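(* Let $p\ge5$ be a prime, $S$ a finite $p$-group of sectional rank $3$ and $\mathcal{F}$ a saturated fusion system on $S$. Then every $\mathcal{F}$-essential subgroup of $S$ of rank $3$ is normal in $S$.
   Context: Rank: minimal size of a generating set; a $p$-group has sectional rank $k$ if all its subgroups have rank at most $k$ and $k$ is minimal. For $P\le S$, $\mathrm{Aut}_{\mathcal{F}}(P)=\mathrm{Hom}_{\mathcal{F}}(P,P)$, $\mathrm{Out}_{\mathcal{F}}(P)=\mathrm{Aut}_{\mathcal{F}}(P)/\mathrm{Inn}(P)$, $P^{\mathcal{F}}=\{P\alpha:\alpha\in\mathrm{Hom}_{\mathcal{F}}(P,S)\}$. $E\le S$ is $\mathcal{F}$-essential if $C_S(P)\le P$ and $|N_S(E)|\ge|N_S(P)|$ for all $P\in E^{\mathcal{F}}$, and $\mathrm{Out}_{\mathcal{F}}(E)$ has a strongly $p$-embedded subgroup. *)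

(* Defs.v *)
From mathcomp Require Import all_boot all_fingroup all_solvable.
Set Implicit Arguments.
Unset Strict Implicit.
Unset Printing Implicit Defensive.
Local Open Scope group_scope.

Section FusionDefs.
Variable gT : finGroupType.
Implicit Types (S P Q E : {set gT}) (f g : {ffun gT -> gT}).

(* A fusion system on S is encoded by the (boolean) predicate
   [F P f] : "f, restricted to P, is a morphism in Hom_F(P, S)".
   Hom_F(P,Q) = { f | F P f and f @: P \subset Q }. *)
Definition is_fusion_system S (F : {set gT} -> {ffun gT -> gT} -> bool) : Prop :=
  (forall P f, F P f ->
         [/\ group_set P, P \subset S, {in P &, {morph f : x y / x * y}},
             {in P &, injective f} & f @: P \subset S]) /\
      (forall P f g, F P f -> {in P, f =1 g} -> F P g) /\
      (forall P y, group_set P -> P \subset S -> y \in S -> F P [ffun x => x ^ y]) /\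
      (forall P Q f, F P f -> group_set Q -> Q \subset P -> F Q f) /\
      (forall P f g, F P f -> F (f @: P) g -> F P [ffun x => g (f x)]) /\
      (forall P f, F P f -> exists g, F (f @: P) g /\ {in P, forall x, g (f x) = x}).

Variable F : {set gT} -> {ffun gT -> gT} -> bool.

Definition fclass P (Q : {set gT}) : Prop := exists f, F P f /\ Q = f @: P.

Definition AutF P : {set {perm gT}} := [set a in Aut P | F P (finfun a)].
Definition AutS S P : {set {perm gT}} :=
  [set a in Aut P | [exists y in 'N_S(P), [forall x in P, a x == x ^ y]]].
Definition InnP P : {set {perm gT}} :=
  [set a in Aut P | [exists y in P, [forall x in P, a x == x ^ y]]].
Definition OutF P := (AutF P / InnP P)%g.

Definition fully_normalized S P : Prop :=
  forall Q, fclass P Q -> #|'N_S(Q)| <= #|'N_S(P)|.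
Definition fully_centralized S P : Prop :=
  forall Q, fclass P Q -> #|'C_S(Q)| <= #|'C_S(P)|.

(* N_phi = { g in N_S(P) : phi^-1 c_g phi in Aut_S(P phi) } *)
Definition Nphi S P f : {set gT} :=
  [set g in 'N_S(P) | [exists h in 'N_S(f @: P),
                         [forall x in P, f (x ^ g) == f x ^ h]]].

Definition saturated (p : nat) S : Prop :=
  is_fusion_system S F /\
  (forall P : {group gT}, P \subset S -> fully_normalized S P ->
      fully_centralized S P /\ p.-Sylow(AutF P) (AutS S P)) /\
  (forall (P : {group gT}) f, F P f -> fully_centralized S (f @: P) ->
      exists f', F (Nphi S P f) f' /\ {in P, f' =1 f}).

End FusionDefs.

Definition strongly_p_embedded (p : nat) (rT : finGroupType) (G H : {set rT}) : bool :=
  [&& group_set H, H \proper G, p %| #|H| &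
      [forall g in G :\: H, ~~ (p %| #|H :&: H :^ g|)]].

Definition essential (gT : finGroupType) (p : nat) (S : {set gT})
    (F : {set gT} -> {ffun gT -> gT} -> bool) (E : {set gT}) : Prop :=
  [/\ group_set E, E \subset S,
      (forall P, fclass F E P -> 'C_S(P) \subset P /\ #|'N_S(P)| <= #|'N_S(E)|) &
      exists H, strongly_p_embedded p (OutF F E) H].

Definition grank (gT : finGroupType) (G : {set gT}) : nat :=
  \big[minn/#|G|]_(A : {set gT} | <<A>> == G) #|A|.

Definition sectional_rank (gT : finGroupType) (S : {set gT}) : nat :=
  \max_(H : {group gT} | H \subset S) grank H.

(* Main.v *)
(* Let N = N_S(E) and suppose N < S. As S has sectional rank 3, no section of S
   is elementary abelian of order p^4. The group Out_F(E) acts faithfully on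
   V = E / Phi(E) = F_p^3 and has a strongly p-embedded subgroup. This forces
   N / E to be generated by one element u of order p, and either u acts as a
   transvection and diag(l^-1, l, 1) belongs to the image of Aut_F(E) for all l
   in a basis adapted to u, or u acts with a single Jordan block and V is
   irreducible.

   In the irreducible case take g in N_S(N) outside N. The series
   E > [E, N] Phi > [[E, N] Phi, N] Phi > Phi is g-invariant below E. By
   irreducibility the p-th power map is either trivial on E modulo
   Psi = [Phi, E] Phi(Phi), which yields a section p^4, or induces an injection
   of V into Phi / Psi; then computing (e^p)^x and e^(x^p) for e in E and
   x = e^g shows that c^p, where c = [e, x], equals both [e, d]^k and [e, d]^-k
   for d = [c, x], which is absurd.

   In the transvection case a torus element extends to tau in Aut_F(N) by
   saturation. Its eigenvalues ("weights") on N > E > Z > D > Phi show that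
   Phi, D and Z are characteristic in N. Let M = N_S(N). After conjugation by
   an element of Aut_F(N) and a Sylow argument, tau normalises Aut_S(N) and
   extends to M, acting with known weights on M > N > L > Z > D > Phi for some
   L normal in M. Weights are multiplicative on commutators, so many commutators
   vanish and C_M(L / Phi) / Phi is elementary abelian of order p^4. *)
Require Import Defs.
From mathcomp Require Import all_boot all_fingroup all_solvable.
From mathcomp Require Import all_algebra all_character ring.
Set Implicit Arguments.
Unset Strict Implicit.
Unset Printing Implicit Defensive.
Local Open Scope group_scope.

(** * Sections of rank at most three *)

(** An element of [S] that normalises N but lies outside N moves [E], since N is the full normaliser
    of [E]. Phi(E) is defined through [E] and is not known to be invariant under such elements. The
    irreducible case therefore uses the invariant subgroup [J, N] Phi(J), with J = [E, N, N] Phi(E),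
    while the transvection case must first recover Phi(E) from N alone.

    Saturation extends automorphisms only from fully normalised subgroups. [E] is one, which carries
    the torus element up to N. N need not be one, so the whole configuration is moved along a
    morphism before the step to M. A second obstacle is that the eigenline of tau in N / Z need not
    be the line L / Z that M fixes; the conjugation in Aut_F(N) makes the two agree.

    The bound p >= 5 serves mainly two purposes: the multiplicative group of F_p has an element l
    for which the weights that must be told apart do differ, and p divides C(p, 2) and C(p, 3),
    which removes the correction terms from p-th powers. *)

Definition sections_le3 (gT : finGroupType) p (S : {group gT}) :=
  forall H K : {group gT},
    H \subset S -> K <| H -> p.-abelem (H / K) -> #|H / K| <= p ^ 3.

Lemma grank_witness_le (gT : finGroupType) (G : {group gT}) :
  exists2 A : {set gT}, <<A>> = G & #|A| = Defs.grank G.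
Proof.
rewrite /Defs.grank.
(* The default value of the iterated minimum is attained too, by [G] as a generating set of
   itself. *)
have: exists2 A : {set gT}, <<A>> = G & #|A| = #|G| by exists (G : {set gT}); rewrite ?genGid.
move: #|G| => n.
elim/big_rec: _ => // A k /eqP defA IH /IH[B genB cardB].
case: (leqP #|A| k) => [le_Ak | lt_kA]; first by exists A; rewrite // (minn_idPl le_Ak).
by exists B => //; rewrite (minn_idPr (ltnW lt_kA)).
Qed.

Lemma grank_le_card (gT : finGroupType) (G : {group gT}) (A : {set gT}) :
  <<A>> = G -> Defs.grank G <= #|A|.
Proof.
move=> genA; rewrite /Defs.grank.
rewrite -big_filter.
have: A \in [seq i <- index_enum {set gT} | <<i>> == (G : {set gT})].
  by rewrite mem_filter genA eqxx mem_index_enum.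
elim: [seq _ <- _ | _] => // B s IH; rewrite inE big_cons => /predU1P[-> | /IH].
  exact: geq_minl.
by apply: leq_trans; apply: geq_minr.
Qed.

Lemma mgrankE (gT : finGroupType) (G : {group gT}) : Defs.grank G = 'm(G).
Proof.
apply/eqP; rewrite eqn_leq; apply/andP; split.
  by have [A genA <-] := grank_witness G; apply: grank_le_card.
by have [A genA <-] := grank_witness_le G; rewrite -genA grank_min.
Qed.

(** A quotient needs no more generators than the group, and for an elementary abelian group the
    number of generators determines the order. This is the form in which the sectional rank
    enters. *)
Lemma sections_le3_of_rank (gT : finGroupType) p (S : {group gT}) :
  prime p -> sectional_rank S <= 3 -> sections_le3 p S.
Proof.
move=> p_pr rS H K sHS nKH abHK.
have: 'm(H) <= 3.
  rewrite -mgrankE; apply: leq_trans rS.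
  exact: (@leq_bigmax_cond _ (fun H : {group gT} => H \subset S) (fun H => Defs.grank H)).
move/(leq_trans (quotient_grank (normal_norm nKH))).
rewrite grank_abelian ?(abelem_abelian abHK) // (rank_abelem abHK) => le3.
by rewrite (card_pgroup (abelem_pgroup abHK)) leq_exp2l // prime_gt1.
Qed.

Lemma card_Phi_quotient (gT : finGroupType) p (E : {group gT}) :
  prime p -> p.-group E -> #|E : 'Phi(E)| = (p ^ 'm(E))%N.
Proof.
move=> p_pr pE.
have abE := Phi_quotient_abelem pE.
have nPE := normal_norm (Phi_normal E).
rewrite -card_quotient // (card_pgroup (abelem_pgroup abE)); congr (p ^ _)%N.
apply/eqP; rewrite -(rank_abelem abE) -(grank_abelian (abelem_abelian abE)).
rewrite eqn_leq quotient_grank //=.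
have [B genB <-] := grank_witness (E / 'Phi(E)).
pose A := (fun x : coset_of 'Phi(E) => repr x) @: B.
have repE x : x \in B -> repr (x : coset_of _) \in E.
  move=> Bx; have: x \in E / 'Phi(E) by rewrite -genB mem_gen.
  case/morphimP=> y Ny Ey ->; rewrite /= val_coset //.
  apply: (subsetP _ _ (mem_repr_rcoset 'Phi(E)%G y)).
  by rewrite mul_subG ?Phi_sub ?sub1set.
have sAE: A \subset E by apply/subsetP=> _ /imsetP[x Bx ->]; apply: repE.
rewrite (leq_trans _ (leq_imset_card (fun x : coset_of 'Phi(E) => repr x) B)) //.
have {1}<-: <<A>> = E; last exact: grank_min.
apply: Phi_nongen; apply/eqP; rewrite eqEsubset join_subG Phi_sub /= sAE /=.
apply: (@subset_trans _ _ ('Phi(E) * <<A>>)); last first.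
  by rewrite mul_subG ?joing_subl // gen_subG joing_subr.
rewrite -quotientSK // -genB gen_subG; apply/subsetP=> x Bx.
rewrite -(coset_reprK x) mem_quotient //= mem_gen //.
exact: (imset_f (fun x : coset_of 'Phi(E) => repr x)).
Qed.

Lemma der_sub_Phi (gT : finGroupType) (p : nat) (E : {group gT}) :
  p.-group E -> [~: E, E] \subset 'Phi(E).
Proof. by move=> pE; have /= -> := Phi_joing pE; apply: joing_subl. Qed.

Lemma expg_Phi (gT : finGroupType) (p : nat) (E : {group gT}) y :
  prime p -> p.-group E -> y \in E -> y ^+ p \in 'Phi(E).
Proof.
move=> p_pr pE Ey; have Ny := subsetP (normal_norm (Phi_normal E)) y Ey.
have abV := Phi_quotient_abelem pE; apply: coset_idr; first by rewrite groupX.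
by rewrite morphX //; case/abelemP: abV => // _; apply; rewrite mem_quotient.
Qed.

Lemma prime_index_nsub (gT : finGroupType) p (A B : {group gT}) :
  prime p -> #|A : B| = p -> ~~ (A \subset B).
Proof. by move=> p_pr; rewrite -indexg_eq1 => ->; apply: contraTneq p_pr => ->. Qed.

Lemma sections_le3S (gT : finGroupType) p (S T : {group gT}) :
  T \subset S -> sections_le3 p S -> sections_le3 p T.
Proof. by move=> sTS rS H K sHT; apply: rS; apply: subset_trans sTS. Qed.

(** A normal subgroup of order p in the p-group [T / B] meets the centre nontrivially, hence lies in
    it. *)
Lemma step_central (gT : finGroupType) p (T A B : {group gT}) :
  prime p -> p.-group T -> A <| T -> B <| T -> B \subset A -> #|A : B| = p ->
  [~: A, T] \subset B.
Proof.
move=> p_pr pT nAT nBT sBA iAB.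
have nBA : B <| A := normalS sBA (normal_sub nAT) nBT.
have qA: #|A / B| = p by rewrite card_quotient ?normal_norm.
rewrite -quotient_cents2 ?(normal_norm nBT) ?(normal_norm nBA) //.
have nil: nilpotent (T / B) by rewrite quotient_nil ?(pgroup_nil pT).
have nAq : A / B <| T / B by rewrite quotient_normal.
have ntA: A / B != 1 by rewrite -cardG_gt1 qA prime_gt1.
have := meet_center_nil nil nAq ntA => ntZ.
have: A / B \subset 'Z(T / B).
  apply/setIidPl/eqP; rewrite eqEcard subsetIl qA.
  have := cardSg (subsetIl (A / B) 'Z(T / B)); rewrite qA.
  case/primeP: p_pr => _ /[apply] /pred2P[/card1_trivg tr | ->]; last by rewrite leqnn.
  by rewrite tr eqxx in ntZ.
by move/subset_trans; apply; apply: subsetIr.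
Qed.

Lemma char_Aut_closed (gT : finGroupType) (K N : {group gT}) (a : {perm gT}) x :
  K \char N -> a \in Aut N -> x \in K -> a x \in K.
Proof.
move=> chK AutNa Kx.
have /charP[sKN /(_ (autm_morphism AutNa) (injm_autm AutNa))] := chK.
rewrite im_autm => /(_ erefl) <-; rewrite -(autmE AutNa) mem_morphim //.
exact: (subsetP sKN).
Qed.

(** * Strongly embedded subgroups *)

Section StronglyEmbedded.
Variables (aT : finGroupType) (p : nat) (G H : {group aT}).
Hypotheses (p_pr : prime p) (emb : strongly_p_embedded p G H).

Lemma se_sub : H \subset G.
Proof. by case/and4P: emb => _ /proper_sub. Qed.

(** For [g] outside [H] the order of [H :&: H :^ g] is prime to p, so this intersection cannot
    contain [x]. *)
Lemma se_mem x g :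
  p.-elt x -> x != 1 -> x \in H -> x \in H :^ g -> g \in G -> g \in H.
Proof.
move=> px ntx Hx Hgx Gg; apply: contraT => notHg.
case/and4P: emb => _ _ _ /forall_inP/(_ g); rewrite inE Gg notHg => /(_ isT)/negP[].
apply: dvdn_trans (_ : #[x] %| _); last by rewrite order_dvdG // inE Hx.
have [k ox] := p_natP px; rewrite ox.
case: k ox => [|k] ox; last by rewrite expnS dvdn_mulr.
by rewrite -order_eq1 ox in ntx.
Qed.

Lemma se_cent x y :
  p.-elt x -> x != 1 -> x \in H -> commute x y -> y \in G -> y \in H.
Proof.
move=> px ntx Hx cxy Gy; apply: (se_mem px ntx Hx _ Gy).
have xy: x ^ y = x by apply/conjg_fixP/commgP.
by rewrite -{1}xy memJ_conjg.
Qed.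

(** Pass through a nontrivial central element [c] of [R]: it commutes with [x], so it lies in [H],
    and all of [R] commutes with [c]. *)
Lemma se_pgroup x (R : {group aT}) :
  p.-elt x -> x != 1 -> x \in H -> p.-group R -> R \subset G -> x \in R -> R \subset H.
Proof.
move=> px ntx Hx pR sRG Rx.
have ntR : R :!=: 1 by apply/trivgPn; exists x.
have: 'Z(R) != 1 by rewrite center_nil_eq1 // (pgroup_nil pR).
case/trivgPn=> c /centerP[Rc cRc] ntc.
have pc: p.-elt c by apply: mem_p_elt pR Rc.
have Hc: c \in H.
  by apply: (se_cent px ntx Hx); [apply/commute_sym/cRc | apply: (subsetP sRG)].
apply/subsetP=> y Ry.
by apply: (se_cent pc ntc Hc); [apply: cRc | apply: (subsetP sRG)].
Qed.

Lemma se_Sylow : exists2 R : {group aT}, p.-Sylow(G) R & R \subset H.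
Proof.
have [x Hx ox] : {x | x \in H & #[x] = p} by apply: Cauchy => //; case/and4P: emb.
have px: p.-elt x by rewrite /p_elt ox pnat_id.
have ntx: x != 1 by rewrite -order_gt1 ox prime_gt1.
have Gx := subsetP se_sub _ Hx.
have sxG: <[x]> \subset G by rewrite cycle_subG.
have [R sylR sxR] := Sylow_superset sxG px.
have Rx: x \in R by rewrite -cycle_subG.
exists R => //.
exact: (se_pgroup px ntx Hx (pHall_pgroup sylR) (pHall_sub sylR)).
Qed.

(** [Q] lies in every Sylow p-subgroup of [G], hence in [H]; being normal it also lies in [H :^ g]
    for some [g] outside [H], which leaves no room for a nontrivial element. *)
Lemma se_pcore1 (Q : {group aT}) : Q <| G -> p.-group Q -> Q :=: 1.
Proof.
move=> nQG pQ; have [R sylR sRH] := se_Sylow.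
have sQH: Q \subset H.
  by apply: subset_trans sRH; apply: subset_trans (pcore_sub_Hall sylR); apply: pcore_max.
apply/eqP; apply: contraT => /trivgPn[x Qx ntx].
case/and4P: emb => _ /properP[_ [g Gg notHg]] _ _.
case/negP: notHg; apply: (se_mem (mem_p_elt pQ Qx) ntx (subsetP sQH _ Qx)) => //.
have: x \in Q :^ g by rewrite (normsP (normal_norm nQG)).
by apply/subsetP; rewrite conjSg.
Qed.

End StronglyEmbedded.

Lemma seJ (aT : finGroupType) p (G H : {group aT}) g :
  g \in G -> strongly_p_embedded p G H -> strongly_p_embedded p G (H :^ g)%G.
Proof.
move=> Gg /and4P[_ prH pH /forall_inP seH]; apply/and4P; split=> //.
- exact: groupP.
- by rewrite -(conjGid Gg) /proper !conjSg.
- by rewrite cardJg.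
apply/forall_inP=> k /setDP[Gk notHk].
have Dk: k = (k ^ g^-1) ^ g by rewrite conjgKV.
have Gk': k ^ g^-1 \in G by rewrite groupJ ?groupV.
have := seH (k ^ g^-1); rewrite in_setD Gk' andbT.
rewrite -(memJ_conjg H g (k ^ g^-1)) -Dk notHk => /(_ isT).
have -> //: #|H :&: H :^ (k ^ g^-1)| = #|H :^ g :&: (H :^ g) :^ k|.
rewrite -(cardJg (H :&: _) g) conjIg -!conjsgM; congr #|pred_of_set (_ :&: _ :^ _)|.
by rewrite /conjg invgK !mulgA mulgKV.
Qed.

Lemma se_over (aT : finGroupType) p (G H U : {group aT}) :
  prime p -> strongly_p_embedded p G H -> p.-group U -> U \subset G ->
  exists2 K : {group aT}, strongly_p_embedded p G K & U \subset K.
Proof.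
move=> p_pr emb pU sUG; have [R sylR sRH] := se_Sylow p_pr emb.
have [g Gg sUR] := Sylow_subJ sylR sUG pU.
exists (H :^ g)%G; first exact: seJ.
by apply: subset_trans sUR _; rewrite conjSg.
Qed.

(** * Commutators and powers *)

Lemma dvdn_expg1 (gT : finGroupType) (x : gT) p n : x ^+ p = 1 -> p %| n -> x ^+ n = 1.
Proof. by move=> xp /dvdnP[k ->]; rewrite mulnC expgM xp expg1n. Qed.

(** [x] acts on [e], [c], [d], [f] as one unipotent Jordan block; the binomial exponents are the
    entries of the n-th power of that block. *)
Lemma expg_conj_block (gT : finGroupType) (e c d f x : gT) n :
  e ^ x = e * c -> c ^ x = c * d -> d ^ x = d * f -> f ^ x = f ->
  commute c d -> commute c f -> commute d f ->
  e ^ (x ^+ n) = e * c ^+ n * d ^+ 'C(n, 2) * f ^+ 'C(n, 3).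
Proof.
move=> ex cx dx fx cd cf df; elim: n => [|n IH]; first by rewrite conjg1 !mulg1.
rewrite expgSr conjgM IH !conjMg !conjXg ex cx dx fx.
rewrite (expgMn _ cd) (expgMn _ df) !binS expgS !expgD !mulgA bin1.
have cdX i j : commute (c ^+ i) (d ^+ j) by apply: commuteX2.
have dfX i j : commute (d ^+ i) (f ^+ j) by apply: commuteX2.
rewrite -!mulgA; do 3![congr (_ * _)].
rewrite !mulgA -(commuteX2 _ _ (commute_refl d)) -!mulgA; do 2![congr (_ * _)].
by rewrite (commuteX2 _ _ (commute_refl f)).
Qed.

(* If [e ^+ p] and [x ^+ p] are the same power of [[~ e, c]] and [[~ x, c]],
   computing [(e ^+ p) ^ x] and [e ^ (x ^+ p)] gives
   [c ^+ p = [~ e, d] ^+ k = [~ e, d] ^- k]. *)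
Lemma Iwahori_relation (gT : finGroupType) (e c d f x r r' : gT) p k :
  prime p -> 5 <= p ->
  e ^ x = e * c -> c ^ x = c * d -> d ^ x = d * f -> f ^ x = f ->
  commute c d -> commute c f -> commute d f ->
  commute c [~ e, c] -> commute d [~ e, c] -> commute e [~ e, c] -> commute e [~ e, d] ->
  commute c [~ e, d] -> commute d [~ e, d] -> commute [~ e, c] [~ e, d] ->
  d ^+ p = 1 -> f ^+ p = 1 -> [~ e, c] ^+ p = 1 ->
  e ^+ p = [~ e, c] ^+ k * r -> r ^ x = r ->
  x ^+ p = [~ x, c] ^+ k * r' -> commute e r' -> commute [~ e, d] r' ->
  (c ^+ p) ^+ 2 = 1.
Proof.
move=> p_pr p_ge5 ex cx dx fx cd cf df c_ec d_ec e_ec e_ed c_ed d_ed ec_ed dp fp ecp ep rx xp er' edr'.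
(* The correction terms below have exponents C(p, 2) and C(p, 3). *)
have p_dvd m : 0 < m < 5 -> p %| 'C(p, m).
  by case/andP=> m0 m5; apply: prime_dvd_bin; rewrite // m0 (leq_trans m5).
have cj (u v : gT) : commute u v -> v ^ u = v.
  by move=> cuv; apply/conjg_fixP/commgP; apply: commute_sym.
have cp1 : c ^+ p = [~ e, d] ^+ k.
  have: (e ^+ p) ^ x = e ^+ p * c ^+ p.
    rewrite conjXg ex expMg_Rmul; last 2 first.
    - by rewrite -(invg_comm e c); apply: commuteV.
    - by rewrite -(invg_comm e c); apply: commuteV.
    by rewrite -invg_comm expVgn (dvdn_expg1 ecp) ?p_dvd // invg1 mulg1.
  rewrite {1}ep conjMg rx conjXg conjRg ex cx.
  have -> : [~ e * c, c * d] = [~ e, c] * [~ e, d].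
    rewrite commgMJ !commMgJ commgg mulg1.
    have -> : [~ c, d] = 1 by apply/eqP/commgP.
    by rewrite mulg1 !cj // ec_ed.
  rewrite (expgMn _ ec_ed) (commuteX2 _ _ ec_ed) -mulgA -ep.
  by rewrite -(commuteX2 _ _ e_ed) => /mulgI.
have cp2 : c ^+ p = [~ e, d] ^- k.
  have: e ^ (x ^+ p) = e * c ^+ p.
    rewrite (expg_conj_block _ ex cx dx fx cd cf df).
    by rewrite (dvdn_expg1 dp) ?(dvdn_expg1 fp) ?p_dvd // !mulg1.
  have xc : [~ x, c] = d^-1 by rewrite -invg_comm commgEl cx mulKg.
  have edV : [~ e, d^-1 ^+ k] = [~ e, d] ^- k.
    have edV1 : [~ e, d^-1] = [~ e, d]^-1 by apply: commgV.
    by rewrite commgX ?edV1 ?expVgn //; apply/commute_sym/commuteV/commute_sym/commuteV.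
  rewrite xp xc conjgM -[e ^ _](mulKVg e) -commgEl edV conjMg conjVg !conjXg !cj //.
  by move/mulgI.
by rewrite expgS expg1 {1}cp1 cp2 mulgV.
Qed.

Lemma commute_coset (gT : finGroupType) (C : {group gT}) x y :
  x \in 'N(C) -> y \in 'N(C) -> [~ x, y] \in C -> commute (coset C x) (coset C y).
Proof.
by move=> Nx Ny Cxy; apply/commgP; rewrite -morphR //; apply/eqP/coset_id.
Qed.

Lemma comm_coset (gT : finGroupType) (C : {group gT}) x y :
  x \in 'N(C) -> y \in 'N(C) -> commute (coset C x) (coset C y) -> [~ x, y] \in C.
Proof.
by move=> Nx Ny /commgP/eqP; rewrite -morphR // => /coset_idr->; rewrite ?groupR.
Qed.

Lemma eq_coset (gT : finGroupType) (C : {group gT}) x y :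
  x \in 'N(C) -> y \in 'N(C) -> coset C x = coset C y -> x^-1 * y \in C.
Proof.
move=> Nx Ny exy; apply: coset_idr; first by rewrite groupM ?groupV.
by rewrite morphM ?groupV // morphV //= exy mulVg.
Qed.

Lemma coset_eq (gT : finGroupType) (C : {group gT}) x y :
  x \in 'N(C) -> x^-1 * y \in C -> coset C x = coset C y.
Proof.
move=> Nx Cxy; have Nxy := subsetP (normG C) _ Cxy.
by rewrite -[y](mulKVg x) morphM //= (coset_id Cxy) mulg1.
Qed.

(** Used as an induction principle: a property that defines a subgroup, holds on [B] and holds at
    one element outside [B], holds on all of [A]. *)
Lemma prime_index_eq (gT : finGroupType) (A B K : {group gT}) v :
  prime #|A : B| -> B \subset A -> B \subset K -> K \subset A ->
  v \in K -> v \notin B -> K :=: A.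
Proof.
move=> pAB sBA sBK sKA Kv notBv.
have /maxgroupP[_ maxB] := p_index_maximal sBA pAB.
apply/eqP; rewrite eqEproper sKA; apply/negP=> prKA.
by case/negP: notBv; rewrite -(maxB K prKA sBK).
Qed.

(** Since [N] normalises [C], the elements of [A] that commute with [N] modulo [C] form a subgroup.
    It contains [B] and [v], hence is [A]. The next lemma does the same in the second argument of
    the commutator. *)
Lemma comm_step (gT : finGroupType) (N A B C : {group gT}) v :
  N \subset 'N(C) -> A \subset N -> B \subset A -> prime #|A : B| ->
  v \in A -> v \notin B -> (forall n, n \in N -> [~ v, n] \in C) ->
  [~: B, N] \subset C -> [~: A, N] \subset C.
Proof.
move=> nCN sAN sBA pAB Av notBv vNC BNC.
have nCA := subset_trans sAN nCN.
pose K := [set a in A | [forall n in N, [~ a, n] \in C]].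
have KP a : reflect (a \in A /\ forall n, n \in N -> [~ a, n] \in C) (a \in K).
  by rewrite inE; apply: (iffP andP) => -[Aa /forall_inP].
have gK : group_set K.
  apply/group_setP; split; first by apply/KP; split=> // n _; rewrite comm1g group1.
  move=> a b /KP[Aa Ca] /KP[Ab Cb]; apply/KP; split=> [|n Nn]; first exact: groupM.
  rewrite commMgJ groupM ?Cb // memJ_norm ?Ca //.
  exact: (subsetP nCA).
have defA : Group gK :=: A.
  apply: (prime_index_eq pAB sBA _ _ _ notBv).
  - apply/subsetP=> b Bb; apply/KP; split=> [|n Nn]; first exact: (subsetP sBA).
    by apply: (subsetP BNC); apply: mem_commg.
  - by apply/subsetP=> a /KP[].
  - exact/KP.
rewrite gen_subG; apply/subsetP=> _ /imset2P[a n Aa Nn ->].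
by rewrite -defA in Aa; have /KP[_] := Aa; apply.
Qed.

Lemma comm_step_r (gT : finGroupType) (N E C : {group gT}) v y :
  N \subset 'N(C) -> E \subset N -> prime #|N : E| ->
  y \in N -> y \notin E -> [~ v, y] \in C -> (forall n, n \in E -> [~ v, n] \in C) ->
  forall n, n \in N -> [~ v, n] \in C.
Proof.
move=> nCN sEN pNE Ny notEy Cvy vEC.
pose K := [set n in N | [~ v, n] \in C].
have gK : group_set K.
  apply/group_setP; split; first by rewrite inE group1 commg1 group1.
  move=> a b; rewrite !inE => /andP[Na Ca] /andP[Nb Cb]; rewrite groupM // commgMJ.
  by rewrite groupM // memJ_norm // (subsetP nCN).
have defN : Group gK :=: N.
  apply: (prime_index_eq pNE sEN _ _ _ notEy).
  - by apply/subsetP=> n En; rewrite inE vEC // (subsetP sEN).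
  - by apply/subsetP=> n; rewrite inE => /andP[].
  - by rewrite inE Ny.
by move=> n; rewrite -{1}defN inE => /andP[].
Qed.

(** The correction between the two sides is a commutator raised to C(p, 2), a multiple of p for odd
    p. *)
Lemma class2_expM (gT : finGroupType) p (G Z : {group gT}) :
  prime p -> odd p -> [~: G, G] \subset Z -> Z \subset 'C(G) ->
  (forall z, z \in Z -> z ^+ p = 1) -> {in G &, {morph (fun x => x ^+ p) : x y / x * y}}.
Proof.
move=> p_pr p_odd sGZ cZG expZ x y Gx Gy.
have Zr: [~ y, x] \in Z by rewrite (subsetP sGZ) // mem_commg.
have cZ u v : u \in Z -> v \in G -> commute v u.
  by move=> Zu Gv; apply/commute_sym/(centP (subsetP cZG u Zu)).
rewrite expMg_Rmul; [|exact: cZ..].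
rewrite (dvdn_expg1 (expZ _ Zr)) ?mulg1 //.
by rewrite bin2odd // dvdn_mulr.
Qed.

Lemma index_pgroup_eq (gT : finGroupType) p (A B : {group gT}) :
  prime p -> p.-group A -> B \subset A -> ~~ (A \subset B) -> #|A : B| <= p -> #|A : B| = p.
Proof.
move=> p_pr pA sBA nsAB le_p.
have [k ek] := p_natP (pnat_dvd (dvdn_indexg A B) pA); move: le_p nsAB; rewrite ek.
case: k ek => [|[|k]] ek; rewrite ?expn1 //; first by rewrite -indexg_eq1 ek.
by rewrite !expnS leqNgt ltn_Pmulr ?prime_gt0 // (leq_trans (prime_gt1 p_pr)) // leq_pmulr // expn_gt0 prime_gt0.
Qed.

Lemma index_pgroup_ge (gT : finGroupType) p (A B : {group gT}) :
  prime p -> p.-group A -> ~~ (A \subset B) -> p <= #|A : B|.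
Proof.
move=> p_pr pA nsAB.
have [k ek] := p_natP (pnat_dvd (dvdn_indexg A B) pA).
rewrite ek; case: k ek => [/eqP | k _]; first by rewrite indexg_eq1 (negPf nsAB).
by rewrite expnS leq_pmulr // expn_gt0 prime_gt0.
Qed.

(** Otherwise [A / B] would be equal to its commutator with the nilpotent group [N / B], hence
    trivial. *)
Lemma nil_step (gT : finGroupType) (p : nat) (N A B : {group gT}) :
  p.-group N -> A \subset N -> N \subset 'N(A) -> B <| N -> ~~ (A \subset B) ->
  ~~ (A \subset [~: A, N] <*> B).
Proof.
move=> pN sAN nAN nBN; apply: contra => sA.
have nBN' := normal_norm nBN; have nBA := subset_trans sAN nBN'.
rewrite -quotient_sub1 //; have [-> | ntA] := eqVneq (A / B) 1; first exact: subxx.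
have prA := nil_comm_properl (quotient_nil B (pgroup_nil pN)) (quotientS B sAN) ntA.
have {}prA : [~: A / B, N / B] \proper A / B.
  by apply: prA; rewrite subsetI subxx quotient_norms.
have nBR: [~: A, N] \subset 'N(B).
  by rewrite (subset_trans _ nBA) // commg_subl.
case/negP: (proper_subn prA); rewrite -quotientR //.
by rewrite -(quotientYidr nBR) quotientS.
Qed.

(** The action of a Jordan block on its exterior square: with central commutators,
    [[~ e * c, c * d]] and its companions expand bilinearly, and the central [f] contributes
    nothing. *)
Lemma class2_conj (gT : finGroupType) (e c d f x : gT) :
  e ^ x = e * c -> c ^ x = c * d -> d ^ x = d * f ->
  {in [:: e; c; d], forall u, {in [:: [~ e, c]; [~ e, d]; [~ c, d]; f], forall v, commute u v}} ->
  [/\ [~ e, c] ^ x = [~ e, c] * ([~ e, d] * [~ c, d]),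
      [~ e, d] ^ x = [~ e, d] * [~ c, d] & [~ c, d] ^ x = [~ c, d]].
Proof.
move=> ex cx dx cen.
have cj u v : u \in [:: e; c; d] -> v \in [:: [~ e, c]; [~ e, d]; [~ c, d]; f] -> v ^ u = v.
  by move=> uin vin; apply/conjg_fixP/commgP; apply/commute_sym/cen.
have uf1 u : u \in [:: e; c; d] -> [~ u, f] = 1.
  by move=> uin; apply/eqP/commgP/cen => //; rewrite !inE eqxx !orbT.
have [ein cin din] : [/\ e \in [:: e; c; d], c \in [:: e; c; d] & d \in [:: e; c; d]].
  by rewrite !inE !eqxx !orbT.
have [v1 v2 v3] : [/\ [~ e, c] \in [:: [~ e, c]; [~ e, d]; [~ c, d]; f],
   [~ e, d] \in [:: [~ e, c]; [~ e, d]; [~ c, d]; f] & [~ c, d] \in [:: [~ e, c]; [~ e, d]; [~ c, d]; f]].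
  by rewrite !inE !eqxx !orbT.
have ecdc : commute [~ e, c] [~ e, d].
  rewrite [X in commute _ X]commgEl; apply: commuteM.
    by apply/commuteV/commute_sym/cen.
  by rewrite conjgE; apply: commuteM; [apply/commuteV|apply: commuteM]; apply/commute_sym/cen.
have eccd : commute [~ e, c] [~ c, d].
  rewrite [X in commute _ X]commgEl; apply: commuteM.
    by apply/commuteV/commute_sym/cen.
  by rewrite conjgE; apply: commuteM; [apply/commuteV|apply: commuteM]; apply/commute_sym/cen.
have fj u : u \in [:: e; c; d] -> u ^ f = u.
  move=> uin; apply/conjg_fixP/commgP; apply: cen => //; by rewrite !inE eqxx !orbT.
rewrite !conjRg ex cx dx !commgMJ !commMgJ !commgg !uf1 //.
have edf : [~ e, d] ^ f = [~ e, d] by rewrite conjRg !fj.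
have cdf : [~ c, d] ^ f = [~ c, d] by rewrite conjRg !fj.
split.
- by rewrite mulg1 !cj //; apply/esym; apply: commuteM.
- by rewrite conj1g !mul1g (cj c [~ e, d]) // conjMg edf cdf.
- by rewrite conj1g !mul1g mulg1 (cj d [~ c, d]).
Qed.

Lemma prime_index_exp (gT : finGroupType) p (N E : {group gT}) y :
  E <| N -> #|N : E| = p -> y \in N -> y ^+ p \in E.
Proof.
move=> nEN iNE Ny; have Ny' := subsetP (normal_norm nEN) y Ny.
apply: coset_idr; first by rewrite groupX.
by rewrite morphX // -iNE -card_quotient ?normal_norm // expg_cardG // mem_quotient.
Qed.

Lemma prime_index_der (gT : finGroupType) p (N E : {group gT}) :
  prime p -> E <| N -> #|N : E| = p -> [~: N, N] \subset E.
Proof.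
move=> p_pr nE iE; rewrite der1_min ?(normal_norm nE) //.
by rewrite cyclic_abelian // prime_cyclic // card_quotient ?(normal_norm nE) // iE.
Qed.

(** * Weights *)

(** [s] acts on the section [A / B] as the scalar [i]. It is a bare function, so that automorphisms,
    which are permutations, and fusion morphisms, which are finite functions, are treated alike;
    scalars are natural numbers read modulo p. *)
Definition weight (gT : finGroupType) (s : gT -> gT) (A B : {set gT}) i :=
  forall v, v \in A -> v ^- i * s v \in B.

Section Weights.
Variables (gT : finGroupType) (p : nat) (M : {group gT}) (s : gT -> gT).
Hypotheses (p_pr : prime p) (sM : {in M &, {morph s : x y / x * y}}).
Implicit Types (A B C D : {group gT}).

Lemma weight_id1 : s 1 = 1.
Proof. by apply: (mulgI (s 1)); rewrite -sM ?mulg1. Qed.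

Lemma weight_idX x n : x \in M -> s (x ^+ n) = s x ^+ n.
Proof.
move=> Mx; elim: n => [|n IH]; first exact: weight_id1.
by rewrite !expgS sM ?groupX // IH.
Qed.

Lemma weight_idV x : x \in M -> s x^-1 = (s x)^-1.
Proof.
by move=> Mx; apply: (mulgI (s x)); rewrite -sM ?groupV // !mulgV weight_id1.
Qed.

Lemma weight_idR x y : x \in M -> y \in M -> s [~ x, y] = [~ s x, s y].
Proof.
by move=> Mx My; rewrite /commg /conjg !sM ?weight_idV ?groupM ?groupV.
Qed.

Lemma weight_stable A B i v : weight s A B i -> B \subset A -> v \in A -> s v \in A.
Proof.
move=> wt sBA Av; rewrite -(mulKVg (v ^+ i) (s v)) groupM ?groupX //.
exact/(subsetP sBA)/wt.
Qed.

Lemma expg_eq_mod (rT : finGroupType) (x : rT) i j :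
  x ^+ p = 1 -> x ^+ i = x ^+ j -> x != 1 -> i = j %[mod p].
Proof.
move=> xp /eqP; rewrite eq_expg_mod_order => /eqP eij ntx.
have : #[x] %| p by rewrite order_dvdn xp.
by case/primeP: p_pr => _ /[apply] /pred2P[/eqP|<- //]; rewrite order_eq1 (negPf ntx).
Qed.

(** In a section on which [s] is a scalar, an element scaled by a different scalar is trivial. This
    is how p-th powers are pushed down a series of subgroups. *)
Lemma weight_inj A B i j v : A \subset 'N(B) -> weight s A B i ->
  v \in A -> v ^+ p \in B -> v ^- j * s v \in B -> i != j %[mod p] -> v \in B.
Proof.
move=> nBA wt Av vp sv neq; have Nv := subsetP nBA v Av.
apply: coset_idr => //; apply/eqP; apply: contraNT neq => ntv; apply/eqP.
apply: (expg_eq_mod _ _ ntv); rewrite -!morphX //=; first exact: coset_id.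
have: v ^- j * s v * (v ^- i * s v)^-1 \in B by rewrite groupM ?groupV ?wt.
rewrite invMg invgK mulgA mulgK => Bv.
rewrite -(mulKVg (v ^+ j) (v ^+ i)) morphM ?groupM ?groupV ?groupX //=.
by rewrite (coset_id Bv) mulg1.
Qed.

Lemma weight_eqmod A B i j : A \subset 'N(B) -> (forall v, v \in A -> v ^+ p \in B) ->
  weight s A B i -> i = j %[mod p] -> weight s A B j.
Proof.
move=> nBA expA wt eij v Av; have Nv := subsetP nBA v Av.
rewrite -(mulKVg (v ^+ i) (s v)) mulgA groupM ?wt //.
apply: eq_coset; rewrite ?groupX // !morphX //=.
have /eqP vp : coset B v ^+ p == 1 by rewrite -morphX //=; apply/eqP/coset_id/expA.
by rewrite -(expg_mod j vp) -eij expg_mod.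
Qed.

Lemma prime_index_weight A B : A \subset M -> B \subset A -> A \subset 'N(B) -> #|A : B| = p ->
  (forall v, v \in A -> s v \in A) -> (forall v, v \in B -> s v \in B) ->
  exists i, weight s A B i.
Proof.
move=> sAM sBA nBA iAB sA sB.
have /subsetPn[m Am notBm] := prime_index_nsub p_pr iAB.
have pAB : prime #|A : B| by rewrite iAB.
have sKA : <[m]> <*> B \subset A by rewrite join_subG cycle_subG Am.
have Km : m \in <[m]> <*> B by rewrite (subsetP (joing_subl _ _)) ?cycle_id.
have defA : <[m]> * B = A.
  rewrite -norm_joinEl; last by rewrite cycle_subG (subsetP nBA).
  exact: (prime_index_eq pAB sBA (joing_subr _ _) sKA Km notBm).
have gen v : v \in A -> exists n, exists2 b, b \in B & v = m ^+ n * b.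
  by rewrite -defA => /mulsgP[_ b /cycleP[n ->] Bb ->]; exists n, b.
have [i [b Bb smE]] := gen _ (sA m Am).
exists i => v Av; have [n [b' Bb' ->]] := gen v Av.
have Mm := subsetP sAM m Am; have Mb' := subsetP sAM _ (subsetP sBA b' Bb').
have Nm := subsetP nBA m Am; have NB := subsetP (normG B).
rewrite sM ?groupX // weight_idX // smE; apply: eq_coset.
- by rewrite groupX // groupM ?groupX // NB.
- by rewrite groupM ?groupX ?groupM ?groupX // NB // sB.
have tM x y : x \in 'N(B) -> y \in 'N(B) -> coset B (x * y) = coset B x * coset B y.
  by move=> Nx Ny; rewrite morphM.
have tX x k : x \in 'N(B) -> coset B (x ^+ k) = coset B x ^+ k by move=> Nx; rewrite morphX.
have [Nb Nb' Nsb'] := And3 (NB _ Bb) (NB _ Bb') (NB _ (sB _ Bb')).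
have Nmn := groupX n Nm; have Nmi := groupX i Nm; have Nmib := groupM Nmi Nb.
rewrite (tX _ _ (groupM Nmn Nb')) (tM _ _ Nmn Nb') (tM _ _ (groupX n Nmib) Nsb').
rewrite (tX _ _ Nmib) (tM _ _ Nmi Nb) !tX // (coset_id Bb) (coset_id Bb').
by rewrite (coset_id (sB _ Bb')) !mulg1 -!expgM mulnC.
Qed.

(** Modulo [C] the commutator is a bilinear map from [A / A'] and [B / B'] to [D / C]. Applying [s]
    to [[~ a, b]] gives its power [r] on one side and its power [i * j] on the other. It is mostly
    used in the contrapositive: if the weights do not fit, the commutator vanishes. *)
Lemma weight_comm A B A' B' C D i j r a b :
  M \subset 'N(C) -> A \subset M -> B \subset M -> A' \subset A -> B' \subset B ->
  [~: A', B] \subset C -> [~: A, B'] \subset C -> [~: A, B] \subset D -> D \subset M ->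
  [~: D, M] \subset C -> weight s A A' i -> weight s B B' j -> weight s D C r ->
  a \in A -> b \in B -> [~ a, b] ^+ p \in C -> [~ a, b] \notin C -> r = i * j %[mod p].
Proof.
move=> nCM sAM sBM sA'A sB'B A'BC AB'C ABD sDM DMC wA wB wD Aa Bb abp notCab.
have Ma := subsetP sAM a Aa; have Mb := subsetP sBM b Bb.
have Dab : [~ a, b] \in D by rewrite (subsetP ABD) ?mem_commg.
have NC y : y \in M -> y \in 'N(C) by apply/subsetP.
have Mab := subsetP sDM _ Dab.
pose t := coset C.
have ntab : t [~ a, b] != 1 by apply: contra notCab => /eqP/coset_idr->; rewrite ?NC.
have := wA a Aa; set a' := _ * s a => A'a'.
have := wB b Bb; set b' := _ * s b => B'b'.
have saE : s a = a ^+ i * a' by rewrite mulKVg.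
have sbE : s b = b ^+ j * b' by rewrite mulKVg.
have Aa' := subsetP sA'A _ A'a'; have Bb' := subsetP sB'B _ B'b'.
have Ma' := subsetP sAM _ Aa'; have Mb' := subsetP sBM _ Bb'.
have tM x y : x \in M -> y \in M -> t (x * y) = t x * t y.
  by move=> Mx My; rewrite /t morphM ?NC.
have tX x k : x \in M -> t (x ^+ k) = t x ^+ k by move=> Mx; rewrite /t morphX ?NC.
have tR x y : x \in M -> y \in M -> t [~ x, y] = [~ t x, t y].
  by move=> Mx My; rewrite /t morphR ?NC.
have cD x y : x \in D -> y \in M -> commute (t x) (t y).
  move=> Dx My; have Mx := subsetP sDM x Dx.
  by apply: commute_coset; rewrite ?NC // (subsetP DMC) ?mem_commg.
apply: (expg_eq_mod _ _ ntab); rewrite -!tX //; first exact: coset_id.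
have -> : t ([~ a, b] ^+ r) = t (s [~ a, b]).
  apply: coset_eq; first by rewrite NC ?groupX.
  exact: wD.
have Mai := groupX i Ma; have Mbj := groupX j Mb.
rewrite weight_idR // saE sbE tX // !tR // ?(groupM Mai Ma') ?(groupM Mbj Mb') //.
rewrite (tM _ _ Mai Ma') (tM _ _ Mbj Mb') !tX //.
have ca'B y : y \in B -> [~ t a', t y] = 1.
  move=> By; have My := subsetP sBM y By; rewrite -tR //; apply: coset_id.
  by rewrite (subsetP A'BC) ?mem_commg.
have cAb' y : y \in A -> [~ t y, t b'] = 1.
  move=> Ay; have My := subsetP sAM y Ay; rewrite -tR //; apply: coset_id.
  by rewrite (subsetP AB'C) ?mem_commg.
have e1 : [~ t a', t b ^+ j * t b'] = 1.
  by rewrite -tX // -tM // ca'B // groupM ?groupX.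
have e2 : [~ t a ^+ i, t b'] = 1 by rewrite -tX // cAb' // groupX.
have cab x : x \in M -> commute (t x) [~ t a, t b].
  by move=> Mx; rewrite -tR //; apply/commute_sym/cD.
have cj x y : commute x y -> y ^ x = y :> coset_of C.
  by move=> cxy; apply/conjg_fixP/commgP; apply: commute_sym.
rewrite commMgJ e1 mulg1 commgMJ e2 mul1g (commXXg i j (cab a Ma) (cab b Mb)).
by rewrite !cj //; apply/commuteX/cab.
Qed.

End Weights.

(** The conjugacy class of [u] in [N / K] lies in one coset of [L / K], which bounds its length. *)
Lemma cent_mod_index (gT : finGroupType) (N K L : {group gT}) u :
  K <| N -> K \subset L -> L \subset N -> u \in N ->
  (forall n, n \in N -> [~ u, n] \in L) ->
  exists C : {group gT}, [/\ C \subset N, #|N : C| <= #|L : K| &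
    forall n, (n \in C) = (n \in N) && ([~ u, n] \in K)].
Proof.
move=> nKN sKL sLN Nu uNL; have nKN' := normal_norm nKN.
have NK y : y \in N -> y \in 'N(K) by apply/subsetP.
pose C := [set n in N | [~ u, n] \in K].
have gC : group_set C.
  apply/group_setP; split; first by rewrite inE group1 commg1 group1.
  move=> a b; rewrite !inE => /andP[Na Ca] /andP[Nb Cb]; rewrite groupM // commgMJ.
  by rewrite groupM // memJ_norm // NK.
have sCN : C \subset N by apply/subsetP=> n; rewrite inE => /andP[].
exists (Group gC); split=> [//||n]; last by rewrite inE.
have sKC : K \subset C.
  apply/subsetP=> k Kk; rewrite inE (subsetP (normal_sub nKN)) //=.
  by rewrite commgEr groupM // memJ_norm ?groupV // NK.
have qC : C / K = 'C_(N / K)[coset K u].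
  apply/setP=> x; apply/idP/idP.
    case/morphimP=> n Nn; rewrite inE => /andP[Nn' Cn] ->; rewrite inE mem_quotient //=.
    by apply/cent1P/commute_sym/commute_coset; rewrite ?NK.
  case/setIP=> /morphimP[n Nn Nn' ->] /cent1P cn; apply: mem_morphim => //.
  by rewrite inE Nn' comm_coset ?NK //; apply: commute_sym.
have -> : #|N : C| = #|coset K u ^: (N / K)|.
  rewrite -index_cent1 -qC.
  by rewrite -(@index_quotient_eq _ N K (Group gC)) // subIset // sKC orbT.
have sub : coset K u ^: (N / K) \subset coset K u *: (L / K).
  apply/subsetP=> _ /imsetP[_ /morphimP[n Nn Nn' ->] ->].
  rewrite -morphJ ?NK // conjg_mulR morphM ?NK ?groupR //= mem_lcoset mulKg.
  by rewrite mem_quotient ?uNL.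
apply: leq_trans (subset_leq_card sub) _; rewrite card_lcoset card_quotient //.
exact: subset_trans sLN nKN'.
Qed.

(* Otherwise N / (K1 :&: K2) has order p^5 and, being a three generator group of
   class two with derived subgroup of order p^2, it contains an elementary
   abelian subgroup of order p^4. *)
Lemma pencil (gT : finGroupType) p (N K1 K2 Z1 : {group gT}) :
  prime p -> p.-group N -> sections_le3 p N ->
  K1 <| N -> K2 <| N -> (forall y, y \in N -> y ^+ p \in K1 :&: K2) ->
  #|N : K1| = (p ^ 4)%N -> #|N : K2| = (p ^ 4)%N ->
  #|[~: N, N] <*> K1 : K1| = p -> #|[~: N, N] <*> K2 : K2| = p ->
  K1 \subset Z1 -> Z1 \subset N -> [~: Z1, N] \subset K1 ->
  ~~ (Z1 \subset [~: N, N] <*> K1) -> K1 :=: K2.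
Proof.
move=> p_pr pN secN nK1 nK2 expN iK1 iK2 iQ1 iQ2 sK1Z1 sZ1N Z1NK1 nsZ1Q.
have p_gt0 := prime_gt0 p_pr; have p_gt1 := prime_gt1 p_pr.
pose Q1 := [~: N, N] <*> K1; pose Q2 := [~: N, N] <*> K2.
have nQN (K : {group gT}) : K <| N -> [~: N, N] <*> K <| N.
  move=> nK; rewrite /normal join_subG (normal_sub nK) commg_subl normG /=.
  by apply: normsY; [apply: normsRr | apply: normal_norm].
have iNQ (K : {group gT}) : K <| N -> #|N : K| = (p ^ 4)%N -> #|[~: N, N] <*> K : K| = p ->
    #|N : [~: N, N] <*> K| = (p ^ 3)%N.
  move=> nK iK iQ; apply/eqP; rewrite -(eqn_pmul2r p_gt0) -{1}iQ.
  by rewrite Lagrange_index ?joing_subr ?(normal_sub (nQN K nK)) // iK -expnSr.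
have abN (Q : {group gT}) : Q <| N -> [~: N, N] \subset Q -> K1 :&: K2 \subset Q -> #|N : Q| <= p ^ 3.
  move=> nQ sNQ sKQ; rewrite -card_quotient ?normal_norm //; apply: secN => //.
  apply/abelemP=> //; split; first by rewrite /abelian quotient_cents2 ?normal_norm.
  move=> _ /morphimP[y Ny Ny' ->]; rewrite -morphX //; apply/coset_id/(subsetP sKQ).
  exact: expN.
(* The quotient of [N] by [Q1 :&: Q2] is elementary abelian, so it has order at most p^3, which is
   already the index of each of the two. *)
have eqQ : Q1 = Q2.
  have le3 : #|N : Q1 :&: Q2| <= p ^ 3.
    apply: (abN (Q1 :&: Q2)%G); first by rewrite normalI ?nQN.
      by rewrite subsetI !joing_subl.
    by rewrite setISS ?joing_subr.
  have meetE (A B : {group gT}) : A <| N -> #|N : A| = (p ^ 3)%N -> #|N : A :&: B| <= p ^ 3 -> A :&: B = A.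
    move=> nA iA leAB; apply/setIidPl/setIidPl/eqP; rewrite eqEcard subsetIl /=.
    rewrite -(@leq_pmul2r (p ^ 3)) ?expn_gt0 ?p_gt0 // -{1}iA Lagrange ?normal_sub //.
    rewrite -(Lagrange (subset_trans (subsetIl A B) (normal_sub nA))) leq_mul2l leAB orbT //.
  have e1 := meetE _ _ (nQN _ nK1) (iNQ _ nK1 iK1 iQ1) le3.
  have le3' : #|N : Q2 :&: Q1| <= p ^ 3 by rewrite setIC.
  have e2 := meetE _ _ (nQN _ nK2) (iNQ _ nK2 iK2 iQ2) le3'.
  by rewrite -[LHS]e1 setIC -[RHS]e2.
have nQ1 := nQN _ nK1; have iNQ1 := iNQ _ nK1 iK1 iQ1.
have sK2Q : K2 \subset Q1 by rewrite eqQ joing_subr.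
have sK1Q : K1 \subset Q1 by apply: joing_subr.
apply/eqP; apply: contraT => neqK.
pose K := (K1 :&: K2)%G.
have nK : K <| N by rewrite normalI.
have sKK1 : K \subset K1 := subsetIl _ _.
have cardK : #|K1| = #|K2|.
  apply/eqP; rewrite -(eqn_pmul2r (_ : 0 < p ^ 4)) ?expn_gt0 ?p_gt0 //.
  by rewrite -{1}iK1 -iK2 !Lagrange ?normal_sub.
have iK1K : p <= #|K1 : K|.
  apply: (index_pgroup_ge p_pr (pgroupS (normal_sub nK1) pN)).
  rewrite subsetI subxx /=; apply: contra neqK => sK12.
  by rewrite eqEcard sK12 cardK leqnn.
have iQK1 : #|Q1 : K1| = p by [].
have sKQ := subset_trans sKK1 sK1Q.
have iK1K' : #|K1 : K| <= p.
  by rewrite indexgI -[p]iQ2 -/Q2 -eqQ subset_leq_card // imsetS.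
have QNK : [~: Q1, N] \subset K.
  rewrite subsetI (step_central p_pr pN nQ1 nK1 sK1Q iQ1).
  have iQK2 : #|Q1 : K2| = p by rewrite eqQ.
  exact: (step_central p_pr pN nQ1 nK2 sK2Q iQK2).
have [u Z1u notQu] := subsetPn nsZ1Q.
have Nu := subsetP sZ1N u Z1u.
have [C [sCN iNC memC]] := cent_mod_index nK sKK1 (normal_sub nK1) Nu
  (fun n Nn => subsetP Z1NK1 _ (mem_commg Z1u Nn)).
have sQN := normal_sub nQ1.
pose U := <[u]> <*> Q1.
have iUQ : #|U : Q1| <= p.
  have nuQ : <[u]> \subset 'N(Q1) by rewrite cycle_subG (subsetP (normal_norm nQ1)).
  rewrite -card_quotient; last by rewrite join_subG nuQ normG.
  rewrite quotientYidr // quotient_cycle ?(subsetP (normal_norm nQ1)) //.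
  rewrite -[#|_|]/(#[_]) dvdn_leq // order_dvdn -morphX ?(subsetP (normal_norm nQ1)) //.
  by apply/eqP/coset_id/(subsetP sKQ)/expN.
have sUN : U \subset N by rewrite join_subG cycle_subG Nu.
(* [C] has index at most p in [N], while [U] has index at least p^2. Then [u], [v] and [Q1] generate
   a group that is elementary abelian modulo [K], of order at least p^4. *)
have [v Cv notUv] : exists2 v, v \in C & v \notin U.
  apply/subsetPn/negP=> sCU; suff: p ^ 3 <= p ^ 2 by rewrite leq_exp2l.
  rewrite -iNQ1 -(Lagrange_index sUN (joing_subr _ _)) (expnS p 1) expn1 leq_mul //.
  by rewrite (leq_trans (dvdn_leq _ (indexgS N sCU))) // (leq_trans iNC).
have Nv := subsetP sCN v Cv.
pose W := [set u; v] :|: Q1; pose X := <<W>>%G.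
have sWN : W \subset N by rewrite !subUset !sub1set Nu Nv.
have sXN : X \subset N by rewrite gen_subG.
have sUX : U \subset X.
  rewrite join_subG cycle_subG; apply/andP; split; last by rewrite sub_gen ?subsetUr.
  by apply: mem_gen; rewrite !inE eqxx.
have Xv : v \in X by rewrite mem_gen // !inE eqxx orbT.
have sKX : K \subset X by rewrite (subset_trans sKQ) // (subset_trans (joing_subr _ _) sUX).
have nKX := subset_trans sXN (normal_norm nK).
have nKW := subset_trans sWN (normal_norm nK).
have abX : abelian (X / K).
  rewrite /= quotient_gen // abelian_gen /abelian quotient_cents2 //.
  rewrite gen_subG; apply/subsetP=> _ /imset2P[a b Wa Wb ->].
  have Na := subsetP sWN a Wa; have Nb := subsetP sWN b Wb.
  have [Qa | nQa] := boolP (a \in Q1); first by rewrite (subsetP QNK) // mem_commg.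
  have [Qb | nQb] := boolP (b \in Q1); first by rewrite -groupV invg_comm (subsetP QNK) // mem_commg.
  have Kuv : [~ u, v] \in K by have := Cv; rewrite memC => /andP[].
  have W2 c : c \in W -> c \notin Q1 -> c = u \/ c = v.
    by rewrite !in_setU in_set1 in_set1 => + nQ; rewrite (negPf nQ) orbF => /orP[]/eqP; [left | right].
  case: (W2 a Wa nQa) => ->; case: (W2 b Wb nQb) => ->; rewrite ?commgg ?group1 //.
  by rewrite -groupV invg_comm.
have : #|X / K| <= p ^ 3.
  apply: secN => //; first by rewrite /normal sKX.
  apply/abelemP=> //; split=> // _ /morphimP[y Ny Xy ->]; rewrite -morphX //.
  by apply/coset_id/expN/(subsetP sXN).
rewrite card_quotient // leqNgt => /negP[].
apply: leq_trans (_ : p ^ 4 <= _); first by rewrite ltn_exp2l.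
rewrite -(Lagrange_index sUX (subset_trans sKQ (joing_subr _ _))).
rewrite -(Lagrange_index (joing_subr _ _ : Q1 \subset U) sKQ) -(Lagrange_index sK1Q sKK1).
have pX (A B : {group gT}) a : A \subset N -> a \in A -> a \notin B -> p <= #|A : B|.
  move=> sAN Aa nBa; apply: (index_pgroup_ge p_pr (pgroupS sAN pN)).
  by apply: contra nBa => /subsetP->.
rewrite !expnS expn0 muln1 !leq_mul //.
- exact: (pX X _ v).
- by apply: (pX _ _ u); rewrite // (subsetP (joing_subl _ _)) ?cycle_id.
by rewrite iQ1.
Qed.

(** * The irreducible case *)

Section IrreducibleCase.
Variables (gT : finGroupType) (p : nat) (S E N : {group gT}) (g : gT).
Variable A : {set {perm gT}}.
Local Notation P := 'Phi(E).
Let I := [~: E, N] <*> P.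
Let J := [~: I, N] <*> P.
Hypotheses (p_pr : prime p) (p_ge5 : 5 <= p) (pS : p.-group S).
Hypotheses (secS : sections_le3 p S) (sNS : N \subset S) (nEN : E <| N) (iNE : #|N : E| = p).
Hypotheses (Sg : g \in S) (nNg : g \in 'N(N)) (nEg : E :^ g != E).
Hypotheses (iEI : #|E : I| = p) (iIJ : #|I : J| = p) (iJP : #|J : P| = p).
Hypothesis JNP : [~: J, N] \subset P.
Hypothesis sAE : A \subset Aut E.
Hypothesis irrA : forall X : {group gT}, P \subset X -> X \subset E ->
  (forall (a : {perm gT}) x, a \in A -> x \in X -> a x \in X) -> X :=: P \/ X :=: E.

Let sEN : E \subset N := normal_sub nEN.
Let nEN' : N \subset 'N(E) := normal_norm nEN.
Let pN : p.-group N := pgroupS sNS pS.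
Let pE : p.-group E := pgroupS sEN pN.
Let pNE : prime #|N : E|. Proof. by rewrite iNE. Qed.
Let pEI : prime #|E : I|. Proof. by rewrite iEI. Qed.
Let pIJ : prime #|I : J|. Proof. by rewrite iIJ. Qed.
Let pJP : prime #|J : P|. Proof. by rewrite iJP. Qed.
Let p_odd : odd p.
Proof. by case: (even_prime p_pr) => // p2; have := p_ge5; rewrite p2. Qed.

Let nPN : P <| N. Proof. exact: char_normal_trans (Phi_char E) nEN. Qed.
Let sIE : I \subset E.
Proof. by rewrite join_subG commg_subl nEN' Phi_sub. Qed.
Let sJI : J \subset I.
Proof. by rewrite join_subG joing_subr andbT (subset_trans (commSg N sIE)) ?joing_subl. Qed.
Let sPJ : P \subset J. Proof. exact: joing_subr. Qed.
Let nIN : I <| N.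
Proof.
rewrite /normal (subset_trans sIE sEN) normsY ?(normal_norm nPN) //.
exact: normsRr.
Qed.
Let nJN : J <| N.
Proof.
rewrite /normal (subset_trans sJI (normal_sub nIN)) normsY ?(normal_norm nPN) //.
exact: normsRr.
Qed.
Let EEP : [~: E, E] \subset P.
Proof. exact: der_sub_Phi pE. Qed.
Let INJ : [~: I, N] \subset J. Proof. exact: joing_subl. Qed.
Let ENI : [~: E, N] \subset I. Proof. exact: joing_subl. Qed.

Let E' := (E :^ g)%G.
Let NgN : N :^ g = N. Proof. exact/normP. Qed.
Let nE'N : E' <| N. Proof. by rewrite /= -NgN normalJ. Qed.
Let iNE' : #|N : E'| = p. Proof. by rewrite -[in LHS]NgN indexJg. Qed.

Let index_meet (X Y : {group gT}) :
  X <| N -> Y <| N -> #|X| = #|Y| -> X :!=: Y -> #|N : Y| = p -> #|X : X :&: Y| = p.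
Proof.
move=> /normal_sub sXN nY cXY neXY iY; apply: (index_pgroup_eq p_pr (pgroupS sXN pN) (subsetIl _ _)).
  rewrite subsetI subxx /=; apply: contra neXY => sXY.
  by rewrite eqEcard sXY cXY leqnn.
by rewrite indexgI -iY subset_leq_card // imsetS.
Qed.

Let PhiI (X Y : {group gT}) : #|X : X :&: Y| = p -> 'Phi(X) \subset X :&: Y.
Proof.
by move=> iXY; apply/Phi_sub_max/(p_index_maximal (subsetIl _ _)); rewrite iXY.
Qed.

(** Two distinct normal subgroups of index p in [N] meet in a subgroup of index p of each; it
    contains [[~: N, N]] and ['Phi(E)], hence [I]. The left side is the same for [E'], which is what
    makes [I] invariant under [g]. *)
Let defI : E :&: E' = I.
Proof.
have iEE' : #|E : E :&: E'| = p by apply: index_meet; rewrite ?cardJg // eq_sym.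
have sub : I \subset E :&: E'.
  rewrite join_subG (@PhiI E E') // andbT subsetI.
  by rewrite !(subset_trans (commSg N sEN)) ?(prime_index_der p_pr).
have c1 : (#|E :&: E'| * p)%N = #|E| by rewrite -iEE' Lagrange ?subsetIl.
have c2 : (#|I| * p)%N = #|E| by rewrite -iEI Lagrange.
by apply/esym/eqP; rewrite eqEcard sub -(leq_pmul2r (prime_gt0 p_pr)) c1 c2 leqnn.
Qed.

Let IgI : I :^ g = I.
Proof.
have iE'E : #|E' : E' :&: E| = p by apply: index_meet; rewrite ?cardJg.
suff sub : I :^ g \subset E :&: E'.
  by apply/eqP; rewrite eqEcard cardJg leqnn andbT -{2}defI.
rewrite conjYg conjsRg NgN -PhiJ setIC join_subG (@PhiI E' E) // andbT subsetI.
by rewrite !(subset_trans (commSg N (normal_sub nE'N))) ?(prime_index_der p_pr).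
Qed.

(** For [y] outside [E] the power [y ^+ p] commutes with [y], and with [E] modulo [P]. So [N] fixes
    it in [E / P], where [N] acts with a single Jordan block whose fixed points are [J / P]. *)
Let expJ y : y \in N -> y ^+ p \in J.
Proof.
move=> Ny; have [Ey | notEy] := boolP (y \in E).
  exact/(subsetP sPJ)/(expg_Phi p_pr pE).
pose v := y ^+ p.
have Ev : v \in E by apply: (prime_index_exp nEN iNE).
have vy : [~ v, y] = 1 by apply/eqP/commgP; apply: commute_sym (commuteX p (commute_refl y)).
have vE n : n \in E -> [~ v, n] \in P.
  by move=> En; apply: (subsetP EEP); rewrite mem_commg.
apply: contraT => notJv.
have vP n : n \in N -> [~ v, n] \in P.
  apply: (comm_step_r (normal_norm nPN) sEN pNE Ny notEy) => //.
  by rewrite vy group1.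
have [Iv | notIv] := boolP (v \in I).
  have : [~: I, N] \subset P.
    exact: (comm_step (normal_norm nPN) (normal_sub nIN) sJI pIJ Iv notJv vP JNP).
  move=> INP; have : J \subset P by rewrite join_subG INP subxx.
  by rewrite (negPf (prime_index_nsub p_pr iJP)).
have : [~: E, N] \subset J.
  apply: (comm_step (normal_norm nJN) sEN sIE pEI Ev notIv _ INJ) => n Nn.
  by apply: (subsetP sPJ); apply: vP.
move=> ENJ; have : I \subset J by rewrite join_subG ENJ sPJ.
by rewrite (negPf (prime_index_nsub p_pr iIJ)).
Qed.

(** Modulo [J :^ g] the group [E] is abelian, being central by cyclic, and has exponent p by the
    previous fact conjugated by [g]. Hence [P] lies in [J :^ g], and so does [J], generated by [P]
    and [[~: I, N]]. *)
Let JgJ : J :^ g = J.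
Proof.
have [e Ee notIe] : exists2 e, e \in E & e \notin I.
  exact/subsetPn/(prime_index_nsub p_pr iEI).
have sJgI : J :^ g \subset I by rewrite -IgI conjSg.
have nJgN : N \subset 'N(J :^ g) by rewrite -{1}NgN normJ conjSg normal_norm.
have nJgE := subset_trans sEN nJgN.
have INJg : [~: I, N] \subset J :^ g by rewrite -{1}IgI -{1}NgN -conjsRg conjSg.
have IEJg : [~: I, E] \subset J :^ g := subset_trans (commgS I sEN) INJg.
have expJg y : y \in N -> y ^+ p \in J :^ g.
  by move=> Ny; rewrite mem_conjg conjXg expJ // -mem_conjg NgN.
have sPJg : P \subset J :^ g.
  have abel : abelian (E / J :^ g).
    rewrite /abelian quotient_cents2 //.
    apply: (@comm_step _ E E I (J :^ g)%G e) => // n En.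
    apply: (@comm_step_r _ E I (J :^ g)%G e e) => //; first by rewrite commgg group1.
    move=> m Im; rewrite -groupV invg_comm; apply: (subsetP IEJg).
    by rewrite mem_commg.
  apply: (Phi_min pE nJgE); apply/abelemP=> //; split=> // _ /morphimP[y Ny Ey ->].
  by rewrite -morphX //; apply/coset_id/expJg/(subsetP sEN).
apply/esym/eqP; rewrite eqEcard cardJg leqnn andbT join_subG sPJg andbT.
exact: INJg.
Qed.

(** [R] is a substitute for [P] that [g] preserves, being built from [J] and [N] only. [Psi] is
    characteristic in [E] and makes [P / Psi] elementary abelian and central in [E / Psi]. *)
Let R := [~: J, N] <*> 'Phi(J).
Let Psi := [~: P, E] <*> 'Phi(P).
Let nRN : R <| N.
Proof.
rewrite /normal join_subG (subset_trans JNP (normal_sub nPN)) /=.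
rewrite (subset_trans (Phi_sub J) (normal_sub nJN)) normsY ?normsRr //.
exact: char_norm_trans (Phi_char J) (normal_norm nJN).
Qed.
Let sRP : R \subset P.
Proof. by rewrite join_subG JNP (PhiS pE (subset_trans sJI sIE)). Qed.
Let chPsi : Psi \char E.
Proof.
by rewrite charY ?charR ?char_refl ?Phi_char // (char_trans (Phi_char P)) ?Phi_char.
Qed.
Let nPsiN : Psi <| N. Proof. exact: char_normal_trans chPsi nEN. Qed.
Let sPsiR : Psi \subset R.
Proof.
rewrite join_subG (subset_trans (commgSS sPJ sEN)) ?joing_subl //=.
by apply: subset_trans (joing_subr _ _); apply: PhiS sPJ; apply: pgroupS (subset_trans sJI sIE) pE.
Qed.
Let sPsiP : Psi \subset P := subset_trans sPsiR sRP.
Let sPE : P \subset E := Phi_sub E.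
Let JNR : [~: J, N] \subset R. Proof. exact: joing_subl. Qed.
Let RgR : R :^ g = R.
Proof. by rewrite conjYg conjsRg NgN -PhiJ JgJ. Qed.

Let IgJ c : c \in I -> [~ c, g] \in J.
Proof.
move=> Ic; pose T := N <*> <[g]>.
have sNT : N \subset T := joing_subl _ _.
have nT (X : {group gT}) : X <| N -> X :^ g = X -> X <| T.
  move=> nX Xg; rewrite /normal (subset_trans (normal_sub nX) sNT) join_subG.
  by rewrite (normal_norm nX) cycle_subG; apply/normP.
have pT : p.-group T.
  by apply: pgroupS pS; rewrite join_subG sNS cycle_subG.
have := step_central p_pr pT (nT _ nIN IgI) (nT _ nJN JgJ) sJI iIJ.
by move/subsetP; apply; rewrite mem_commg // (subsetP (joing_subr _ _)) ?cycle_id.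
Qed.

Let nPsi x : x \in N -> x \in 'N(Psi). Proof. exact/subsetP/normal_norm. Qed.
Let nPsiE x : x \in E -> x \in 'N(Psi). Proof. by move=> Ex; apply/nPsi/(subsetP sEN). Qed.
Let PEPsi : [~: P, E] \subset Psi. Proof. exact: joing_subl. Qed.
Let expP z : z \in P -> z ^+ p \in Psi.
Proof. by move=> Pz; apply/(subsetP (joing_subr _ _))/(expg_Phi p_pr (pgroupS sPE pE)). Qed.

Let expE x y : x \in E -> y \in E ->
  coset Psi ((x * y) ^+ p) = coset Psi (x ^+ p) * coset Psi (y ^+ p).
Proof.
move=> Ex Ey; have nPsiE' : E \subset 'N(Psi) by apply/subsetP.
rewrite !morphX ?groupM ?nPsiE // morphM ?nPsiE //.
apply: (@class2_expM _ p (E / Psi) (P / Psi)) => //; try exact: mem_quotient.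
- by rewrite -quotientR // quotientS.
- by rewrite quotient_cents2 // (subset_trans sPE).
by move=> _ /morphimP[z Nz Pz ->]; rewrite -morphX //; apply/coset_id/expP.
Qed.

Let expE_mem x y : x \in E -> y \in E -> x ^+ p \in Psi -> y ^+ p \in Psi -> (x * y) ^+ p \in Psi.
Proof.
move=> Ex Ey xp yp; apply: coset_idr; first by rewrite groupX ?groupM ?nPsiE.
by rewrite expE // !coset_id // mulg1.
Qed.

Let PsiA (a : {perm gT}) x : a \in A -> x \in Psi -> a x \in Psi.
Proof. by move/(subsetP sAE); apply: char_Aut_closed chPsi. Qed.

(** Taking p-th powers induces an [A]-equivariant homomorphism from [E / P] to [P / Psi];
    irreducibility leaves only two kernels. *)
Let exp_trivial : (forall y, y \in E -> y ^+ p \in Psi -> y \in P) \/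
  (forall y, y \in E -> y ^+ p \in Psi).
Proof.
pose X := [set y in E | y ^+ p \in Psi].
have gX : group_set X.
  apply/group_setP; split; first by rewrite inE group1 expg1n group1.
  by move=> x y; rewrite !inE => /andP[Ex xp] /andP[Ey yp]; rewrite groupM ?expE_mem.
have [] := @irrA (Group gX).
- by apply/subsetP=> z Pz; rewrite inE expP // (subsetP sPE).
- by apply/subsetP=> z; rewrite inE => /andP[].
- move=> a x Aa; rewrite !inE => /andP[Ex xp].
  rewrite (Aut_closed (subsetP sAE a Aa)) //=.
  have <- : a (x ^+ p) = a x ^+ p.
    by have := morphX (autm_morphism (subsetP sAE a Aa)) p Ex; rewrite /= autmE.
  exact: PsiA.
- by move=> /= defX; left=> y Ey yp; rewrite -defX inE Ey.
by move=> /= defX; right=> y; rewrite -{1}defX inE => /andP[].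
Qed.

Lemma irreducible_case_false : False.
Proof.
have [e Ee notIe] : exists2 e, e \in E & e \notin I by apply/subsetPn/(prime_index_nsub p_pr iEI).
(* Choosing a conjugate of [e] as the element of [N] outside [E] lets [g] turn a formula for
   [e ^+ p] into one for [x ^+ p]. *)
pose x := e ^ g; have Ne := subsetP sEN e Ee.
have Nx : x \in N by rewrite -NgN memJ_conjg.
have notEx : x \notin E.
  apply: contra notIe => Ex; rewrite -(memJ_conjg I g) IgI -defI inE Ex /=.
  by rewrite memJ_conjg.
pose c := [~ e, x]; pose d := [~ c, x]; pose f := [~ d, x].
have Ic : c \in I by rewrite (subsetP ENI) ?mem_commg.
have Nc := subsetP (normal_sub nIN) c Ic; have Ec := subsetP sIE c Ic.
have Jd : d \in J by rewrite (subsetP INJ) ?mem_commg.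
have Nd := subsetP (normal_sub nJN) d Jd; have Ed := subsetP sIE d (subsetP sJI d Jd).
have Rf : f \in R by rewrite (subsetP JNR) ?mem_commg.
have Pf := subsetP sRP f Rf; have Ef := subsetP sPE f Pf; have Nf := subsetP sEN f Ef.
have EP u v : u \in E -> v \in E -> [~ u, v] \in P.
  by move=> Eu Ev; rewrite (subsetP EEP) ?mem_commg.
have notJc : c \notin J.
  apply/negP=> Jc; case/negP: (prime_index_nsub p_pr iIJ); rewrite join_subG sPJ andbT.
  apply: (comm_step (normal_norm nJN) sEN sIE pEI Ee notIe _ INJ).
  apply: (comm_step_r (normal_norm nJN) sEN pNE Nx notEx Jc) => n En.
  by apply: (subsetP sPJ); apply: EP.
have notPd : d \notin P.
  apply/negP=> Pd; case/negP: (prime_index_nsub p_pr iJP); rewrite join_subG subxx andbT.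
  apply: (comm_step (normal_norm nPN) (normal_sub nIN) sJI pIJ Ic notJc _ JNP).
  apply: (comm_step_r (normal_norm nPN) sEN pNE Nx notEx Pd) => n En.
  exact: EP.
(* [c ^ g] is [c * j] with [j] in [J], and commutators of [J] with [N] are trivial modulo [R]. *)
have ecg : exists2 r, r \in R & [~ e, c] ^ g = [~ x, c] * r.
  have Jj := IgJ Ic; set j := [~ c, g] in Jj.
  have Nj := subsetP (normal_sub nJN) j Jj.
  have xcJ : [~ x, c] \in J by rewrite -groupV invg_comm.
  have JRl u v : u \in J -> v \in N -> [~ u, v] \in R.
    by move=> Ju Nv; rewrite (subsetP JNR) ?mem_commg.
  exists ([~ x, j] ^ [~ x, c] * [~ [~ x, c], j]).
    have Rxj : [~ x, j] \in R by rewrite -groupV invg_comm JRl.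
    apply: groupM (JRl _ _ xcJ Nj); rewrite memJ_norm //.
    by rewrite (subsetP (normal_norm nRN)) // (subsetP (normal_sub nJN)).
  have aux (a b : gT) : a * b ^ j = b * (a ^ b * [~ b, j]).
    by rewrite [[~ b, j]]commgEl (conjgE a b) !mulgA mulgV mul1g mulgK.
  have cgE : c ^ g = c * j by rewrite /j commgEl mulKVg.
  by rewrite conjRg -/x cgE commgMJ aux.
(* Conjugating by [g] would put [[~ x, c]], the inverse of [d], into [R], hence into [P]. *)
have notRec : [~ e, c] \notin R.
  apply: contra notPd => Rec; have [r Rr ecgE] := ecg.
  have: [~ e, c] ^ g \in R :^ g by rewrite memJ_conjg.
  by rewrite RgR ecgE groupMr // => xc; rewrite (subsetP sRP) // -groupV invg_comm.
have PEP u v : u \in P -> v \in E -> [~ u, v] \in Psi.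
  by move=> Pu Ev; rewrite (subsetP PEPsi) ?mem_commg.
have EPP u v : u \in E -> v \in P -> [~ u, v] \in Psi.
  by move=> Eu Pv; rewrite -groupV invg_comm PEP.
pose q := coset Psi.
have [exE cxE dxE] : [/\ q e ^ q x = q e * q c, q c ^ q x = q c * q d & q d ^ q x = q d * q f].
  by rewrite /q -!morphJ ?nPsi // -!morphM ?nPsi // !conjg_mulR.
have cq u v : u \in E -> v \in P -> commute (q u) (q v).
  by move=> Eu Pv; apply: commute_coset; rewrite ?nPsiE ?EPP // (subsetP sPE).
have qR u v : u \in E -> v \in E -> [~ q u, q v] = q [~ u, v].
  by move=> Eu Ev; rewrite /q morphR ?nPsiE.
have [] := @class2_conj _ (q e) (q c) (q d) (q f) (q x) exE cxE dxE.
  rewrite !qR // => u; rewrite !inE => /or3P[] /eqP -> v; rewrite !inE => /or4P[] /eqP ->;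
  by apply: cq => //; rewrite EP.
rewrite !qR // => ecx edx cdx.
have qx u : u \in E -> q u ^ q x = q u * q [~ u, x].
  move=> Eu; have Nu := subsetP sEN u Eu; have NRu : [~ u, x] \in N by rewrite groupR.
  have uxE : u ^ x = u * [~ u, x] by rewrite commgEl mulKVg.
  by rewrite /q -morphJ ?nPsi // uxE morphM ?nPsi.
have q1 u : u \in E -> (q u = 1) <-> (u \in Psi).
  by move=> Eu; split=> [/coset_idr -> // | /coset_id //]; apply: nPsiE.
have EcP u v : u \in E -> v \in E -> [~ u, v] \in E by move=> Eu Ev; rewrite groupR.
have Exx u : u \in E -> [~ u, x] \in E.
  by move=> Eu; rewrite (subsetP sIE) // (subsetP ENI) ?mem_commg.
have ecx' : q [~ [~ e, c], x] = q [~ e, d] * q [~ c, d].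
  by apply: (mulgI (q [~ e, c])); rewrite -(qx _ (EcP _ _ Ee Ec)) ecx.
have edx' : q [~ [~ e, d], x] = q [~ c, d].
  by apply: (mulgI (q [~ e, d])); rewrite -(qx _ (EcP _ _ Ee Ed)) edx.
have cdx' : [~ [~ c, d], x] \in Psi.
  by apply/q1; [exact/Exx/EcP | apply: (mulgI (q [~ c, d])); rewrite -(qx _ (EcP _ _ Ec Ed)) cdx mulg1].
have abelemPsi (X : {group gT}) : X \subset E -> Psi \subset X -> [~: X, X] \subset Psi ->
    (forall y, y \in X -> y ^+ p \in Psi) -> #|X : Psi| <= p ^ 3.
  move=> sXE sPX XXP expX; have nX := subset_trans sXE (subset_trans sEN (normal_norm nPsiN)).
  rewrite -card_quotient //; apply: secS; first exact: subset_trans sXE (subset_trans sEN sNS).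
    by rewrite /normal sPX.
  apply/abelemP=> //; split; first by rewrite /abelian quotient_cents2.
  by move=> _ /morphimP[y Ny Xy ->]; rewrite -morphX //; apply/coset_id/expX.
have PPsi : [~: P, P] \subset Psi by apply: subset_trans PEPsi; apply: commgS.
have nPsiX (X : {group gT}) : X \subset N -> X \subset 'N(Psi).
  by move=> sXN; apply: subset_trans sXN (normal_norm nPsiN).
have PsiP' : ~~ (P \subset Psi).
  by apply: contra notRec => sPP; apply: (subsetP sPsiR); apply: (subsetP sPP); apply: EP.
pose P1 := [~: P, N] <*> Psi.
have nP1N : P1 <| N.
  rewrite /normal join_subG comm_subG ?(normal_sub nPN) ?(normal_sub nPsiN) //=.
  by rewrite normsY ?normsRr ?(normal_norm nPsiN).
have sP1P : P1 \subset P by rewrite join_subG sPsiP andbT commg_subl (normal_norm nPN).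
have P1P' : ~~ (P \subset P1).
  exact: (nil_step pN (normal_sub nPN) (normal_norm nPN) nPsiN PsiP').
have sPsiP1 : Psi \subset P1 by apply: joing_subr.
have pP := pgroupS (subset_trans sPE sEN) pN.
have P1_edcd : [~ e, d] * [~ c, d] \in P1.
  have P1a : [~ [~ e, c], x] \in P1.
    by rewrite (subsetP (joing_subl _ _)) // mem_commg ?EP.
  have Eed := EcP _ _ Ee Ed; have Ecd := EcP _ _ Ec Ed; have Eec := EcP _ _ Ee Ec.
  have qm : q ([~ e, d] * [~ c, d]) = q [~ e, d] * q [~ c, d] by rewrite /q morphM ?nPsiE.
  rewrite -(mulVKg [~ [~ e, c], x] ([~ e, d] * _)) groupM // (subsetP sPsiP1) //.
  apply: eq_coset (etrans ecx' (esym qm)); apply: nPsiE.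
    exact: Exx.
  exact: groupM.
have nXN (X : {group gT}) : X \subset N -> N \subset 'N(X) -> X <| N by move=> ? ?; apply/andP.
have sJE := subset_trans sJI sIE; have sJN := normal_sub nJN; have sIN := normal_sub nIN.
have PXPsi (X : {group gT}) : X \subset E -> [~: P, X] \subset Psi.
  by move=> sXE; apply: subset_trans (commgS _ sXE) PEPsi.
have dJ n : n \in J -> [~ d, n] \in Psi.
  apply: (comm_step_r (nPsiX _ sJN) sPJ pJP Jd notPd) => [|m Pm]; last exact: EPP.
  by rewrite commgg group1.
have JJPsi : [~: J, J] \subset Psi.
  exact: (comm_step (nPsiX _ sJN) (subxx _) sPJ pJP Jd notPd dJ (PXPsi _ sJE)).
have sPsiJ := subset_trans sPsiP sPJ; have sPsiI := subset_trans sPsiJ sJI.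
have p_gt1 := prime_gt1 p_pr; have p_gt0 := prime_gt0 p_pr.
(* If all p-th powers are trivial modulo [Psi], every abelian [X / Psi] is elementary abelian. When
   [[~ c, d]] is nontrivial modulo [Psi], [J / Psi] is too large; when only [[~ e, d]] is, [I / Psi]
   is; otherwise [d] is central modulo [Psi]. *)
case: exp_trivial => [expPsi | exp1]; last first.
  have bad4 (X : {group gT}) n : X \subset E -> Psi \subset X -> [~: X, X] \subset Psi ->
      #|X : Psi| = n -> p ^ 4 <= n -> False.
    move=> sXE sPsiX XXP <-; have := abelemPsi X sXE sPsiX XXP (fun y Xy => exp1 y (subsetP sXE y Xy)).
    by move=> le3 le4; have := leq_trans le4 le3; rewrite leq_exp2l.
  have [cdPsi | ncd] := boolP ([~ c, d] \in Psi); last first.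
    have edcdx : [~ [~ e, d] * [~ c, d], x] \in Psi -> [~ c, d] \in Psi.
      have Eed := EcP _ _ Ee Ed; have Ecd := EcP _ _ Ec Ed.
      have Em := groupM Eed Ecd; move=> /(q1 _ (Exx _ Em)) m1; apply/(q1 _ Ecd).
      have := qx _ Em; rewrite m1 mulg1 /q morphM ?nPsiE // conjMg -/q edx cdx.
      by rewrite -[RHS]mulg1 => /mulgI.
    have P1cd : P1 \subset Psi -> [~ c, d] \in Psi.
      move=> sP1; apply: edcdx; have m := subsetP sP1 _ P1_edcd.
      by rewrite commgEl groupM ?groupV // memJ_norm // nPsi.
    pose P2 := [~: P1, N] <*> Psi.
    have P2P1' : ~~ (P1 \subset P2).
      apply: (nil_step pN (normal_sub nP1N) (normal_norm nP1N) nPsiN).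
      by apply: contra ncd => sP1; apply: P1cd.
    have sPsiP2 : Psi \subset P2 by apply: joing_subr.
    have sP2P1 : P2 \subset P1 by rewrite join_subG sPsiP1 andbT commg_subl (normal_norm nP1N).
    have P2Psi' : ~~ (P2 \subset Psi).
      apply: contra ncd => sP2; apply: edcdx; apply: (subsetP sP2).
      by rewrite (subsetP (joing_subl _ _)) // mem_commg.
    apply: (bad4 J _ sJE sPsiJ JJPsi (esym (Lagrange_index sPJ sPsiP))).
    rewrite iJP expnS leq_pmul2l // -(Lagrange_index sP1P sPsiP1) -(Lagrange_index sP2P1 sPsiP2).
    by rewrite !expnS expn0 muln1 !leq_mul ?(index_pgroup_ge p_pr) // (pgroupS _ pN) // ?(normal_sub nP1N) // (subset_trans sP2P1) ?(normal_sub nP1N).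
  have [edPsi | ned] := boolP ([~ e, d] \in Psi); last first.
    have P1Psi' : ~~ (P1 \subset Psi).
      apply: contra ned => sP1; have := subsetP sP1 _ P1_edcd.
      by rewrite groupMr.
    have cJ n : n \in J -> [~ c, n] \in Psi.
      by apply: (comm_step_r (nPsiX _ sJN) sPJ pJP Jd notPd) => // m Pm; apply: EPP.
    have cI n : n \in I -> [~ c, n] \in Psi.
      by apply: (comm_step_r (nPsiX _ sIN) sJI pIJ Ic notJc) => //; rewrite commgg group1.
    have dI n : n \in I -> [~ d, n] \in Psi.
      apply: (comm_step_r (nPsiX _ sIN) sJI pIJ Ic notJc) => //.
      by rewrite -groupV invg_comm.
    have JIPsi := comm_step (nPsiX _ sIN) sJI sPJ pJP Jd notPd dI (PXPsi _ sIE).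
    have IIPsi := comm_step (nPsiX _ sIN) (subxx _) sJI pIJ Ic notJc cI JIPsi.
    apply: (bad4 I _ sIE sPsiI IIPsi (esym (Lagrange_index sJI sPsiJ))).
    rewrite -(Lagrange_index sPJ sPsiP) -(Lagrange_index sP1P sPsiP1) iIJ iJP.
    rewrite !expnS expn0 muln1 !leq_pmul2l // leq_mul ?(index_pgroup_ge p_pr) //.
    exact: pgroupS (normal_sub nP1N) pN.
  have dE n : n \in E -> [~ d, n] \in Psi.
    apply: (comm_step_r (nPsiX _ sEN) sIE pEI Ee notIe); first by rewrite -groupV invg_comm.
    apply: (comm_step_r (nPsiX _ sIN) sJI pIJ Ic notJc) => //.
    by rewrite -groupV invg_comm.
  (* The preimage of the centre of [E / Psi]. It is invariant and contains [d] outside [P], so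
     irreducibility makes it [E], although [e] and [c] do not commute modulo [Psi]. *)
  pose X := [set y in E | [forall v in E, [~ y, v] \in Psi]].
  have XP y : reflect (y \in E /\ forall v, v \in E -> [~ y, v] \in Psi) (y \in X).
    by rewrite inE; apply: (iffP andP) => -[Ey /forall_inP].
  have gX : group_set X.
    apply/group_setP; split; first by apply/XP; split=> // v _; rewrite comm1g group1.
    move=> y z /XP[Ey cy] /XP[Ez cz]; apply/XP; split=> [|v Ev]; first exact: groupM.
    by rewrite commMgJ groupM ?cz // memJ_norm ?cy ?nPsiE.
  have [] := @irrA (Group gX).
  - by apply/subsetP=> z Pz; apply/XP; split=> [|v Ev]; [apply: (subsetP sPE) | apply: PEP].
  - by apply/subsetP=> z /XP[].
  - move=> a y Aa /XP[Ey cy]; apply/XP; have AutEa := subsetP sAE a Aa.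
    split=> [|v Ev]; first exact: Aut_closed.
    have [w Ew ->] : exists2 w, w \in E & v = a w.
      have : v \in autm AutEa @* E by rewrite im_autm.
      by case/morphimP=> w _ Ew ->; exists w.
    have <- : a [~ y, w] = [~ a y, a w].
      by have := morphR (autm_morphism AutEa) Ey Ew; rewrite /= !autmE.
    by apply: PsiA => //; apply: cy.
  - move=> /= defX; case/negP: notPd; rewrite -defX; apply/XP; split=> //.
  move=> /= defX; case/negP: notRec; apply: (subsetP sPsiR).
  have /XP[_ ce] : e \in X by rewrite defX.
  exact: ce.
have expEP y : y \in E -> y ^+ p \in P by apply: expg_Phi.
have PowP (B : {group gT}) : B \subset E ->
    group_set [set y in P | [exists w in B, q y == q (w ^+ p)]].
  move=> sBE; apply/group_setP; split.
    by rewrite inE group1; apply/exists_inP; exists 1; rewrite ?group1 // expg1n.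
  move=> y z; rewrite !inE => /andP[Py /exists_inP[u Bu /eqP qy]] /andP[Pz /exists_inP[v Bv /eqP qz]].
  rewrite groupM //=; apply/exists_inP; exists (u * v); first exact: groupM.
  rewrite /q expE ?(subsetP sBE) // -/q -qy -qz /q morphM ?nPsiE // ?(subsetP sPE) //.
(* The images of [J] and [I] under the p-th power map, pulled back from [P / Psi]. *)
pose R2 := Group (PowP J sJE); pose R3 := Group (PowP I sIE).
have inPow (B : {group gT}) (sBE : B \subset E) w : w \in B -> w ^+ p \in Group (PowP B sBE).
  move=> Bw; rewrite inE expEP ?(subsetP sBE) //=; apply/exists_inP; by exists w.
have Pow_root (B : {group gT}) (sBE : B \subset E) v : P \subset B -> v \in E ->
    v ^+ p \in Group (PowP B sBE) -> v \in B.
  move=> sPB Ev; rewrite inE => /andP[_ /exists_inP[w Bw /eqP qvw]].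
  have Ew := subsetP sBE w Bw.
  rewrite -(groupMr _ (groupVr Bw)); apply: (subsetP sPB); apply: expPsi; first by rewrite groupM ?groupV.
  apply: coset_idr; first by rewrite nPsiE ?groupX ?groupM ?groupV.
  by rewrite expE ?groupV // -/q qvw /q expgVn morphV ?nPsiE ?groupX // mulgV.
have sPsiPow (B : {group gT}) (sBE : B \subset E) : Psi \subset Group (PowP B sBE).
  apply/subsetP=> y Psiy; rewrite inE (subsetP sPsiP) //=; apply/exists_inP; exists 1; first exact: group1.
  by rewrite expg1n /q (coset_id Psiy) (coset_id (group1 _)).
have sR2R3 : R2 \subset R3.
  apply/subsetP=> y; rewrite !inE => /andP[-> /exists_inP[w Jw qyw]]; apply/exists_inP.
  by exists w => //; apply: (subsetP sJI).
have sR3P : R3 \subset P by apply/subsetP=> y; rewrite inE => /andP[].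
have sR2P := subset_trans sR2R3 sR3P.
have sPsiR2 : Psi \subset R2 := sPsiPow _ _.
have dpPsi : d ^+ p \notin Psi by apply: contra notPd; apply: expPsi.
have cpR2 : c ^+ p \notin R2 by apply: contra notJc; apply: Pow_root.
have epR3 : e ^+ p \notin R3 by apply: contra notIe; apply: Pow_root => //; apply: subset_trans sJI.
have dpR2 : d ^+ p \in R2 by apply: inPow.
have cpR3 : c ^+ p \in R3 by apply: inPow.
have epP : e ^+ p \in P by apply: expEP.
have nsub (X Y : {group gT}) y : y \in X -> y \notin Y -> ~~ (X \subset Y).
  by move=> Xy; apply: contra => /subsetP->.
have pR3 := pgroupS sR3P pP; have pR2 := pgroupS sR2P pP.
(* The powers [e ^+ p], [c ^+ p], [d ^+ p] show that the three inclusions are proper, and the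
   elementary abelian [P / Psi] has order at most p^3. *)
have [iPR3 iR32 iR2] : [/\ #|P : R3| = p, #|R3 : R2| = p & #|R2 : Psi| = p].
  have := abelemPsi P sPE sPsiP PPsi (fun y Py => expP Py).
  rewrite -(Lagrange_index sR3P (subset_trans sPsiR2 sR2R3)) -(Lagrange_index sR2R3 sPsiR2).
  have := index_pgroup_ge p_pr pP (nsub _ _ _ epP epR3).
  have := index_pgroup_ge p_pr pR3 (nsub _ _ _ cpR3 cpR2).
  have := index_pgroup_ge p_pr pR2 (nsub _ _ _ dpR2 dpPsi).
  rewrite !expnS expn0 muln1; move: #|P : R3| #|R3 : R2| #|R2 : Psi| => i j k lek lej lei le3.
  have i_p : i = p.
    apply/eqP; rewrite eqn_leq lei andbT -(@leq_pmul2r (p * p)) ?muln_gt0 ?p_gt0 //.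
    by apply: leq_trans le3; rewrite leq_mul2l leq_mul ?orbT.
  have j_p : j = p.
    apply/eqP; rewrite eqn_leq lej andbT -(@leq_pmul2r (p * p)) ?muln_gt0 ?p_gt0 //.
    by apply: leq_trans le3; rewrite [X in _ <= X]mulnCA leq_mul2l leq_mul ?orbT.
  split=> //; apply/eqP; rewrite eqn_leq lek andbT -(@leq_pmul2r (p * p)) ?muln_gt0 ?p_gt0 //.
  by apply: leq_trans le3; rewrite [X in _ <= X]mulnA [X in _ <= X]mulnC leq_mul2l leq_mul ?orbT.
have pPR3 : prime #|P : R3| by rewrite iPR3.
have pR32 : prime #|R3 : R2| by rewrite iR32.
have pR2Psi : prime #|R2 : Psi| by rewrite iR2.
have expx w : w \in E -> q [~ w ^+ p, x] = q ([~ w, x] ^+ p).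
  move=> Ew; have Ewp := groupX p Ew; have ERw := Exx w Ew.
  apply: (mulgI (q (w ^+ p))); rewrite -(qx _ Ewp) -expE // -conjg_mulR.
  have Nwp := subsetP sEN _ Ewp.
  by rewrite -conjXg /q -morphJ ?nPsi.
have PNR : [~: P, N] \subset R by apply: subset_trans (commSg N sPJ) JNR.
have Rpow w : w \in E -> [~ w, x] ^+ p \in R.
  move=> Ew; have Ewp := groupX p Ew; have ERw := Exx w Ew.
  have R1 : [~ w ^+ p, x] \in R by rewrite (subsetP PNR) ?mem_commg ?expEP.
  rewrite -(mulVKg [~ w ^+ p, x] (_ ^+ p)) groupM // (subsetP sPsiR) //.
  by apply: eq_coset (expx w Ew); apply: nPsiE; rewrite ?Exx ?groupX.
(* Modulo [Psi], [[~ w ^+ p, x]] is [[~ w, x] ^+ p]; this puts [d ^+ p] and [c ^+ p] into [R]. So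
   [R] contains [R3], which is maximal in [P], and [[~ e, c]] shows that [R] is not [P]. *)
have defR : R3 :=: R.
  have sR2R : R2 \subset R.
    have <- : (R :&: R2)%G :=: R2.
      apply: (prime_index_eq pR2Psi sPsiR2 _ (subsetIr _ _) _ dpPsi); first by rewrite subsetI sPsiR.
      by rewrite inE dpR2 andbT Rpow.
    exact: subsetIl.
  have sR3R : R3 \subset R.
    have <- : (R :&: R3)%G :=: R3.
      apply: (prime_index_eq pR32 sR2R3 _ (subsetIr _ _) _ cpR2); first by rewrite subsetI sR2R.
      by rewrite inE cpR3 andbT Rpow.
    exact: subsetIl.
  apply/eqP; rewrite eqEsubset sR3R; apply/subsetP=> y Ry; apply: contraT => notR3y.
  have defP := prime_index_eq pPR3 sR3P sR3R sRP Ry notR3y.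
  by move: (EP _ _ Ee Ec); rewrite -defP => Rec; case/negP: notRec.
have sEN' := nPsiX _ sEN.
have R2NPsi : [~: R2, N] \subset Psi.
  apply: (comm_step (normal_norm nPsiN) (subset_trans sR2P (subset_trans sPE sEN)) sPsiR2 pR2Psi dpR2 dpPsi).
    apply: (comm_step_r (normal_norm nPsiN) sEN pNE Nx notEx).
      have Edp := groupX p Ed.
      by apply/(q1 _ (Exx _ Edp)); rewrite expx //; apply/coset_id/expP.
    by move=> n En; apply: PEP => //; apply: expEP.
  by rewrite commg_subl (normal_norm nPsiN).
have nR2N : N \subset 'N(R2) by rewrite -commg_subl (subset_trans R2NPsi).
have R3NR2 : [~: R3, N] \subset R2.
  apply: (comm_step nR2N (subset_trans sR3P (subset_trans sPE sEN)) sR2R3 pR32 cpR3 cpR2).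
    apply: (comm_step_r nR2N sEN pNE Nx notEx) => [|n En].
      have Ecp := groupX p Ec; have Edp := groupX p Ed.
      rewrite -(mulKVg (d ^+ p) [~ _, _]) groupM // (subsetP sPsiR2) //.
      by apply: eq_coset; rewrite ?nPsiE ?Exx // -/q expx.
    by apply: (subsetP sPsiR2); apply: PEP => //; apply: expEP.
  by rewrite commg_subl.
have cpx : [~ c ^+ p, x] \notin Psi.
  have Ecp := groupX p Ec; have Edp := groupX p Ed.
  by apply: contra dpPsi => /(q1 _ (Exx _ Ecp)); rewrite expx // => /(q1 _ Edp).
have epx : [~ e ^+ p, x] \notin R2.
  apply: contra cpR2 => ep2; rewrite -(mulKVg [~ e ^+ p, x] (c ^+ p)) groupM //.
  apply: (subsetP sPsiR2); apply: eq_coset; rewrite ?nPsiE ?Exx ?groupX //.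
  by rewrite -/q expx.
(* [[~ c, d]] is fixed by [N] modulo [Psi]. The power map makes [P / Psi] a single Jordan block for
   [N] as well, with fixed points [R2 / Psi]. *)
have cdR2 : [~ c, d] \in R2.
  have Pcd := EP _ _ Ec Ed; apply: contraT => notR2.
  have cdN n : n \in N -> [~ [~ c, d], n] \in Psi.
    apply: (comm_step_r (normal_norm nPsiN) sEN pNE Nx notEx cdx') => m Em.
    exact: PEP.
  have [R3cd | notR3] := boolP ([~ c, d] \in R3).
    have sR3N : [~: R3, N] \subset Psi.
      by apply: (comm_step (normal_norm nPsiN) (subset_trans sR3P (subset_trans sPE sEN)) sR2R3 pR32 R3cd notR2).
    by case/negP: cpx; apply: (subsetP sR3N); rewrite mem_commg.
  have sPN : [~: P, N] \subset R2.
    apply: (comm_step nR2N (normal_sub nPN) sR3P pPR3 Pcd notR3 _ R3NR2) => n Nn.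
    by apply: (subsetP sPsiR2); apply: cdN.
  by case/negP: epx; apply: (subsetP sPN); rewrite mem_commg.
(* [[~ e, c]] lies outside [R3], so it generates [P] modulo [R3]; [k] is the coordinate of
   [e ^+ p]. *)
have [k [r Rr epE]] : exists k, exists2 r, r \in R & e ^+ p = [~ e, c] ^+ k * r.
  have notR3ec : [~ e, c] \notin R3 by rewrite defR.
  have Pec := EP _ _ Ee Ec.
  have sKP : <[[~ e, c]]> <*> R3 \subset P by rewrite join_subG cycle_subG Pec.
  have Kec : [~ e, c] \in <[[~ e, c]]> <*> R3 by rewrite (subsetP (joing_subl _ _)) ?cycle_id.
  have defP := prime_index_eq pPR3 sR3P (joing_subr _ _) sKP Kec notR3ec.
  have : e ^+ p \in <[[~ e, c]]> <*> R3 by rewrite defP.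
  rewrite norm_joinEl; last first.
    by rewrite cycle_subG defR (subsetP (normal_norm nRN)) // (subsetP (normal_sub nPN)).
  by case/mulsgP=> _ r /cycleP[k ->] R3r ->; exists k, r; rewrite // -defR.
have [r' Rr' xpE] : exists2 r', r' \in R & x ^+ p = [~ x, c] ^+ k * r'.
  have [r0 Rr0 ecgE] := ecg.
  have Rrg : r ^ g \in R by rewrite -[R]RgR memJ_conjg.
  have NRx y : y \in N -> y \in 'N(R) by apply/subsetP/normal_norm.
  have Nxc : [~ x, c] \in N by rewrite groupR.
  have Nr0 := subsetP (normal_sub nRN) _ Rr0; have Nrg := subsetP (normal_sub nRN) _ Rrg.
  exists ([~ x, c] ^- k * x ^+ p); last by rewrite mulKVg.
  apply: eq_coset; rewrite ?NRx ?groupX //.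
  rewrite -[x in RHS]/(e ^ g) -conjXg epE conjMg conjXg ecgE.
  have tM u v : u \in N -> v \in N -> coset R (u * v) = coset R u * coset R v.
    by move=> Nu Nv; rewrite morphM ?NRx.
  have tX u n : u \in N -> coset R (u ^+ n) = coset R u ^+ n.
    by move=> Nu; rewrite morphX ?NRx.
  have Nm := groupM Nxc Nr0; have Nmk := groupX k Nm.
  by rewrite (tM _ _ Nmk Nrg) (coset_id Rrg) mulg1 !tX // (tM _ _ Nxc Nr0) (coset_id Rr0) mulg1.
have Psi2 y : y \in Psi -> y \in R2 := subsetP sPsiR2 y.
have NR2 y : y \in N -> y \in 'N(R2) by apply/subsetP.
have NR2E y : y \in E -> y \in 'N(R2) by move=> Ey; apply/NR2/(subsetP sEN).
(* The right level for the power computation: [[~ c, d]] and [d ^+ p] vanish modulo [R2], elements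
   of [R] are fixed by [x], and [c ^+ p] survives. *)
pose t := coset R2.
have tR u v : u \in N -> v \in N -> [~ t u, t v] = t [~ u, v].
  by move=> Nu Nv; rewrite /t morphR ?NR2.
have tJ u : u \in N -> t u ^ t x = t u * t [~ u, x].
  by move=> Nu; rewrite /t -morphJ ?NR2 // conjg_mulR morphM ?NR2 ?groupR.
have tX u n : u \in N -> t (u ^+ n) = t u ^+ n by move=> Nu; rewrite /t morphX ?NR2.
have tM u v : u \in N -> v \in N -> t (u * v) = t u * t v.
  by move=> Nu Nv; rewrite /t morphM ?NR2.
have t1 u : u \in R2 -> t u = 1 by apply: coset_id.
have tc u v : u \in E -> v \in P -> commute (t u) (t v).
  by move=> Eu Pv; apply: commute_coset; rewrite ?NR2E ?Psi2 ?EPP // (subsetP sPE).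
have NP y : y \in P -> y \in N by move=> Py; apply: (subsetP sEN); apply: (subsetP sPE).
have NR y : y \in R -> y \in N by move=> Ry; apply/NP/(subsetP sRP).
have Pec := EP _ _ Ee Ec; have Ped := EP _ _ Ee Ed.
have Eec := subsetP sPE _ Pec; have Eed := subsetP sPE _ Ped.
have Rx y : y \in R -> t y ^ t x = t y.
  move=> Ry; rewrite tJ ?NR // (t1 [~ y, x]) ?mulg1 //; apply: (subsetP R3NR2).
  by rewrite mem_commg // defR.
have xc : [~ t x, t c] = t [~ x, c] by apply: tR.
have Nec := NP _ Pec; have Nxc : [~ x, c] \in N by rewrite groupR.
have : (t c ^+ p) ^+ 2 = 1.
  apply: (@Iwahori_relation _ (t e) (t c) (t d) (t f) (t x) (t r) (t r') p k) => //.
  - exact: tJ.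
  - exact: tJ.
  - exact: tJ.
  - exact: Rx.
  - by apply: commute_coset; rewrite ?NR2.
  - exact: tc.
  - exact: tc.
  - by rewrite tR //; apply: tc.
  - by rewrite tR //; apply: tc.
  - by rewrite tR //; apply: tc.
  - by rewrite tR //; apply: tc.
  - by rewrite tR //; apply: tc.
  - by rewrite tR //; apply: tc.
  - by rewrite !tR //; apply: tc.
  - by rewrite -tX // t1.
  - by rewrite -tX // t1 // Psi2 // expP.
  - by rewrite tR // -tX ?NP // t1 // Psi2 // expP.
  - by rewrite tR // -(tX e p) // -(tX _ k Nec) -(tM _ _ (groupX k Nec) (NR _ Rr)) -epE.
  - exact: Rx.
  - by rewrite xc -(tX x p) // -(tX _ k Nxc) -(tM _ _ (groupX k Nxc) (NR _ Rr')) -xpE.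
  - by apply: tc => //; apply: (subsetP sRP).
  - by rewrite tR //; apply: tc => //; apply: (subsetP sRP).
have tcp : (t c ^+ p) ^+ p = 1.
  by rewrite -tX // -tX ?groupX // t1 // Psi2 // expP // expEP.
move=> tc2; case/negP: cpR2; apply: coset_idr; first by rewrite NR2 ?groupX.
rewrite -/t tX //; apply/eqP; rewrite -order_eq1 -dvdn1.
have : #[t c ^+ p] %| gcdn 2 p by rewrite dvdn_gcd !order_dvdn tc2 tcp !eqxx.
have : coprime 2 p by rewrite coprime2n.
by move/eqP->.
Qed.

End IrreducibleCase.

(** * Towers with prescribed weights *)

Section ExponentN.
Variables (gT : finGroupType) (p l k : nat) (N E Z D P : {group gT}) (s : gT -> gT).
Hypotheses (p_pr : prime p) (p_odd : odd p) (pN : p.-group N).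
Hypotheses (nE : E <| N) (nZ : Z <| N) (nD : D <| N) (nP : P <| N).
Hypotheses (sZE : Z \subset E) (sDZ : D \subset Z) (sPD : P \subset D).
Hypotheses (iNE : #|N : E| = p) (iEZ : #|E : Z| = p) (iZD : #|Z : D| = p) (iDP : #|D : P| = p).
Hypotheses (ZNP : [~: Z, N] \subset P) (END : [~: E, N] \subset D) (nENP : ~~ ([~: E, N] \subset P)).
Hypotheses (EEP : [~: E, E] \subset P) (expEP : forall y, y \in E -> y ^+ p \in P).
Hypothesis sM : {in N &, {morph s : x y / x * y}}.
Hypotheses (wD : weight s D P l) (wZ : weight s Z D 1) (wN : weight s N E (l ^ 2)).
Hypotheses (l12 : l != l ^ 2 %[mod p]) (l02 : 1 != l ^ 2 %[mod p]).

Let pNE : prime #|N : E|. Proof. by rewrite iNE. Qed.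
Let pEZ : prime #|E : Z|. Proof. by rewrite iEZ. Qed.
Let sEN := normal_sub nE.

Lemma config_notin : exists2 x, x \in N & x \notin E.
Proof. exact/subsetPn/(prime_index_nsub p_pr iNE). Qed.

Lemma config_der : [~: N, N] \subset D.
Proof.
have [x Nx notEx] := config_notin.
apply: (comm_step (normal_norm nD) (subxx _) sEN pNE Nx notEx _ END).
apply: (comm_step_r (normal_norm nD) sEN pNE Nx notEx) => [|m Em]; first by rewrite commgg group1.
by rewrite -groupV invg_comm (subsetP END) ?mem_commg.
Qed.

(** For [y] outside [E] the power [v] is fixed by [N] modulo [P], hence lies in [Z]. Modulo [P] the
    group [N] has class at most two with p-th powers multiplicative, so [v] inherits the weight
    [l ^ 2] of [y]. The factors [Z / D] and [D / P] have the weights 1 and [l], so [v] vanishes in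
    both. *)
Lemma config_exp y : y \in N -> y ^+ p \in P.
Proof.
move=> Ny; have [Ey | notEy] := boolP (y \in E); first exact: expEP.
pose v := y ^+ p.
have Ev : v \in E by apply: (prime_index_exp nE iNE Ny).
have vy : [~ v, y] = 1 by apply/eqP/commgP; apply: commute_sym (commuteX p (commute_refl y)).
have vP n : n \in N -> [~ v, n] \in P.
  apply: (comm_step_r (normal_norm nP) sEN pNE Ny notEy); first by rewrite vy group1.
  by move=> n' En'; rewrite (subsetP EEP) ?mem_commg.
have Zv : v \in Z.
  apply: contraR nENP => notZv.
  exact: (comm_step (normal_norm nP) sEN sZE pEZ Ev notZv vP ZNP).
have NP z : z \in N -> z \in 'N(P) by apply/subsetP/normal_norm.
have Nv := subsetP sEN v Ev.
have sv : v ^- (l ^ 2) * s v \in P.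
  have := wN Ny; set e := _ * s y => Ee; have Ne := subsetP sEN e Ee.
  have syE : s y = y ^+ (l ^ 2) * e by rewrite mulKVg.
  have Nyl := groupX (l ^ 2) Ny; have Nvl := groupX (l ^ 2) Nv.
  have svE : s v = (y ^+ (l ^ 2) * e) ^+ p by rewrite /v (weight_idX sM) // syE.
  have ND := normal_sub nD.
  have qX z n : z \in N -> coset P (z ^+ n) = coset P z ^+ n by move=> Nz; rewrite morphX ?NP.
  have Nm := groupM Nyl Ne.
  rewrite svE; apply: eq_coset; rewrite ?NP ?groupX //.
  rewrite (qX _ p Nm) morphM ?NP //=.
  rewrite (@class2_expM _ p (N / P) (D / P)) ?mem_quotient //.
  - rewrite -!qX // (coset_id (expEP Ee)) mulg1 -expgM mulnC expgM.
    by rewrite -/v.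
  - by rewrite -quotientR ?(normal_norm nP) // quotientS // config_der.
  - rewrite quotient_cents2 ?(subset_trans ND) ?(normal_norm nP) //.
    exact: subset_trans (commSg N sDZ) ZNP.
  by move=> _ /morphimP[z Nz Dz ->]; rewrite -morphX //; apply/coset_id/expEP/(subsetP sZE)/(subsetP sDZ).
have vp : v ^+ p \in P by apply: expEP.
have sPN := normal_sub nP; have sZN := subset_trans sZE sEN; have sDN := normal_sub nD.
have Dv : v \in D.
  exact: (weight_inj p_pr (subset_trans sZN (normal_norm nD)) wZ Zv (subsetP sPD _ vp) (subsetP sPD _ sv)).
exact: (weight_inj p_pr (subset_trans sDN (normal_norm nP)) wD Dv vp sv).
Qed.

End ExponentN.

(** * The tower below M; the letter [E] stands here for the group called L in the overview *)

Section Tower.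
Variables (gT : finGroupType) (p l k : nat) (M N E Z D P : {group gT}) (s : gT -> gT).
Hypotheses (p_pr : prime p) (pM : p.-group M) (secM : sections_le3 p M).
Hypotheses (nN : N <| M) (nE : E <| M) (nZ : Z <| M) (nD : D <| M) (nP : P <| M).
Hypotheses (sEN : E \subset N) (sZE : Z \subset E) (sDZ : D \subset Z) (sPD : P \subset D).
Hypotheses (iMN : #|M : N| = p) (iNE : #|N : E| = p) (iEZ : #|E : Z| = p).
Hypotheses (iZD : #|Z : D| = p) (iDP : #|D : P| = p).
Hypotheses (expN : forall y, y \in N -> y ^+ p \in P).
Hypotheses (ZNP : [~: Z, N] \subset P) (NND : [~: N, N] \subset D).
Hypotheses (nENP : ~~ ([~: E, N] \subset P)) (nNMZ : ~~ ([~: N, M] \subset Z)).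
Hypotheses (sM : {in M &, {morph s : x y / x * y}}) (stM : forall y, y \in M -> s y \in M).
Hypothesis stP : forall y, y \in P -> s y \in P.
Hypotheses (wD : weight s D P l) (wZ : weight s Z D 1).
Hypotheses (wE : weight s E Z (l ^ 2)) (wN : weight s N E k).
Hypotheses (kl : k * l = 1 %[mod p]) (l31 : l != l ^ 3 %[mod p]) (l30 : 1 != l ^ 3 %[mod p]).
Hypotheses (l32 : l ^ 2 != l ^ 3 %[mod p]) (l5 : 1 != l ^ 5 %[mod p]).

Let sNM := normal_sub nN.
Let pNE : prime #|N : E|. Proof. by rewrite iNE. Qed.
Let pEZ : prime #|E : Z|. Proof. by rewrite iEZ. Qed.
Let sEM := normal_sub nE.
Let sZM := normal_sub nZ.
Let sDM := normal_sub nD.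
Let sPZ := subset_trans sPD sDZ.
Let sPE := subset_trans sPZ sZE.
Let sPN := subset_trans sPE sEN.
Let NME : [~: N, M] \subset E. Proof. exact: (step_central p_pr pM nN nE sEN iNE). Qed.
Let EMZ : [~: E, M] \subset Z. Proof. exact: (step_central p_pr pM nE nZ sZE iEZ). Qed.
Let ZMD : [~: Z, M] \subset D. Proof. exact: (step_central p_pr pM nZ nD sDZ iZD). Qed.
Let DMP : [~: D, M] \subset P. Proof. exact: (step_central p_pr pM nD nP sPD iDP). Qed.
Let sZN := subset_trans sZE sEN.
Let NNZ : [~: N, N] \subset Z. Proof. exact: subset_trans NND sDZ. Qed.

Lemma comm_witness (A B C : {group gT}) : ~~ ([~: A, B] \subset C) ->
  exists a b, [/\ a \in A, b \in B & [~ a, b] \notin C].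
Proof.
rewrite gen_subG => /subsetPn[_ /imset2P[a b Aa Bb ->] notC].
by exists a, b.
Qed.

(** [[~: N, M]] is nontrivial modulo [Z], so the weight [j] of [M / N] satisfies k j = l^2, and [k]
    is the inverse of [l]. *)
Let top_weight : weight s M N (l ^ 3).
Proof.
have stE : forall v, v \in E -> s v \in E by move=> v; apply: weight_stable wE sZE.
have stN : forall v, v \in N -> s v \in N by move=> v; apply: weight_stable wN sEN.
have [j wM] := prime_index_weight p_pr sM (subxx M) sNM (normal_norm nN) iMN stM stN.
have [d [m [Nd Mm notZ]]] := comm_witness nNMZ.
have Edm : [~ d, m] \in E by rewrite (subsetP NME) ?mem_commg.
have dmp : [~ d, m] ^+ p \in Z by apply: (subsetP sPZ); apply: expN; apply: (subsetP sEN).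
have eqw := weight_comm p_pr sM (normal_norm nZ) sNM (subxx M) sEN sNM EMZ NNZ NME sEM EMZ
  wN wM wE Nd Mm dmp notZ.
apply: (weight_eqmod (normal_norm nN) _ wM) => [v Mv|]; first exact: (prime_index_exp nN iMN).
by rewrite -[j in LHS]mul1n -modnMml -kl modnMml -mulnA mulnCA -modnMmr -eqw modnMmr -expnS.
Qed.

Let expP (A : {group gT}) y : A \subset N -> y \in A -> y ^+ p \in P.
Proof. by move=> sAN Ay; apply: expN; apply: (subsetP sAN). Qed.

(** A nontrivial commutator would force l^3 = l. The same computation for [E] and [M] below would
    force l^2 l^3 = 1. *)
Let ZMP : [~: Z, M] \subset P.
Proof.
apply: contraT => /comm_witness[a [b [Za Mb notP]]].
have Dab : [~ a, b] \in D by rewrite (subsetP ZMD) ?mem_commg.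
have abp := expP (subset_trans sDZ sZN) Dab.
have eqw := weight_comm p_pr sM (normal_norm nP) sZM (subxx M) sDZ sNM DMP ZNP ZMD sDM DMP
  wZ top_weight wD Za Mb abp notP.
by move: l31; rewrite eqw mul1n eqxx.
Qed.

Let ENP' : [~: E, N] \subset D. Proof. exact: subset_trans (commSg N sEN) NND. Qed.

Let EMD : [~: E, M] \subset D.
Proof.
apply: contraT => /comm_witness[a [b [Ea Mb notD]]].
have Zab : [~ a, b] \in Z by rewrite (subsetP EMZ) ?mem_commg.
have abp : [~ a, b] ^+ p \in D by apply/(subsetP sPD)/(expP sZN Zab).
have eqw := weight_comm p_pr sM (normal_norm nD) sEM (subxx M) sZE sNM ZMD ENP' EMZ sZM ZMD
  wE top_weight wZ Ea Mb abp notD.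
by move: l5; rewrite eqw -expnD eqxx.
Qed.

(** Fix [u] in [E] outside [Z]. Its centraliser [H] modulo [P] has index at most p in [M], because
    [[~: E, M]] lies in [D]. As [Z] is central modulo [P], [H] centralises [E / P]; since [H / E] is
    cyclic, [H / P] is abelian. A p-th power of an element of [H] outside [N] has weight l^3, which
    none of [E / Z], [Z / D], [D / P] has. *)
Lemma tower_false : False.
Proof.
have p_gt0 := prime_gt0 p_pr; have p_gt1 := prime_gt1 p_pr.
have [u Eu notZu] : exists2 u, u \in E & u \notin Z.
  exact/subsetPn/(prime_index_nsub p_pr iEZ).
have Mu := subsetP sEM u Eu; have Nu := subsetP sEN u Eu.
have [H [sHM iMH memH]] := cent_mod_index nP sPD sDM Mu
  (fun n Mn => subsetP EMD _ (mem_commg Eu Mn)).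
have nPM := normal_norm nP; have MP y : y \in M -> y \in 'N(P) by apply/subsetP.
have sEH : E \subset H.
  apply/subsetP=> y Ey; rewrite memH (subsetP sEM) //=; move: y Ey.
  apply: (comm_step_r (subset_trans sEM nPM) sZE pEZ Eu notZu); first by rewrite commgg group1.
  move=> z Zz; rewrite -groupV invg_comm (subsetP ZNP) // mem_commg //.
have uH h : h \in H -> [~ u, h] \in P by rewrite memH => /andP[].
have HNE y : y \in H -> y \in N -> y \in E.
  move=> Hy Ny; apply: contraR nENP => notEy.
  apply: (comm_step (subset_trans sNM nPM) sEN sZE pEZ Eu notZu _ ZNP).
  by apply: (comm_step_r (subset_trans sNM nPM) sEN pNE Ny notEy (uH y Hy)) => n /(subsetP sEH)/uH.
have EHP : [~: E, H] \subset P.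
  apply: (comm_step (subset_trans sHM nPM) sEH sZE pEZ Eu notZu uH).
  exact: subset_trans (commgS Z sHM) ZMP.
have sPH := subset_trans sPE sEH.
have leMH : #|M : H| <= p by rewrite -iDP.
have geH : p ^ 4 <= #|H : P|.
  rewrite -(@leq_pmul2l p) // -expnS; apply: leq_trans (_ : #|M : H| * #|H : P| <= _).
    rewrite (Lagrange_index sHM sPH) -(Lagrange_index sNM sPN) -(Lagrange_index sEN sPE).
    rewrite -(Lagrange_index sZE sPZ) -(Lagrange_index sDZ sPD) iMN iNE iEZ iZD iDP.
    by rewrite !expnS expn0 muln1.
  by rewrite leq_mul.
have iEP : #|E : P| = (p ^ 3)%N.
  by rewrite -(Lagrange_index sZE sPZ) -(Lagrange_index sDZ sPD) iEZ iZD iDP !expnS expn0 muln1.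
have [h Hh notEh] : exists2 h, h \in H & h \notin E.
  apply/subsetPn/negP=> sHE; have: p ^ 4 <= p ^ 3.
    by rewrite -iEP (leq_trans geH) // subset_leq_card // imsetS.
  by rewrite leq_exp2l.
have iHE : #|H : E| = p.
  apply: (index_pgroup_eq p_pr (pgroupS sHM pM) sEH); first by apply: contra notEh => /subsetP->.
  have -> : E :=: H :&: N.
    apply/eqP; rewrite eqEsubset subsetI sEH sEN; apply/subsetP=> y /setIP[Hy Ny].
    exact: HNE.
  by rewrite indexgI -iMN subset_leq_card // imsetS.
have pHE : prime #|H : E| by rewrite iHE.
have nPH := subset_trans sHM nPM.
have HHP : [~: H, H] \subset P.
  apply: (comm_step nPH (subxx H) sEH pHE Hh notEh _ EHP).
  apply: (comm_step_r nPH sEH pHE Hh notEh); first by rewrite commgg group1.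
  by move=> e Ee; rewrite -groupV invg_comm (subsetP EHP) ?mem_commg.
pose t := coset P.
have tM x y : x \in M -> y \in M -> t (x * y) = t x * t y.
  by move=> Mx My; rewrite /t morphM ?MP.
have tX x n : x \in M -> t (x ^+ n) = t x ^+ n by move=> Mx; rewrite /t morphX ?MP.
have tR x y : x \in M -> y \in M -> t [~ x, y] = [~ t x, t y].
  by move=> Mx My; rewrite /t morphR ?MP.
have t1 x : x \in P -> t x = 1 by apply: coset_id.
have expH y : y \in H -> y ^+ p \in P.
  move=> Hy; have My := subsetP sHM y Hy.
  have [Ny | notNy] := boolP (y \in N); first exact: expN.
  pose v := y ^+ p.
  have Ev : v \in E by apply: HNE; [apply: groupX | apply: (prime_index_exp nN iMN)].
  have Mv := subsetP sEM v Ev; have Msy := stM My; have Msu := stM Mu.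
  (* [s] maps [[~ u, y]] into [P], and [s u] is [u ^+ (l ^ 2)] times an element that is central
     modulo [P]; so [[~ u, s y]] to the power l^2 lies in [P]. *)
  have Hsy : s y \in H.
    rewrite memH Msy /=; apply: contraT => notP.
    have Dusy : [~ u, s y] \in D by rewrite (subsetP EMD) ?mem_commg.
    have Musy := subsetP sDM _ Dusy.
    have nt : t [~ u, s y] != 1 by apply: contra notP => /eqP/coset_idr->; rewrite ?MP.
    have := wE Eu; set z := _ * s u => Zz; have Mz := subsetP sZM z Zz.
    have suE : s u = u ^+ (l ^ 2) * z by rewrite mulKVg.
    have cu : commute (t u) [~ t u, t (s y)].
      rewrite -tR //; apply/commute_sym/commute_coset; rewrite ?MP //.
      by rewrite (subsetP DMP) ?mem_commg.
    have zy : [~ t z, t (s y)] = 1 by rewrite -tR // t1 // (subsetP ZMP) ?mem_commg.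
    have : [~ t (s u), t (s y)] = 1 by rewrite -tR // -(weight_idR sM) // t1 // stP // uH.
    rewrite suE tM ?groupX // tX // commMgJ zy mulg1 => /eqP; rewrite conjg_eq1 commXg //.
    (* It remains to divide by l^2, which is nonzero modulo p: otherwise l^2 and l^3 would both be
       zero, against [l32]. *)
    rewrite -tR // => /eqP e0; move: l32.
    have e1 : t [~ u, s y] ^+ p = 1 by rewrite -tX // t1 // (expP (subset_trans sDZ sZN)).
    have := expg_eq_mod p_pr e1 (etrans e0 (esym (expg0 _))) nt.
    move=> e2; have e3 : l ^ 3 = 0 %[mod p] by rewrite expnS -modnMmr e2 modnMmr muln0.
    by rewrite e2 e3 eqxx.
  have := top_weight My; set n0 := _ * s y => Nn0; have Mn0 := subsetP sNM _ Nn0.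
  have En0 : n0 \in E by apply: HNE => //; rewrite groupM // groupV groupX.
  have syE : s y = y ^+ (l ^ 3) * n0 by rewrite mulKVg.
  have Myl := groupX (l ^ 3) My.
  have sv : v ^- (l ^ 3) * s v \in P.
    have Myn := groupM Myl Mn0; have Myp := groupX p My.
    rewrite /v (weight_idX sM) // syE; apply: eq_coset; [exact/MP/groupX | exact/MP/groupX |].
    rewrite -/(t _) -/(t _) (tX _ (l ^ 3)%N Myp) (tX _ p My) (tX _ p Myn) (tM _ _ Myl Mn0).
    have cyn : commute (t (y ^+ (l ^ 3))) (t n0).
      apply: commute_coset; rewrite ?MP //; apply: (subsetP HHP); rewrite mem_commg ?groupX //.
      exact: (subsetP sEH).
    rewrite expgMn // (tX _ _ My) -(tX n0 p) // (t1 (n0 ^+ p)) ?expN // mulg1.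
    by rewrite -!expgM mulnC.
  have vp : v ^+ p \in P by apply: expP Ev.
  have Zv : v \in Z.
    exact: (weight_inj p_pr (subset_trans sEM (normal_norm nZ)) wE Ev (subsetP sPZ _ vp) (subsetP sPZ _ sv)).
  have Dv : v \in D.
    exact: (weight_inj p_pr (subset_trans sZM (normal_norm nD)) wZ Zv (subsetP sPD _ vp) (subsetP sPD _ sv)).
  exact: (weight_inj p_pr (subset_trans sDM nPM) wD Dv vp sv l31).
have : #|H / P| <= p ^ 3.
  apply: secM => //; first by rewrite /normal sPH.
  apply/abelemP=> //; split; first by rewrite /abelian quotient_cents2.
  by move=> _ /morphimP[y Ny Hy ->]; rewrite -morphX //; apply/coset_id/expH.
rewrite card_quotient // => le3.
by have := leq_trans geH le3; rewrite leq_exp2l.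
Qed.

End Tower.

(** * Fusion systems *)

Section Fusion.
Variables (gT : finGroupType) (S : {group gT}) (F : {set gT} -> {ffun gT -> gT} -> bool).
Hypothesis fusF : is_fusion_system S F.
Implicit Types P Q : {group gT}.

Lemma fus_mor (P : {set gT}) f : F P f ->
  [/\ group_set P, P \subset S, {in P &, {morph f : x y / x * y}},
      {in P &, injective f} & f @: P \subset S].
Proof. by case: fusF => H _; apply: H. Qed.

Lemma fus_ext (P : {set gT}) (f g : {ffun gT -> gT}) : F P f -> {in P, f =1 g} -> F P g.
Proof. by case: fusF => _ [H _]; apply: H. Qed.

Lemma fus_conj P y : P \subset S -> y \in S -> F P [ffun x => x ^ y].
Proof. by case: fusF => _ [_ [H _]] sPS Sy; apply: H => //; apply: groupP. Qed.

Lemma fus_res (P : {set gT}) Q f : F P f -> Q \subset P -> F Q f.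
Proof. by case: fusF => _ [_ [_ [H _]]] Ff sQP; apply: H Ff _ sQP; apply: groupP. Qed.

Lemma fus_comp (P : {set gT}) f g : F P f -> F (f @: P) g -> F P [ffun x => g (f x)].
Proof. by case: fusF => _ [_ [_ [_ [H _]]]]; apply: H. Qed.

Lemma fus_inv (P : {set gT}) f : F P f -> exists g : {ffun gT -> gT}, F (f @: P) g /\ {in P, forall x, g (f x) = x}.
Proof. by case: fusF => _ [_ [_ [_ [_ H]]]]; apply: H. Qed.

Lemma fus_id P : P \subset S -> F P (finfun id).
Proof.
move=> sPS; apply: (fus_ext (fus_conj sPS (group1 S))) => x _.
by rewrite !ffunE conjg1.
Qed.

Lemma Aut_imset P (a : {perm gT}) : a \in Aut P -> a @: P = P.
Proof.
move=> Aa; apply/eqP; rewrite eqEcard card_imset ?leqnn ?andbT; last exact: perm_inj.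
by apply/subsetP=> _ /imsetP[x Px ->]; apply: Aut_closed.
Qed.

Lemma finfun_imset (f : gT -> gT) (P : {set gT}) : finfun f @: P = f @: P.
Proof. by apply: eq_imset => x; rewrite ffunE. Qed.

Lemma AutF_group_set P : P \subset S -> group_set (AutF F P).
Proof.
move=> sPS; apply/group_setP; split.
  apply/setIdP; split; first exact: group1.
  apply: (fus_ext (fus_id sPS)) => x _.
  by rewrite !ffunE perm1.
move=> a b /setIdP[Aa Fa] /setIdP[Ab Fb].
have Fb' : F (finfun a @: P) (finfun b) by rewrite finfun_imset Aut_imset.
apply/setIdP; split; first exact: groupM.
by apply: (fus_ext (fus_comp Fa Fb')) => x _; rewrite !ffunE permM.
Qed.

Lemma AutF_sub P : AutF F P \subset Aut P.
Proof. by apply/subsetP=> a; case/setIdP. Qed.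

Lemma AutS_P P a :
  reflect (exists2 y, y \in 'N_S(P) & a = conj_aut P y) (a \in AutS S P).
Proof.
rewrite inE; apply: (iffP andP) => [[Aa /exists_inP[y NSy /forall_inP ay]] | [y NSy ->]].
  exists y => //; apply: (eq_Aut Aa (Aut_aut _ _)) => x Px.
  rewrite norm_conj_autE //; last by case/setIP: NSy.
  exact/eqP/ay.
split; first exact: Aut_aut.
apply/exists_inP; exists y => //; apply/forall_inP=> x Px.
by rewrite norm_conj_autE //; case/setIP: NSy.
Qed.

Lemma AutSE P : AutS S P = conj_aut P @* 'N_S(P).
Proof.
apply/setP=> a; apply/AutS_P/morphimP => [[y NSy ->] | [y Ny NSy ->]]; last by exists y.
by exists y => //; case/setIP: NSy.
Qed.

Lemma InnPE P : InnP P = conj_aut P @* P.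
Proof.
apply/setP=> a; rewrite inE; apply/andP/morphimP => [[Aa /exists_inP[y Py /forall_inP ay]] | [y Ny Py ->]].
  exists y; rewrite ?(subsetP (normG P)) //.
  apply: (eq_Aut Aa (Aut_aut _ _)) => x Px.
  by rewrite norm_conj_autE ?(subsetP (normG P)) //; apply/eqP/ay.
split; first exact: Aut_aut.
by apply/exists_inP; exists y => //; apply/forall_inP=> x Px; rewrite norm_conj_autE.
Qed.

Lemma AutS_sub_AutF P : P \subset S -> AutS S P \subset AutF F P.
Proof.
move=> sPS; apply/subsetP=> _ /AutS_P[y /setIP[Sy Ny] ->]; apply/setIdP; split; first exact: Aut_aut.
by apply: (fus_ext (fus_conj sPS Sy)) => x Px; rewrite !ffunE norm_conj_autE.
Qed.

Lemma fus_aut P (f : {ffun gT -> gT}) : F P f -> f @: P = P -> exists2 a, a \in AutF F P & {in P, a =1 f}.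
Proof.
move=> Ff fP; have [_ sPS fM finj _] := fus_mor Ff.
pose fm := Morphism fM.
have injf : 'injm fm by apply/injmP.
have imf : fm @* P = P by rewrite morphimEdom.
exists (aut injf imf); last exact: autE.
rewrite inE Aut_aut; apply: (fus_ext Ff) => x Px; by rewrite ffunE autE.
Qed.

End Fusion.

(** The condition on [X] says that it lies in the extension domain [Nphi] of [a]. As [a] maps [P] to
    itself, the image is fully normalised, hence fully centralised as the extension axiom
    demands. *)
Lemma saturated_extend (gT : finGroupType) (p : nat) (S P X : {group gT})
    (F : {set gT} -> {ffun gT -> gT} -> bool) (a : {perm gT}) :
  saturated F p S -> P \subset S -> fully_normalized F S P -> a \in AutF F P ->
  X \subset 'N_S(P) ->
  (forall x, x \in X -> exists2 h : gT, h \in 'N_S(P) & {in P, forall y, a (y ^ x) = a y ^ h}) ->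
  exists2 f : {ffun gT -> gT}, F X f & {in P, f =1 a}.
Proof.
case=> fusF [satN satC] sPS fnP Aa sXN extX.
have [fcP _] := satN P sPS fnP.
have [AutPa Fa] : a \in Aut P /\ F P (finfun a) by apply/andP; move: Aa; rewrite inE.
have aP : finfun a @: P = P by rewrite finfun_imset Aut_imset.
have [|f [Ff fa]] := satC P (finfun a) Fa; first by rewrite aP.
exists f; last by move=> x Px; rewrite fa // ffunE.
apply: (fus_res fusF Ff); apply/subsetP=> x Xx; rewrite inE (subsetP sXN) //=.
have [h Nh ah] := extX x Xx; apply/exists_inP; exists h; first by rewrite aP.
by apply/forall_inP=> y Py; rewrite !ffunE ah.
Qed.

(** * The torus case *)

Lemma char_Aut_imset (gT : finGroupType) (K N : {group gT}) (a : {perm gT}) :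
  K \char N -> a \in Aut N -> a @: K = K.
Proof.
move=> chK AutNa; apply/eqP; rewrite eqEcard card_imset ?leqnn ?andbT; last exact: perm_inj.
by apply/subsetP=> _ /imsetP[x Kx ->]; apply: char_Aut_closed chK AutNa Kx.
Qed.

(** * Recovering [P], [D] and [Z] from [N] alone *)

Section Chain.
Variables (gT : finGroupType) (p l : nat) (N E Z D P : {group gT}) (s : gT -> gT).
Hypotheses (p_pr : prime p) (p_odd : odd p) (pN : p.-group N) (secN : sections_le3 p N).
Hypotheses (nE : E <| N) (nZ : Z <| N) (nD : D <| N) (nP : P <| N).
Hypotheses (sZE : Z \subset E) (sDZ : D \subset Z) (sPD : P \subset D).
Hypotheses (iNE : #|N : E| = p) (iEZ : #|E : Z| = p) (iZD : #|Z : D| = p) (iDP : #|D : P| = p).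
Hypotheses (ZNP : [~: Z, N] \subset P) (END : [~: E, N] \subset D) (nENP : ~~ ([~: E, N] \subset P)).
Hypotheses (EEP : [~: E, E] \subset P).
Hypothesis expN : forall y, y \in N -> y ^+ p \in P.
Hypothesis NND : [~: N, N] \subset D.

Let sEN := normal_sub nE.
Let p_gt1 := prime_gt1 p_pr.
Let pr_index (X Y : {group gT}) : #|X : Y| = p -> prime #|X : Y|.
Proof. by move=> ->. Qed.
Let not_sub (X Y : {group gT}) : #|X : Y| = p -> ~~ (X \subset Y).
Proof. exact: prime_index_nsub. Qed.

(** So [Z / P] is the whole centre of [N / P]. A central element outside [Z] would generate [E]
    together with [Z], or [N] together with [E]; as [Z / P] is central and [E / P] abelian,
    [[~: E, N]] would lie in [P] either way. *)
Lemma chain_center y : y \in N -> (forall n, n \in N -> [~ y, n] \in P) -> y \in Z.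
Proof.
move=> Ny yP; have nPN := normal_norm nP.
have [Ey | notEy] := boolP (y \in E).
  apply: contraT => notZy; case/negP: nENP.
  exact: (comm_step nPN sEN sZE (pr_index iEZ) Ey notZy yP ZNP).
case/negP: nENP; rewrite gen_subG; apply/subsetP=> _ /imset2P[x n Ex Nn ->].
apply: (comm_step_r nPN sEN (pr_index iNE) Ny notEy _ _ Nn) => [|m Em].
  by rewrite -groupV invg_comm yP // (subsetP sEN).
by rewrite (subsetP EEP) ?mem_commg.
Qed.

Lemma chain_der : D :=: [~: N, N] <*> P.
Proof.
have sPN := normal_sub nP.
have [a notPa] : exists2 a, a \in [~: N, N] & a \notin P.
  by apply/subsetPn; apply: contra nENP; apply: subset_trans; apply: commSg.
move=> Na; symmetry; apply: (prime_index_eq (pr_index iDP) sPD (joing_subr _ _) _ _ Na).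
  by rewrite join_subG NND.
exact: (subsetP (joing_subl _ _)).
Qed.

(** The image of [P] under an automorphism of [N] has the same index, contains the same p-th powers
    and leaves a derived subgroup of order p, so [pencil] identifies the two. *)
Lemma chain_char_bottom : P \char N.
Proof.
have [sPN sDN sZN] := And3 (normal_sub nP) (normal_sub nD) (normal_sub nZ).
apply/charP; split=> // f injf fN.
have iNP : #|N : P| = (p ^ 4)%N.
  rewrite -(Lagrange_index sEN (subset_trans (subset_trans sPD sDZ) sZE)) iNE.
  by rewrite -(Lagrange_index sZE (subset_trans sPD sDZ)) iEZ -(Lagrange_index sDZ sPD) iZD iDP.
have sfPN : f @* P \subset N by apply: subset_trans (morphimS f sPN) _; rewrite fN.
have nfP : f @* P <| N by have := morphim_normal f nP; rewrite fN.
have iND : #|[~: N, N] <*> P : P| = p by rewrite -chain_der.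
symmetry; apply: (pencil (Z1 := Z) p_pr pN secN nP nfP) => //.
- move=> y Ny; rewrite inE expN //; have: y \in f @* N by rewrite fN.
  case/morphimP=> [x _ Nx ->].
  by rewrite -morphX //; apply: mem_morphim; [apply: groupX | apply: expN].
- by have := index_injm P injf (subxx N); rewrite {1}fN /= => ->.
- have sR : [~: N, N] \subset N by rewrite commg_subl normG.
  have -> : [~: N, N] <*> f @* P = f @* ([~: N, N] <*> P).
    by rewrite morphimY //= morphimR // fN.
  by rewrite index_injm // join_subG sR.
- exact: subset_trans sPD sDZ.
by rewrite -chain_der not_sub.
Qed.

Lemma chain_char_der : D \char N.
Proof.
by rewrite chain_der; rewrite charY ?chain_char_bottom ?charR ?char_refl.
Qed.

Lemma chain_char_center : Z \char N.
Proof.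
have sZN := normal_sub nZ; apply/charP; split=> // f injf fN.
apply/eqP; rewrite eqEcard card_injm // leqnn andbT.
apply/subsetP=> _ /morphimP[z Nz Zz ->]; apply: chain_center => [|n].
  by have := mem_morphim f Nz Nz; rewrite fN.
move=> Nn; have: n \in f @* N by rewrite fN.
case/morphimP=> m _ Nm ->; rewrite -morphR //.
have /charP[_ /(_ f injf fN) <-] := chain_char_bottom.
by apply: mem_morphim; [apply: groupR | rewrite (subsetP ZNP) ?mem_commg].
Qed.

End Chain.

Lemma prime_index_uniq (gT : finGroupType) p (X Y B : {group gT}) v : prime p ->
  #|X : B| = p -> #|Y : B| = p -> B \subset X -> B \subset Y ->
  v \in X -> v \in Y -> v \notin B -> X :=: Y.
Proof.
move=> p_pr iX iY sBX sBY Xv Yv notBv.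
have XYv : v \in X :&: Y by rewrite inE Xv.
have sB : B \subset X :&: Y by rewrite subsetI sBX.
rewrite -(@prime_index_eq _ X B (X :&: Y)%G v _ sBX sB (subsetIl _ _) XYv notBv) ?iX //=.
by rewrite -{2}(@prime_index_eq _ Y B (X :&: Y)%G v _ sBY sB (subsetIr _ _) XYv notBv) ?iY.
Qed.

(** [N / Z] has order p^2 and [L / Z] is a line fixed by [M]. Modulo [Z] the map sending [m] to
    [[~ e, m]] is a homomorphism because [[~: L, M]] lies in [Z]; its image is nontrivial, hence all
    of [L / Z]. So conjugation shifts [e] by any element of [L / Z], which reaches every line except
    [L / Z]. *)
Lemma lines_conj (gT : finGroupType) p (M N L Z E X : {group gT}) :
  prime p -> Z <| M -> N <| M -> L <| M -> Z \subset L -> L \subset N ->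
  #|N : L| = p -> #|L : Z| = p -> [~: L, M] \subset Z ->
  Z \subset E -> E \subset N -> #|E : Z| = p -> ~~ ([~: E, M] \subset Z) ->
  [~: E, M] \subset L ->
  Z \subset X -> X \subset N -> #|X : Z| = p -> X :!=: L ->
  exists2 m, m \in M & X :=: E :^ m.
Proof.
move=> p_pr nZM nNM nLM sZL sLN iNL iLZ LMZ sZE sEN iEZ nEMZ EML sZX sXN iXZ neXL.
have [e [m0 [Ee Mm0 notZ0]]] := comm_witness nEMZ.
have sZM := normal_sub nZM; have sNM := normal_sub nNM; have nZ := normal_norm nZM.
have Ne := subsetP sEN e Ee; have Me := subsetP sNM e Ne.
have [x Xx notLx] : exists2 x, x \in X & x \notin L.
  apply/subsetPn; apply: contra neXL => sXL; rewrite eqEcard sXL.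
  by rewrite -(Lagrange sZL) -(Lagrange sZX) iXZ iLZ leqnn.
have Nx := subsetP sXN x Xx.
have nLx : x \in 'N(L) by apply: (subsetP (normal_norm nLM)); apply: (subsetP sNM).
have defN : <[x]> * L = N.
  rewrite -norm_joinEl ?cycle_subG //.
  apply: (@prime_index_eq _ N L (<[x]> <*> L)%G x) => //; rewrite ?iNL ?joing_subr //.
    by rewrite join_subG cycle_subG Nx.
  by rewrite (subsetP (joing_subl _ _)) ?cycle_id.
have := Ne; rewrite -defN => /mulsgP[_ y /cycleP[j ->] Ly eE].
pose K := [set y in L | [exists m in M, [~ e, m]^-1 * y \in Z]].
have KP a : reflect (a \in L /\ exists2 m, m \in M & [~ e, m]^-1 * a \in Z) (a \in K).
  by rewrite inE; apply: (iffP andP) => -[La /exists_inP].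
have eML m : m \in M -> [~ e, m] \in L by move=> Mm; rewrite (subsetP EML) ?mem_commg.
have gK : group_set K.
  apply/group_setP; split.
    by apply/KP; split=> //; exists 1; rewrite ?commg1 ?mulg1 ?invg1 ?group1.
  move=> a b /KP[La [m Mm Za]] /KP[Lb [n Mn Zb]]; apply/KP; split; first exact: groupM.
  exists (m * n); first exact: groupM.
  have Mem := subsetP (normal_sub nLM) _ (eML m Mm).
  have -> : [~ e, m * n] = [~ e, n] * ([~ e, m] * [~ [~ e, m], n]).
    by rewrite commgMJ conjg_mulR.
  have Zm : [~ [~ e, m], n] \in Z by rewrite (subsetP LMZ) ?mem_commg ?eML.
  have N1 : [~ e, n] \in 'N(Z) by rewrite (subsetP nZ) ?groupR.
  have N2 : [~ e, m] \in 'N(Z) by rewrite (subsetP nZ).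
  have N3 := subsetP (normG Z) _ Zm.
  have [Na Nb] : a \in 'N(Z) /\ b \in 'N(Z).
    by split; rewrite (subsetP nZ) // (subsetP (normal_sub nLM)).
  have tM u v : u \in 'N(Z) -> v \in 'N(Z) -> coset Z (u * v) = coset Z u * coset Z v.
    by move=> Nu Nv; rewrite morphM.
  apply: eq_coset; first exact: (groupM N1 (groupM N2 N3)); first exact: (groupM Na Nb).
  rewrite (tM _ _ N1 (groupM N2 N3)) (tM _ _ N2 N3) (tM _ _ Na Nb) (coset_id Zm) mulg1.
  rewrite (coset_eq N2 Za) (coset_eq N1 Zb).
  apply: commute_coset => //.
  by rewrite (subsetP LMZ) ?mem_commg // (subsetP (normal_sub nLM)).
have sZK : Z \subset K.
  apply/subsetP=> z Zz; apply/KP; split; first exact: (subsetP sZL).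
  by exists 1 => //; rewrite commg1 invg1 mul1g.
have sKL : K \subset L by apply/subsetP=> a /KP[].
have Ke : [~ e, m0] \in K.
  by apply/KP; split; [exact: eML | exists m0; rewrite // mulVg].
have defK := prime_index_eq (K := Group gK) (etrans (congr1 prime iLZ) p_pr) sZL sZK sKL Ke notZ0.
have : y^-1 \in K by rewrite -[K]/(gval (Group gK)) defK groupV.
case/KP=> _ [m Mm Zm].
exists m => //; have nZm : Z :^ m = Z by rewrite (normsP nZ).
apply: (prime_index_uniq (v := e ^ m) (B := Z) p_pr iXZ _ sZX).
- by rewrite -[X in #|_ : X|]nZm indexJg.
- by rewrite -nZm conjSg.
- have -> : e ^ m = x ^+ j * ([~ e, m]^-1 * y^-1)^-1.
    by rewrite invMg !invgK mulgA -eE -conjg_mulR.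
  by rewrite groupM ?groupX ?groupV // (subsetP sZX).
- by rewrite memJ_conjg.
rewrite -nZm memJ_conjg; apply: contra notZ0 => Ze.
by rewrite /commg groupM ?groupV // memJ_norm // (subsetP nZ).
Qed.

Lemma Aut_morph (gT : finGroupType) (N : {group gT}) (a : {perm gT}) :
  a \in Aut N -> {in N &, {morph a : x y / x * y}}.
Proof. by move=> Aa x y Nx Ny; rewrite -(autmE Aa) morphM. Qed.

Lemma index_cycle_join (gT : finGroupType) p (Z : {group gT}) x :
  prime p -> x \in 'N(Z) -> x ^+ p \in Z -> x \notin Z -> #|<[x]> <*> Z : Z| = p.
Proof.
move=> p_pr Nx xp notZx; have sxN : <[x]> \subset 'N(Z) by rewrite cycle_subG.
rewrite -card_quotient ?join_subG ?sxN ?normG // quotientYidr //.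
rewrite quotient_cycle // -orderE; apply: nt_prime_order => //.
  by rewrite -morphX //; apply: coset_id.
by apply: contra notZx => /eqP/coset_idr->.
Qed.

(** Cayley-Hamilton in multiplicative notation: if s sends x to x^m y and y to y^k, then (s - k) x
    is an eigenvector with eigenvalue m. *)
Lemma eigen_identity (gT : finGroupType) (x y : gT) k m : commute x y ->
  (x ^- k * (x ^+ m * y)) ^+ m = (x ^+ m * y) ^- k * ((x ^+ m * y) ^+ m * y ^+ k).
Proof.
move=> cxy; set w := x ^+ m * y.
have cxmy : commute (x ^+ m) y by apply/commute_sym/commuteX/commute_sym.
have cxw : commute x w by apply: commuteM => //; apply: commuteX.
have cwy : commute w y by apply/commute_sym/commuteM => //; apply: commute_sym.
rewrite expgMn; last by apply/commute_sym/commuteV/commuteX/commute_sym.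
rewrite [w ^+ m * y ^+ k](commuteX2 m k cwy) mulgA; congr (_ * _).
rewrite expgVn [w ^+ k]expgMn // (commuteX2 k k cxmy) invMg mulgKV.
by rewrite expgAC.
Qed.

Section Eigenline.
Variables (gT : finGroupType) (p : nat) (N : {group gT}) (s : gT -> gT).
Hypotheses (p_pr : prime p) (sM : {in N &, {morph s : x y / x * y}}).

Lemma weight_gen (A C B : {group gT}) i x :
  A \subset N -> A \subset 'N(B) -> [~: A, A] \subset B -> C \subset A -> prime #|A : C| ->
  x \in A -> x \notin C -> weight s C B i -> x ^- i * s x \in B -> weight s A B i.
Proof.
move=> sAN nBA ABA sCA pAC Ax notCx wC xB.
pose K := [set v in A | v ^- i * s v \in B].
have gK : group_set K.
  apply/group_setP; split.
    by rewrite inE group1 expg1n invg1 mul1g (weight_id1 sM) group1.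
  move=> v w /setIdP[Av Bv] /setIdP[Aw Bw]; apply/setIdP; split; first exact: groupM.
  have [Nv Nw] : v \in 'N(B) /\ w \in 'N(B) by split; apply: (subsetP nBA).
  have svE y : s y = y ^+ i * (y ^- i * s y) by rewrite mulKVg.
  rewrite sM ?(subsetP sAN) // (svE v) (svE w).
  have N1 := subsetP (normG B) _ Bv; have N2 := subsetP (normG B) _ Bw.
  have [Ni Nj] := conj (groupX i Nv) (groupX i Nw).
  apply: eq_coset.
  - by apply/groupX/groupM.
  - by apply: groupM; apply: groupM.
  have tM u t : u \in 'N(B) -> t \in 'N(B) -> coset B (u * t) = coset B u * coset B t.
    by move=> Nu Nt; rewrite morphM.
  have tX u n : u \in 'N(B) -> coset B (u ^+ n) = coset B u ^+ n by move=> Nu; rewrite morphX.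
  rewrite (tX _ _ (groupM Nv Nw)) (tM _ _ Nv Nw) (tM _ _ (groupM Ni N1) (groupM Nj N2)).
  rewrite (tM _ _ Ni N1) (tM _ _ Nj N2) (coset_id Bv) (coset_id Bw) !mulg1 !tX //.
  by apply: expgMn; apply: commute_coset => //; rewrite (subsetP ABA) ?mem_commg.
have sCK : C \subset Group gK.
  by apply/subsetP=> v Cv; apply/setIdP; split; [apply: (subsetP sCA) | apply: wC].
have sKA : Group gK \subset A by apply/subsetP=> v /setIdP[].
have Kx : x \in Group gK by apply/setIdP.
have defK := prime_index_eq pAC sCA sCK sKA Kx notCx.
by move=> v Av; have: v \in Group gK by [rewrite defK]; case/setIdP.
Qed.

Lemma eigenline (E Z : {group gT}) k m :
  Z <| N -> Z \subset E -> E \subset N -> #|N : E| = p -> [~: N, N] \subset Z ->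
  (forall y, y \in N -> y ^+ p \in Z) -> weight s E Z k -> weight s N E m ->
  (forall z, z \in Z -> s z \in Z) -> k != m %[mod p] ->
  exists L : {group gT}, [/\ Z \subset L, L \subset N, #|L : Z| = p,
    weight s L Z m & weight s N L k].
Proof.
move=> nZN sZE sEN iNE NNZ expNZ wE wN sZ neq_km.
have p_gt1 := prime_gt1 p_pr; have sZN := normal_sub nZN; have nZ := normal_norm nZN.
have [x Nx notEx] : exists2 x, x \in N & x \notin E.
  exact/subsetPn/(prime_index_nsub p_pr iNE).
have nEN : N \subset 'N(E).
  by rewrite -commg_subr (subset_trans _ (subset_trans NNZ sZE)) // commgS.
have stN v : v \in N -> s v \in N by move=> Nv; apply: (weight_stable wN sEN).
(* This is (s - k) x, which s - m annihilates modulo [Z] by [eigen_identity]. *)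
pose y := x ^- k * s x.
have Ny : y \in N by rewrite groupM ?groupV ?groupX ?stN.
have notEy : y \notin E.
  apply/negP=> Ey; case/negP: notEx.
  by apply: (weight_inj p_pr nEN wN Nx _ Ey); rewrite ?(subsetP sZE) ?expNZ // eq_sym.
have notZy : y \notin Z by apply: contra notEy; apply: (subsetP sZE).
have nZy := subsetP nZ y Ny.
pose L := (<[y]> <*> Z)%G; have sZL : Z \subset L := joing_subr _ _.
have sLN : L \subset N by rewrite join_subG cycle_subG Ny.
have iLZ : #|L : Z| = p by apply: index_cycle_join; rewrite ?expNZ.
have Ly : y \in L by rewrite (subsetP (joing_subl _ _)) ?cycle_id.
have NNL := subset_trans NNZ sZL.
exists L; split=> //.
  apply: (weight_gen (C := Z) (x := y)); rewrite ?iLZ ?(subset_trans sLN) //.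
  - by apply: subset_trans NNZ; apply: commgSS.
  - by move=> z Zz; rewrite groupM ?groupV ?groupX ?sZ.
  have := wN x Nx; set e := _ * s x => Ee; have Ne := subsetP sEN e Ee.
  have sxE : s x = x ^+ m * e by rewrite mulKVg.
  have := wE e Ee; set z := _ * s e => Zz; have Nz := subsetP sZN z Zz.
  have seE : s e = e ^+ k * z by rewrite mulKVg.
  have [Nsx Nse] := conj (stN x Nx) (stN e Ne).
  have [Nxk Nxm] := conj (groupX k Nx) (groupX m Nx).
  have tM u t : u \in N -> t \in N -> coset Z (u * t) = coset Z u * coset Z t.
    by move=> Nu Nt; rewrite morphM ?(subsetP nZ).
  have tX u n : u \in N -> coset Z (u ^+ n) = coset Z u ^+ n.
    by move=> Nu; rewrite morphX ?(subsetP nZ).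
  have tV u : u \in N -> coset Z u^-1 = (coset Z u)^-1.
    by move=> Nu; rewrite morphV ?(subsetP nZ).
  apply: eq_coset; rewrite ?groupX ?(subsetP nZ _ (stN y Ny)) //.
  have cXE : commute (coset Z x) (coset Z e).
    by apply: commute_coset; rewrite ?(subsetP nZ) // (subsetP NNZ) ?mem_commg.
  have NVxk : x ^- k \in N by rewrite groupV.
  have tsx : coset Z (s x) = coset Z x ^+ m * coset Z e.
    by rewrite sxE tM // tX.
  have tssx : coset Z (s (s x)) = (coset Z x ^+ m * coset Z e) ^+ m * coset Z e ^+ k.
    have -> : s (s x) = s x ^+ m * (e ^+ k * z).
      by rewrite -seE -(weight_idX sM m Nx) -(sM Nxm Ne) -sxE.
    rewrite (tM _ _ (groupX m Nsx) (groupM (groupX k Ne) Nz)) (tM _ _ (groupX k Ne) Nz).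
    by rewrite (tX _ m Nsx) tsx (coset_id Zz) mulg1 (tX _ k Ne).
  have NVsxk : s x ^- k \in N by rewrite groupV groupX.
  have -> : s y = s x ^- k * s (s x).
    by rewrite /y (sM NVxk Nsx) (weight_idV sM Nxk) (weight_idX sM k Nx).
  rewrite (tX _ m Ny) (tM _ _ NVsxk (stN _ Nsx)) (tV _ (groupX k Nsx)) (tX _ k Nsx).
  rewrite (tM _ _ NVxk Nsx) (tV _ Nxk) (tX _ k Nx) tssx tsx.
  exact: eigen_identity.
apply: (weight_gen (C := E) (x := x)); rewrite ?iNE //.
- by rewrite -commg_subr (subset_trans _ NNL) // commgS.
- by move=> e Ee; apply: (subsetP sZL); apply: wE.
Qed.

(** On a stable [L / Z] of order p the map [s] is a scalar. Its nonzero images in [N / E] and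
    [N / K] would make that scalar both [m] and [k]. *)
Lemma eigenline_uniq (E Z L K : {group gT}) k m :
  L \subset N -> Z \subset E -> Z \subset L -> Z \subset K -> E \subset N -> K \subset N ->
  E <| N -> K <| N -> Z <| N ->
  (forall y, y \in N -> y ^+ p \in Z) -> #|L : Z| = p -> weight s N E m -> weight s N K k ->
  k != m %[mod p] -> ~~ (L \subset E) -> ~~ (L \subset K) ->
  (forall z, z \in Z -> s z \in Z) -> ~ (forall y, y \in L -> s y \in L).
Proof.
move=> sLN sZE sZL sZK sEN sKN nE nK nZ expNZ iLZ wE wK neq /subsetPn[u Lu notEu] /subsetPn[v Lv notKv] sZ sL.
have [j wj] := prime_index_weight p_pr sM sLN sZL (subset_trans sLN (normal_norm nZ)) iLZ sL sZ.
have [Nu Nv] := conj (subsetP sLN u Lu) (subsetP sLN v Lv).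
have [ejm | njm] := eqVneq (m %% p) (j %% p).
  case/negP: notKv; apply: (weight_inj p_pr (normal_norm nK) wK Nv _ (subsetP sZK _ (wj v Lv))).
    exact/(subsetP sZK)/expNZ.
  by rewrite -ejm.
case/negP: notEu; apply: (weight_inj p_pr (normal_norm nE) wE Nu _ (subsetP sZE _ (wj u Lu)) njm).
exact/(subsetP sZE)/expNZ.
Qed.

End Eigenline.

Lemma weight_mul1 (gT : finGroupType) (A B : {group gT}) (b c : {perm gT}) i : B \subset A ->
  weight b A B i -> weight c A B 1 -> weight (b * c) A B i.
Proof.
move=> sBA wb wc v Av; have Abv := weight_stable wb sBA Av.
have -> : v ^- i * (b * c) v = v ^- i * b v * (b v ^- 1 * c (b v)).
  by rewrite permM expg1 -mulgA mulKVg.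
by rewrite groupM ?wb ?wc.
Qed.

Lemma weight_conj (gT : finGroupType) (N A B A' B' : {group gT}) (b t : {perm gT}) i :
  t \in Aut N -> b \in Aut N -> A \subset N -> t @: A = A' -> t @: B = B' ->
  weight b A B i -> weight (b ^ t) A' B' i.
Proof.
move=> At Ab sAN tA tB wb v; rewrite -tA => /imsetP[w Aw ->]; rewrite permJ.
have tM := Aut_morph At; have Nw := subsetP sAN w Aw.
have Nbw : b w \in N by rewrite Aut_closed.
have Nwi := groupX i Nw.
have Nwi' : w ^- i \in N by rewrite groupV.
rewrite -(weight_idX tM) // -(weight_idV tM) // -(tM _ _ Nwi' Nbw) -tB.
by apply: imset_f; apply: wb.
Qed.

Section ChainSylow.
Variables (gT : finGroupType) (p : nat) (N : {group gT}) (A U : {group {perm gT}}).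
Variables (cs : seq ({group gT} * {group gT})) (t : {perm gT}).
Hypotheses (sAAut : A \subset Aut N) (sylU : p.-Sylow(A) U) (At : t \in A).
Hypothesis csP : forall c, c \in cs -> c.2 \subset c.1 /\ c.1 \subset N.
Hypothesis wU : forall b c, b \in U -> c \in cs -> weight b c.1 c.2 1.
Hypothesis tcs : forall c, c \in cs -> t @: c.1 = c.1 /\ t @: c.2 = c.2.

(** A Frattini argument. The elements of [A] that act trivially on all factors form a group [X],
    which contains [U] as a Sylow subgroup and also [U :^ t]. Some element of [X] takes [U :^ t]
    back to [U], and correcting [t] by it leaves the weights alone. *)
Lemma chain_sylow : exists n, [/\ n \in A, U :^ n = U &
  forall c i, c \in cs -> weight t c.1 c.2 i -> weight n c.1 c.2 i].
Proof.
pose X := [set b in A | all (fun c : {group gT} * {group gT} =>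
  [forall v in c.1, v ^- 1 * b v \in c.2]) cs].
have XP b : reflect (b \in A /\ forall c, c \in cs -> weight b c.1 c.2 1) (b \in X).
  rewrite inE; apply: (iffP andP) => -[Ab H]; split=> //.
    by move=> c /(allP H)/forall_inP.
  by apply/allP=> c /H wb; apply/forall_inP.
have gX : group_set X.
  apply/group_setP; split.
    by apply/XP; split=> [|c _ v _]; rewrite ?group1 // perm1 mulVg group1.
  move=> b c /XP[Ab wb] /XP[Ac wc]; apply/XP; split=> [|d csd]; first exact: groupM.
  by apply: weight_mul1; [case: (csP csd) | apply: wb | apply: wc].
have sXA : Group gX \subset A by apply/subsetP=> b /XP[].
have sUX : U \subset Group gX.
  by apply/subsetP=> b Ub; apply/XP; split=> [|c]; [apply: (subsetP (pHall_sub sylU)) | apply: wU].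
have sylUX := pHall_subl sUX sXA sylU.
have sUtX : U :^ t \subset Group gX.
  apply/subsetP=> _ /imsetP[b Ub ->]; have /XP[Ab wb] := subsetP sUX b Ub.
  apply/XP; split=> [|c csc]; first exact: groupJ.
  have [tc1 tc2] := tcs csc.
  by apply: (weight_conj _ _ _ tc1 tc2 (wb c csc)); [apply: (subsetP sAAut) .. | case: (csP csc)].
have [c Xc sUtc] := Sylow_subJ sylUX sUtX (etrans (pgroupJ p U t) (pHall_pgroup sylU)).
have /XP[Ac' wc'] : c^-1 \in Group gX by rewrite groupV.
exists (t * c^-1); split; first exact: groupM.
  apply/eqP; rewrite eqEcard cardJg leqnn andbT conjsgM.
  by rewrite sub_conjgV.
by move=> d i csd wt; apply: weight_mul1; [case: (csP csd) | | apply: wc'].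
Qed.

End ChainSylow.

Lemma normal_line (gT : finGroupType) p (M N Z : {group gT}) :
  prime p -> p.-group M -> Z <| M -> N <| M -> Z \subset N -> p %| #|N : Z| ->
  exists L : {group gT}, [/\ L <| M, Z \subset L, L \subset N & #|L : Z| = p].
Proof.
move=> p_pr pM nZM nNM sZN piNZ; have sNM := normal_sub nNM.
have nZN := subset_trans sNM (normal_norm nZM).
have pq : p.-group (M / Z) by apply: quotient_pgroup.
have nq : N / Z <| M / Z by apply: quotient_normal.
have le1 : 1 <= logn p #|N / Z|.
  by rewrite logn_gt0 mem_primes p_pr cardG_gt0 card_quotient.
have [Q [sQN nQM cQ]] := normal_pgroup pq nq le1.
have [L defQ sZL nLM] := inv_quotientN nZM nQM.
have sLN : L \subset N by rewrite -(quotientSGK _ sZN) -?defQ // (subset_trans (normal_sub nLM)) ?normal_norm.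
exists L; split=> //.
by rewrite -card_quotient -?defQ ?cQ ?expn1 // (subset_trans sLN).
Qed.

(** For [d] in [E] outside [Z], the centraliser of [d] modulo [Z] in [M] has index at most p. It
    normalises [E], which is generated by [d] and [Z], so it lies in [N]; this bounds [#|M : N|].
    [L] differs from [E] because [M] does not normalise [E]. *)
Lemma line_data (gT : finGroupType) p (M N E Z : {group gT}) :
  prime p -> p.-group M -> Z <| M -> N <| M -> Z \subset E -> E \subset N ->
  #|N : E| = p -> #|E : Z| = p -> ~~ (M \subset N) ->
  (forall m, m \in M -> m \in 'N(E) -> m \in N) ->
  exists L : {group gT}, [/\ [/\ L <| M, Z \subset L, L \subset N, #|L : Z| = p & #|N : L| = p],
    [/\ L :!=: E, [~: L, M] \subset Z & [~: N, M] \subset L],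
    ~~ ([~: E, M] \subset Z) & #|M : N| = p].
Proof.
move=> p_pr pM nZM nNM sZE sEN iNE iEZ nsMN NE; have sNM := normal_sub nNM.
have sZN := subset_trans sZE sEN.
have iNZ : #|N : Z| = (p * p)%N by rewrite -(Lagrange_index sEN sZE) iNE iEZ.
have [L [nLM sZL sLN iLZ]] : exists L : {group gT}, [/\ L <| M, Z \subset L, L \subset N & #|L : Z| = p].
  by apply: normal_line => //; rewrite iNZ dvdn_mulr.
have iNL : #|N : L| = p.
  apply/eqP; rewrite -(eqn_pmul2r (prime_gt0 p_pr)) -iNZ -{1}iLZ.
  by rewrite Lagrange_index.
have [m0 Mm0 notNm0] := subsetPn nsMN.
have neLE : L :!=: E.
  apply: contraNneq notNm0 => eLE; apply: NE => //.
  by rewrite -eLE; apply: (subsetP (normal_norm nLM)).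
have LMZ := step_central p_pr pM nLM nZM sZL iLZ.
have NML := step_central p_pr pM nNM nLM sLN iNL.
have nEMZ : ~~ ([~: E, M] \subset Z).
  apply: contra nsMN => EMZ; apply/subsetP=> m Mm; apply: NE => //.
  move: m Mm; apply/subsetP; rewrite -commg_subl; exact: subset_trans EMZ sZE.
exists L; split=> //.
have [d Ed notZd] : exists2 d, d \in E & d \notin Z.
  exact/subsetPn/(prime_index_nsub p_pr iEZ).
have Nd := subsetP sEN d Ed; have Md := subsetP sNM d Nd.
have dML n : n \in M -> [~ d, n] \in L by move=> Mn; rewrite (subsetP NML) ?mem_commg.
have [C [sCM iMC memC]] := cent_mod_index nZM sZL (normal_sub nLM) Md dML.
have sCN : C \subset N.
  apply/subsetP=> c; rewrite memC => /andP[Mc Zdc]; apply: NE => //.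
  rewrite inE; have nZc : Z :^ c = Z by rewrite (normsP (normal_norm nZM)).
  suff eEc : E :=: E :^ c by rewrite -eEc.
  have Edc : d ^ c \in E by rewrite conjg_mulR groupM // (subsetP sZE).
  apply: (prime_index_uniq (v := d ^ c) (B := Z) (Y := (E :^ c)%G) p_pr iEZ) => //.
  - by rewrite -[X in #|_ : X|]nZc indexJg.
  - by rewrite -nZc conjSg.
  - by rewrite memJ_conjg.
  by rewrite -nZc memJ_conjg.
apply: (index_pgroup_eq p_pr pM sNM nsMN).
by rewrite -iLZ; apply: leq_trans (dvdn_leq _ (indexgS _ sCN)) iMC; rewrite indexg_gt0.
Qed.

Lemma eq_weight (gT : finGroupType) (s t : gT -> gT) (A B : {set gT}) i :
  {in A, s =1 t} -> weight t A B i -> weight s A B i.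
Proof. by move=> est wt v Av; rewrite est // wt. Qed.

(** * Lifting the torus element to the normaliser of [N] *)

Section FusionTower.
Variables (gT : finGroupType) (p l k : nat) (S N E Z D P : {group gT}).
Variables (F : {set gT} -> {ffun gT -> gT} -> bool) (t : {perm gT}).
Hypotheses (p_pr : prime p) (p_odd : odd p) (pS : p.-group S) (secS : sections_le3 p S).
Hypotheses (satF : saturated F p S) (sNS : N \subset S) (fnN : fully_normalized F S N).
Hypotheses (nsSN : ~~ (S \subset N)) (NSE : forall y, y \in S -> y \in 'N(E) -> y \in N).
Hypotheses (nE : E <| N) (nZ : Z <| N) (nD : D <| N) (nP : P <| N).
Hypotheses (sZE : Z \subset E) (sDZ : D \subset Z) (sPD : P \subset D).
Hypotheses (iNE : #|N : E| = p) (iEZ : #|E : Z| = p) (iZD : #|Z : D| = p) (iDP : #|D : P| = p).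
Hypotheses (ZNP : [~: Z, N] \subset P) (END : [~: E, N] \subset D) (nENP : ~~ ([~: E, N] \subset P)).
Hypotheses (EEP : [~: E, E] \subset P) (expEP : forall y, y \in E -> y ^+ p \in P).
Hypothesis At : t \in AutF F N.
Hypotheses (wD : weight t D P l) (wZ : weight t Z D 1) (wE : weight t E Z k).
Hypothesis wN : weight t N E (l ^ 2).
Hypotheses (kl : k * l = 1 %[mod p]) (l12 : l != l ^ 2 %[mod p]) (l02 : 1 != l ^ 2 %[mod p]).
Hypotheses (l31 : l != l ^ 3 %[mod p]) (l30 : 1 != l ^ 3 %[mod p]).
Hypotheses (l32 : l ^ 2 != l ^ 3 %[mod p]) (l5 : 1 != l ^ 5 %[mod p]) (neq_k : k != l ^ 2 %[mod p]).

Theorem fusion_tower_false : False.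
Proof.
have fusF : is_fusion_system S F by case: satF.
pose A := Group (AutF_group_set fusF sNS).
have sAAut : A \subset Aut N by apply: AutF_sub.
have AutNt : t \in Aut N := subsetP sAAut t At.
have pN := pgroupS sNS pS; have sEN := normal_sub nE.
have not_sub (X Y : {group gT}) : #|X : Y| = p -> ~~ (X \subset Y).
  exact: prime_index_nsub.
have tM := Aut_morph AutNt.
have expN y : y \in N -> y ^+ p \in P.
  exact: (config_exp p_pr p_odd nE nD nP sZE sDZ sPD iNE iEZ ZNP END nENP EEP
    expEP tM wD wZ wN l12 l02).
have NND : [~: N, N] \subset D.
  exact: (config_der (p := p) (E := E)).
have secN := sections_le3S sNS secS.
have chP : P \char N by apply: (@chain_char_bottom _ p N E Z D P).
have chD : D \char N by apply: (@chain_char_der _ p N E Z D P).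
have chZ : Z \char N by apply: (@chain_char_center _ p N E Z D P).
pose M := 'N_S(N)%G; have sMS : M \subset S by apply: subsetIl.
have pM : p.-group M := pgroupS sMS pS.
have nNM : N <| M by apply: normalSG.
have nsMN : ~~ (M \subset N).
  have ltNS : N \proper S by rewrite properE sNS.
  by case/andP: (nilpotent_proper_norm (pgroup_nil pS) ltNS).
have [nZM nDM nPM] := And3 (char_normal_trans chZ nNM) (char_normal_trans chD nNM)
  (char_normal_trans chP nNM).
have NE m : m \in M -> m \in 'N(E) -> m \in N by case/setIP=> Sm _; apply: NSE.
have [L [[nLM sZL sLN iLZ iNL] [neLE LMZ NML] nEMZ iMN]] :=
  line_data p_pr pM nZM nNM sZE sEN iNE iEZ nsMN NE.
have sZN := subset_trans sZE sEN; have sPZ := subset_trans sPD sDZ.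
have sMN' := normal_sub nNM.
have nLN : L <| N := normalS sLN sMN' nLM.
have nLNP : ~~ ([~: L, N] \subset P).
  apply: contra (not_sub _ _ iLZ) => LNP; apply/subsetP=> y Ly.
  apply: (@chain_center _ p N E Z P) => // [|n Nn]; first exact: (subsetP sLN).
  by rewrite (subsetP LNP) ?mem_commg.
have nNMZ : ~~ ([~: N, M] \subset Z).
  by apply: contra nEMZ; apply: subset_trans (commSg _ sEN).
have tZ z : z \in Z -> t z \in Z by move=> Zz; apply: char_Aut_closed chZ AutNt Zz.
have NNZ := subset_trans NND sDZ.
have expNZ y : y \in N -> y ^+ p \in Z by move=> Ny; rewrite (subsetP sPZ) ?expN.
have [L2 [sZL2 sL2N iL2Z wL2 wNL2]] :=
  eigenline p_pr tM nZ sZE sEN iNE NNZ expNZ wE wN tZ neq_k.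
have sAutS (m : gT) : m \in M -> conj_aut N m \in A.
  by move=> Mm; apply: (subsetP (AutS_sub_AutF fusF sNS)); apply/AutS_P; exists m.
have EML : [~: E, M] \subset L by apply: subset_trans NML; apply: commSg sEN.
(* Suppose that [L2] is not [L]. The lines invariant under [t] are [E] and [L2] only, so [t] moves
   [L] to some other line [L3]. Then [L2] and [L3] are both conjugate to [E] under [M]; conjugating
   [L2] to [L3] and applying the inverse of [t] leads to [L]. *)
have [a Aa aL2] : exists2 a, a \in A & a @: L2 = L.
  have [-> | neL] := eqVneq (L2 : {set gT}) L.
    exists 1; first exact: group1.
    by rewrite -[RHS]imset_id; apply: eq_imset => x; rewrite perm1.
  pose L3 := (autm_morphism AutNt @* L)%G.
  have L3E : L3 = t @: L :> {set gT} by rewrite /= morphimEsub //; apply: eq_imset => x; rewrite autmE.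
  have sZL3 : Z \subset L3 by have := imsetS t sZL; rewrite (char_Aut_imset chZ AutNt) -L3E.
  have sL3N : L3 \subset N by have := imsetS t sLN; rewrite (Aut_imset AutNt) -L3E.
  have iL3Z : #|L3 : Z| = p.
    apply/eqP; rewrite -(eqn_pmul2l (cardG_gt0 Z)) Lagrange // L3E card_imset; last exact: perm_inj.
    by rewrite -iLZ Lagrange.
  have neL3 : L3 :!=: L.
    apply/eqP=> eL3.
    have nEk (X Y : {group gT}) : #|X : Z| = p -> #|Y : Z| = p -> Z \subset X -> Z \subset Y ->
        X :!=: Y -> ~~ (X \subset Y).
      move=> iX iY sZX sZY; apply: contra => sXY.
      by rewrite eqEcard sXY -(Lagrange sZX) -(Lagrange sZY) iX iY leqnn.
    have nL2N : L2 <| N.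
      rewrite /normal sL2N -commg_subr.
      by apply: subset_trans sZL2; apply: subset_trans NNZ; apply: commgS.
    apply: (eigenline_uniq p_pr tM sLN sZE sZL sZL2 sEN sL2N nE nL2N nZ expNZ iLZ wN wNL2 neq_k) => //.
    - exact: nEk.
    - by apply: nEk; rewrite // eq_sym.
    by move=> y Ly; rewrite -eL3 L3E imset_f.
  have [m1 Mm1 L2E] := lines_conj p_pr nZM nNM nLM sZL sLN iNL iLZ LMZ sZE sEN iEZ nEMZ EML
    sZL2 sL2N iL2Z neL.
  have [m2 Mm2 L3E'] := lines_conj p_pr nZM nNM nLM sZL sLN iNL iLZ LMZ sZE sEN iEZ nEMZ EML
    sZL3 sL3N iL3Z neL3.
  exists (conj_aut N (m1^-1 * m2) * t^-1).
    by rewrite groupM ?groupV // sAutS // groupM ?groupV.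
  apply/eqP; rewrite eqEcard card_imset; last exact: perm_inj.
  rewrite -(Lagrange sZL) -(Lagrange sZL2) iL2Z iLZ leqnn andbT.
  apply/subsetP=> _ /imsetP[x L2x ->]; rewrite permM norm_conj_autE ?(subsetP sL2N) //; last first.
    by have /setIP[_] : m1^-1 * m2 \in M by rewrite groupM ?groupV.
  have : x ^ (m1^-1 * m2) \in t @: L.
    by rewrite -L3E L3E' conjgM memJ_conjg -mem_conjg -L2E.
  by case/imsetP=> y Ly ->; rewrite permK.
have AutNa := subsetP sAAut a Aa.
pose t1 := t ^ a; have At1 : t1 \in A by apply: groupJ.
have AutNt1 := subsetP sAAut t1 At1.
have [aN aZ aD aP] := And4 (Aut_imset AutNa) (char_Aut_imset chZ AutNa)
  (char_Aut_imset chD AutNa) (char_Aut_imset chP AutNa).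
pose cs : seq ({group gT} * {group gT}) := [:: (N, L); (L, Z); (Z, D); (D, P)].
have sDN := subset_trans sDZ sZN.
have csP c : c \in cs -> c.2 \subset c.1 /\ c.1 \subset N.
  by rewrite !inE => /or4P[] /eqP->.
have wL2t : weight t1 L Z (l ^ 2) := weight_conj AutNa AutNt sL2N aL2 aZ wL2.
have t1L : t1 @: L = L.
  apply/eqP; rewrite eqEcard card_imset ?leqnn ?andbT; last exact: perm_inj.
  by apply/subsetP=> _ /imsetP[x Lx ->]; apply: weight_stable wL2t sZL Lx.
have tcs c : c \in cs -> t1 @: c.1 = c.1 /\ t1 @: c.2 = c.2.
  have [cN cZ cD cP] := And4 (Aut_imset AutNt1) (char_Aut_imset chZ AutNt1)
    (char_Aut_imset chD AutNt1) (char_Aut_imset chP AutNt1).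
  by rewrite !inE => /or4P[] /eqP->.
have ZMD := step_central p_pr pM nZM nDM sDZ iZD.
have DMP := step_central p_pr pM nDM nPM sPD iDP.
pose U := (conj_aut N @* M)%G.
have sylU : p.-Sylow(A) U by have [_ [/(_ N sNS fnN)[_]]] := satF; rewrite AutSE.
have wU b c : b \in U -> c \in cs -> weight b c.1 c.2 1.
  case/morphimP=> m nm Mm -> csc v c1v; have [_ sc1] := csP c csc.
  rewrite norm_conj_autE ?(subsetP sc1) //; move: csc v c1v {sc1}.
  have com (X Y : {group gT}) v : [~: X, M] \subset Y -> v \in X -> v ^- 1 * v ^ m \in Y.
    by move=> XY Xv; rewrite (subsetP XY) // -/(commg v m) mem_commg.
  by rewrite !inE => /or4P[] /eqP-> v; apply: com.
have [n [An Un wn]] := chain_sylow sAAut sylU At1 csP wU tcs.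
have AutNn := subsetP sAAut n An.
(* [n] normalises [Aut_S(N)], the image of [M]; this is the condition for extending [n] to all of
   [M]. *)
have [||f Ff fn] := @saturated_extend _ p S N M F n satF sNS fnN An.
- exact: subxx.
- move=> x Mx; have : conj_aut N x ^ n \in U.
    by rewrite -Un memJ_conjg mem_morphim //; case/setIP: Mx.
  case/morphimP=> h nh Mh eh; exists h => // y Ny.
  rewrite -(norm_conj_autE nh) ?(Aut_closed AutNn) // -eh permJ norm_conj_autE //.
  by case/setIP: Mx.
have [_ _ fM _ fS] := fus_mor fusF Ff.
have stN y : y \in N -> f y \in N by move=> Ny; rewrite fn ?Aut_closed.
have stM y : y \in M -> f y \in M.
  move=> My; have Nfy : f y \in S by apply: (subsetP fS); apply: imset_f.
  rewrite inE Nfy inE; apply/subsetP=> _ /imsetP[v Nv ->].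
  have : v \in n @: N by rewrite Aut_imset.
  case/imsetP=> w Nw ->; rewrite -fn //; have Mw := subsetP sMN' w Nw.
  have nNy : w ^ y \in N by rewrite memJ_norm //; case/setIP: My.
  have Myw : w * y \in M by rewrite groupM.
  have MyV : y^-1 \in M by rewrite groupV.
  rewrite conjgE -(weight_idV fM) // -(fM) // -fM ?groupM //; exact: stN nNy.
have stP y : y \in P -> f y \in P.
  by move=> Py; rewrite fn ?(char_Aut_closed chP AutNn) // (subsetP (normal_sub nP)).
have wf c i : c \in cs -> weight t1 c.1 c.2 i -> weight f c.1 c.2 i.
  move=> csc w1; have [_ sc1] := csP c csc; apply: eq_weight (wn c i csc w1).
  by move=> v cv; rewrite fn // (subsetP sc1).
(* [L] takes the place of [E], so the weights of the two factors between [N] and [Z] are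
   exchanged. *)
apply: (@tower_false gT p l k M N L Z D P f) => //.
- exact: sections_le3S sMS secS.
- by apply: (wf (D, P)); rewrite ?inE ?eqxx ?orbT //; apply: weight_conj AutNa AutNt sDN aD aP wD.
- by apply: (wf (Z, D)); rewrite ?inE ?eqxx ?orbT //; apply: weight_conj AutNa AutNt sZN aZ aD wZ.
- by apply: (wf (L, Z)); rewrite ?inE ?eqxx ?orbT.
by apply: (wf (N, L)); rewrite ?inE ?eqxx ?orbT //; apply: weight_conj AutNa AutNt (subxx N) aN aL2 wNL2.
Qed.

End FusionTower.

(** An element of prime order q different from p permutes each coset of ['Phi(E)], whose size is a
    power of p, and hence fixes a point in it. The fixed points then generate [E] modulo ['Phi(E)],
    so they generate [E]. *)
Lemma Aut_Phi_pgroup (gT : finGroupType) p (E : {group gT}) (K : {group {perm gT}}) :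
  prime p -> p.-group E -> K \subset Aut E ->
  (forall a x, a \in K -> x \in E -> x^-1 * a x \in 'Phi(E)) -> p.-group K.
Proof.
move=> p_pr pE sKA trivK; apply/pgroupP=> q q_pr; case/(Cauchy q_pr)=> a Ka oa.
rewrite -[_ \in _]/(q == p); apply: contraT => neqp; have AutEa := subsetP sKA a Ka.
have aM := Aut_morph AutEa; have sPE := Phi_sub E.
pose C := [set x in E | a x == x].
have gC : group_set C.
  apply/group_setP; split; first by rewrite inE group1 (weight_id1 aM) /=.
  move=> x y /setIdP[Ex /eqP ax] /setIdP[Ey /eqP ay].
  by rewrite inE groupM // aM // ax ay /=.
have sCE : C \subset E by apply/subsetP=> x /setIdP[].
have aPhi x : x \in 'Phi(E) -> a x \in 'Phi(E).
  exact: (char_Aut_closed (Phi_char E) AutEa).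
have defE : 'Phi(E) <*> C = E.
  apply/eqP; rewrite eqEsubset join_subG sPE sCE /=; apply/subsetP=> x Ex.
  have nSa : [acts <[a]>, on x *: 'Phi(E) | 'P].
    rewrite cycle_subG; apply/astabsP=> y; rewrite /= apermE.
    suff st z : z \in x *: 'Phi(E) -> a z \in x *: 'Phi(E).
      suff {1}<- : a @: (x *: 'Phi(E)) = x *: 'Phi(E) by rewrite mem_imset //; apply: perm_inj.
      apply/eqP; rewrite eqEcard card_imset ?leqnn ?andbT; last exact: perm_inj.
      by apply/subsetP=> _ /imsetP[z /st az ->].
    case/lcosetP=> w Pw ->; have Ew := subsetP sPE w Pw.
    rewrite aM // mem_lcoset mulgA groupM ?aPhi //.
    exact: trivK.
  have qa : q.-group <[a]> by rewrite /pgroup -orderE oa pnat_id.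
  have := pgroup_fix_mod qa nSa; rewrite card_lcoset => eqq.
  have [k cP] := p_natP (pgroupS sPE pE).
  have : 'Fix_(x *: 'Phi(E) | 'P)(<[a]>) != set0.
    apply: contraNneq neqp => fix0; move: eqq; rewrite fix0 cards0 mod0n => /eqP.
    by rewrite -/(q %| _) cP Euclid_dvdX // => /andP[]; rewrite dvdn_prime2.
  case/set0Pn=> y /setIP[xy]; rewrite afix_cycle => /afix1P; rewrite /= apermE => ay.
  have Ey : y \in E by case/lcosetP: xy => w Pw ->; rewrite groupM // (subsetP sPE).
  have -> : x = y * (x^-1 * y)^-1 by rewrite invMg invgK mulgA mulgV mul1g.
  rewrite groupM ?groupV //; last by rewrite (subsetP (joing_subl _ _)) // -mem_lcoset.
  by rewrite (subsetP (joing_subr _ _)) // inE Ey ay /=.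
have genC : <<C>> = E := Phi_nongen defE.
have sEC : E \subset C by rewrite -{1}genC (genGid (Group gC)).
have a1 : a = 1.
  apply: (eq_Aut AutEa (group1 _)) => x Ex; rewrite perm1.
  by have /setIdP[_ /eqP] := subsetP sEC x Ex.
by move: q_pr; rewrite -oa a1 order1.
Qed.

Section FusionConfiguration.
Variables (gT : finGroupType) (p l k : nat) (S N E Z D P : {group gT}).
Variables (F : {set gT} -> {ffun gT -> gT} -> bool) (t : {perm gT}).
Hypotheses (p_pr : prime p) (p_odd : odd p) (pS : p.-group S) (secS : sections_le3 p S).
Hypotheses (satF : saturated F p S) (sNS : N \subset S).
Hypothesis fnE : fully_normalized F S E.
Hypotheses (nsSN : ~~ (S \subset N)) (NSE : 'N_S(E) = N).
Hypotheses (nE : E <| N) (nZ : Z <| N) (nD : D <| N) (nP : P <| N).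
Hypotheses (sZE : Z \subset E) (sDZ : D \subset Z) (sPD : P \subset D).
Hypotheses (iNE : #|N : E| = p) (iEZ : #|E : Z| = p) (iZD : #|Z : D| = p) (iDP : #|D : P| = p).
Hypotheses (ZNP : [~: Z, N] \subset P) (END : [~: E, N] \subset D) (nENP : ~~ ([~: E, N] \subset P)).
Hypotheses (EEP : [~: E, E] \subset P) (expEP : forall y, y \in E -> y ^+ p \in P).
Hypothesis At : t \in AutF F N.
Hypotheses (wD : weight t D P l) (wZ : weight t Z D 1) (wE : weight t E Z k).
Hypothesis wN : weight t N E (l ^ 2).
Hypotheses (kl : k * l = 1 %[mod p]) (l12 : l != l ^ 2 %[mod p]) (l02 : 1 != l ^ 2 %[mod p]).
Hypotheses (l31 : l != l ^ 3 %[mod p]) (l30 : 1 != l ^ 3 %[mod p]).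
Hypotheses (l32 : l ^ 2 != l ^ 3 %[mod p]) (l5 : 1 != l ^ 5 %[mod p]) (neq_k : k != l ^ 2 %[mod p]).

(* The configuration is transported along an F-morphism alpha on N whose image
   has a normaliser of maximal order, hence is fully normalised. *)
Theorem fusion_configuration_false : False.
Proof.
have fusF : is_fusion_system S F by case: satF.
pose h (f : {ffun gT -> gT}) := #|'N_S(f @: N)|.
case: (@arg_maxnP _ (finfun id) (F N) h (fus_id fusF sNS)) => f Ff fmax.
have [_ _ fM finj fS] := fus_mor fusF Ff.
pose fm := Morphism fM; have injf : 'injm fm by apply/injmP.
have imf (X : {group gT}) : X \subset N -> fm @* X = f @: X by move=> sXN; rewrite morphimEsub.
have [g [Fg gK]] := fus_inv fusF Ff.
have [tN Ft] : t @: N = N /\ F N (finfun t).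
  by split; [apply: Aut_imset (subsetP (AutF_sub F N) t At) | case/setIdP: At].
have gfN : g @: (f @: N) = N.
  rewrite -imset_comp -[RHS]imset_id; apply: eq_in_imset => x Nx /=; exact: gK.
have tM : {in N &, {morph t : x y / x * y}} := Aut_morph (subsetP (AutF_sub F N) t At).
pose N' := (fm @* N)%G; have N'E : N' = f @: N :> {set gT} by apply: imf.
have Ftg : F N' [ffun x => finfun t (g x)].
  by apply: (fus_comp fusF); rewrite N'E // gfN.
have im_tg : [ffun x => finfun t (g x)] @: N' = N.
  transitivity (t @: (g @: N')); last by rewrite N'E gfN tN.
  by rewrite -(imset_comp t g); apply: eq_imset => x; rewrite !ffunE.
have Fftg : F N' [ffun y => f ([ffun x => finfun t (g x)] y)].
  by apply: (fus_comp fusF Ftg); rewrite im_tg.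
have [t' At' t'E] : exists2 t', t' \in AutF F N' & {in N, forall x, t' (f x) = f (t x)}.
  have [|a Aa aE] := fus_aut fusF Fftg.
    rewrite [in RHS]N'E -[in RHS]im_tg -(imset_comp f [ffun x => finfun t (g x)]).
    by apply: eq_imset => x; rewrite !ffunE /= !ffunE.
  exists a => // x Nx; rewrite aE; last by rewrite N'E imset_f.
  by rewrite !ffunE gK.
have sEN := normal_sub nE; have sZN := subset_trans sZE sEN.
have sDN := subset_trans sDZ sZN; have sPN := subset_trans sPD sDN.
have wt (A B : {group gT}) i : A \subset N -> weight t A B i -> weight t' (fm @* A) (fm @* B) i.
  move=> sAN wA _ /morphimP[x Nx Ax ->]; rewrite t'E //.
  have Ntx : t x \in N by rewrite -tN imset_f.
  have NVx : x ^- i \in N by rewrite groupV groupX.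
  rewrite -(weight_idX fM) // -(weight_idV fM) ?groupX // -(fM _ _ NVx Ntx).
  by apply: (mem_morphim fm (groupM NVx Ntx)); apply: wA.
have sN'S : N' \subset S by rewrite N'E.
have cN' : #|N'| = #|N| by apply: card_injm.
have nfE : fm @* E <| N' := morphim_normal fm nE.
(* The normaliser of the image of [E] contains the image of [N], and it is not larger because [E] is
   fully normalised. *)
have NSE' : 'N_S(fm @* E) = N'.
  symmetry; apply/eqP; rewrite eqEcard subsetI sN'S normal_norm //= cN'.
  apply: (leq_trans (n := #|'N_S(E)|)); last by rewrite NSE.
  apply: fnE; exists f; split; last exact: imf.
  exact: (fus_res fusF Ff).
apply: (@fusion_tower_false gT p l k S N' (fm @* E)%G (fm @* Z)%G (fm @* D)%G (fm @* P)%G F t') => //;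
  rewrite ?morphimS //; try exact: morphim_normal; try (by rewrite index_injm); try exact: wt.
- move=> Q [g' [Fg' QE]]; rewrite N'E; have := fmax [ffun x => g' (f x)].
  rewrite /h => le; rewrite QE N'E; have -> : g' @: (f @: N) = [ffun x => g' (f x)] @: N.
    by rewrite -imset_comp; apply: eq_imset => x /=; rewrite ffunE.
  by apply: le; apply: (fus_comp fusF Ff); rewrite -N'E.
- apply: contra nsSN => sSN'; rewrite -(_ : N :=: S) //; apply/eqP.
  by rewrite eqEcard sNS -cN' subset_leq_card.
- by move=> y Sy ny; rewrite -NSE' inE Sy.
- by rewrite -morphimR // morphimS.
- by rewrite -morphimR // morphimS.
- by rewrite -morphimR // injmSK // commg_subr (subset_trans sEN) ?normG.
- by rewrite -morphimR // morphimS.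
by move=> _ /morphimP[y Ny Ey ->]; rewrite -morphX //; apply: mem_morphim; [apply: groupX | apply: expEP].
Qed.

End FusionConfiguration.

Import GRing.Theory.
Local Open Scope ring_scope.

(** * Subgroups of GL_3(p) with a strongly embedded subgroup *)

Section Matrix3.
Variable R : comNzRingType.

Definition mx3 (a b c d e f g h i : R) : 'M[R]_3 :=
  \matrix_(r, s) nth 0 (nth [::] [:: [:: a; b; c]; [:: d; e; f]; [:: g; h; i]] r) s.

Lemma mx3E (A : 'M[R]_3) :
  A = mx3 (A 0 0) (A 0 1) (A 0 2%:R) (A 1 0) (A 1 1) (A 1 2%:R) (A 2%:R 0) (A 2%:R 1) (A 2%:R 2%:R).
Proof.
by apply/matrixP=> [[[|[|[|//]]] ?] [[|[|[|//]]] ?]]; rewrite mxE /=;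
  congr (A _ _); apply: val_inj.
Qed.

Lemma mx3M a b c d e f g h i a' b' c' d' e' f' g' h' i' :
  mx3 a b c d e f g h i *m mx3 a' b' c' d' e' f' g' h' i' =
  mx3 (a * a' + b * d' + c * g') (a * b' + b * e' + c * h') (a * c' + b * f' + c * i')
      (d * a' + e * d' + f * g') (d * b' + e * e' + f * h') (d * c' + e * f' + f * i')
      (g * a' + h * d' + i * g') (g * b' + h * e' + i * h') (g * c' + h * f' + i * i').
Proof.
by apply/matrixP=> [[[|[|[|//]]] ?] [[|[|[|//]]] ?]];
  rewrite !mxE !big_ord_recl big_ord0 !mxE /= addr0 addrA.
Qed.

Lemma mx3_inj a b c d e f g h i a' b' c' d' e' f' g' h' i' :
  mx3 a b c d e f g h i = mx3 a' b' c' d' e' f' g' h' i' ->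
  [/\ a = a', b = b' & c = c'] /\ [/\ d = d', e = e' & f = f'] /\ [/\ g = g', h = h' & i = i'].
Proof.
move/matrixP=> eqA.
have := (eqA 0 0, eqA 0 1, eqA 0 2%:R, eqA 1 0, eqA 1 1, eqA 1 2%:R, eqA 2%:R 0, eqA 2%:R 1, eqA 2%:R 2%:R).
by rewrite !mxE /= => -[[[[[[[[-> ->] ->] ->] ->] ->] ->] ->] ->].
Qed.

Lemma mx3D a b c d e f g h i a' b' c' d' e' f' g' h' i' :
  mx3 a b c d e f g h i + mx3 a' b' c' d' e' f' g' h' i' =
  mx3 (a + a') (b + b') (c + c') (d + d') (e + e') (f + f') (g + g') (h + h') (i + i').
Proof. by apply/matrixP=> [[[|[|[|//]]] ?] [[|[|[|//]]] ?]]; rewrite !mxE. Qed.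

Lemma mx3N a b c d e f g h i :
  - mx3 a b c d e f g h i = mx3 (- a) (- b) (- c) (- d) (- e) (- f) (- g) (- h) (- i).
Proof. by apply/matrixP=> [[[|[|[|//]]] ?] [[|[|[|//]]] ?]]; rewrite !mxE. Qed.

Lemma mx3_1 : 1%:M = mx3 1 0 0 0 1 0 0 0 1.
Proof. by apply/matrixP=> [[[|[|[|//]]] ?] [[|[|[|//]]] ?]]; rewrite !mxE. Qed.

Lemma mx3_0 : 0 = mx3 0 0 0 0 0 0 0 0 0.
Proof. by apply/matrixP=> [[[|[|[|//]]] ?] [[|[|[|//]]] ?]]; rewrite !mxE. Qed.

(** Groups act on row vectors from the right, so for a basis this is the matrix of the base
    change. *)
Definition mx3row (u v w : 'rV[R]_3) : 'M[R]_3 :=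
  \matrix_(r, s) nth 0 [:: u 0 s; v 0 s; w 0 s] r.

Lemma mul_rV_mx3row (x : 'rV[R]_3) u v w :
  x *m mx3row u v w = x 0 0 *: u + x 0 1 *: v + x 0 2%:R *: w.
Proof.
apply/rowP=> s; rewrite !mxE !big_ord_recl big_ord0 !mxE /= addr0 addrA.
by congr (_ * _ + _ * _ + _ * _); congr (x _ _); apply: val_inj.
Qed.

Lemma mx3row_mul (A : 'M[R]_3) u v w :
  mx3row u v w *m A = mx3row (u *m A) (v *m A) (w *m A).
Proof.
apply/matrixP=> [[[|[|[|//]]] ?] j]; rewrite !mxE /=;
by apply: eq_bigr => k _; rewrite mxE.
Qed.

Lemma mx3_mulrow a b c d e f g h i u v w :
  mx3 a b c d e f g h i *m mx3row u v w =
  mx3row (a *: u + b *: v + c *: w) (d *: u + e *: v + f *: w) (g *: u + h *: v + i *: w).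
Proof.
apply/matrixP=> [[[|[|[|//]]] ?] j];
by rewrite !mxE !big_ord_recl big_ord0 !mxE /= addr0 addrA.
Qed.

Lemma mx3row_row0 u v w : row 0 (mx3row u v w) = u.
Proof. by apply/rowP=> j; rewrite !mxE. Qed.
Lemma mx3row_row1 u v w : row 1 (mx3row u v w) = v.
Proof. by apply/rowP=> j; rewrite !mxE. Qed.
Lemma mx3row_row2 u v w : row 2%:R (mx3row u v w) = w.
Proof. by apply/rowP=> j; rewrite !mxE. Qed.

Lemma mx3rowE (A : 'M[R]_3) : A = mx3row (row 0 A) (row 1 A) (row 2%:R A).
Proof.
apply/matrixP=> [[[|[|[|//]]] ?] j]; rewrite !mxE /=; congr (A _ _);
by apply: val_inj.
Qed.

End Matrix3.

(** * Unipotent matrices and p-elements in dimension three *)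

Section Unipotent.
Variables (aT : finGroupType) (p : nat) (G : {group aT}).
Hypotheses (p_pr : prime p) (p_ge5 : (5 <= p)%N).
Variable rG : mx_representation 'F_p G 3.
Hypothesis faith : mx_faithful rG.

Let pcharP : p \in [pchar {poly 'F_p}].
Proof. by rewrite pchar_poly pchar_Fp. Qed.

(** The Frobenius identity holds in the commutative ring of polynomials and is then evaluated at
    [A]. *)
Lemma exprB1_mx (A : 'M['F_p]_3) k : (A - 1) ^+ (p ^ k) = A ^+ (p ^ k) - 1.
Proof.
have -> : A - 1 = horner_mx A ('X - 1).
  by rewrite rmorphB /= horner_mx_X rmorph1.
have pk: [pchar {poly 'F_p}].-nat (p ^ k)%N by rewrite pnatX pnatE ?pcharP.
rewrite -rmorphXn /= exprDn_pchar // exprNn_pchar //.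
by rewrite expr1n rmorphB /= rmorphXn /= horner_mx_X rmorph1.
Qed.

(** The minimal polynomial divides a power of X - 1 and has degree at most three. *)
Lemma unipotent_p_elt x : x \in G -> p.-elt x -> (rG x - 1) ^+ 3 = 0.
Proof.
move=> Gx /p_natP[k ox].
have: (rG x - 1) ^+ (p ^ k) = 0.
  by rewrite exprB1_mx -repr_mxX // -ox expg_order repr_mx1 subrr.
set A := rG x; move=> A0.
have: horner_mx A (('X - 1%:P) ^+ (p ^ k)) = 0.
  by rewrite rmorphXn /= rmorphB /= horner_mx_X horner_mx_C.
move/mxminpoly_min/dvdp_exp_XsubCP=> [m _ eqm].
have: (mxminpoly A %| char_poly A)%R by apply: mxminpoly_dvd_char.
move/dvdp_leq; rewrite -size_poly_eq0 size_char_poly => /(_ isT).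
rewrite (eqp_size eqm) size_exp_XsubC ltnS => le_m3.
have: (mxminpoly A %| ('X - 1%:P) ^+ 3)%R.
  by rewrite (eqp_dvdl _ eqm) dvdp_exp2l.
move/mxminpoly_minP; rewrite rmorphXn /= rmorphB /= horner_mx_X horner_mx_C //.
Qed.

Lemma p_elt_unipotent x : x \in G -> (rG x - 1) ^+ 3 = 0 -> (x ^+ p)%g = 1%g.
Proof.
move=> Gx x3; apply: (mx_faithful_inj faith); rewrite ?groupX ?group1 // repr_mxX // repr_mx1.
apply/eqP; rewrite -subr_eq0.
have /= <- := exprB1_mx (rG x) 1; rewrite expn1.
have -> : (rG x - 1) ^+ p = (rG x - 1) ^+ (p - 3) * (rG x - 1) ^+ 3.
  by rewrite -exprD subnK // (leq_trans _ p_ge5).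
by rewrite x3 mulr0.
Qed.

End Unipotent.

(** * Transvections and the strongly embedded subgroup *)

Section Transvections.
Variables (aT : finGroupType) (p : nat) (G : {group aT}).
Hypotheses (p_pr : prime p) (p_ge5 : (5 <= p)%N).
Variable rG : mx_representation 'F_p G 3.
Hypothesis faith : mx_faithful rG.

Lemma unipotent_elt x : x \in G -> (rG x - 1) ^+ 3 = 0 -> p.-elt x.
Proof.
move=> Gx x3; rewrite /p_elt (pnat_dvd _ (pnat_id p_pr)) // order_dvdn.
by rewrite (p_elt_unipotent p_pr p_ge5 faith Gx).
Qed.

Lemma nilsq_elt x : x \in G -> (rG x - 1) ^+ 2 = 0 -> p.-elt x.
Proof. by move=> Gx x2; apply: unipotent_elt; rewrite // exprS x2 mulr0. Qed.

Lemma rep_commute x y : x \in G -> y \in G -> rG x *m rG y = rG y *m rG x -> commute x y.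
Proof.
by move=> Gx Gy cxy; apply: (mx_faithful_inj faith); rewrite ?groupM // !repr_mxM.
Qed.

Lemma mulmx_rank1 (f f' : 'cV['F_p]_3) (a a' : 'rV['F_p]_3) :
  (1 + f *m a) *m (1 + f' *m a') = 1 + f *m a + f' *m a' + f *m (a *m f') *m a'.
Proof.
rewrite mulmxDl mulmxDr -[1 *m 1]/(1 * 1) mulr1 -[1 *m _]/(1 * _) mul1r.
by rewrite mulmxDr -[_ *m 1]/(_ * 1) mulr1 !mulmxA -!addrA [f' *m a' + _]addrCA.
Qed.

(** The witness is the commutator: when [a' *m f] vanishes it is again of the form 1 plus a rank one
    matrix, with column [f] and row [a'] up to a scalar, and so it commutes with both. *)
Lemma transvections_pair z z' (f : 'cV['F_p]_3) (a : 'rV['F_p]_3) (f' : 'cV['F_p]_3) (a' : 'rV['F_p]_3) :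
  z \in G -> z' \in G -> rG z = 1 + f *m a -> rG z' = 1 + f' *m a' ->
  a *m f = 0 -> a' *m f' = 0 -> a' *m f = 0 ->
  exists k, [/\ k \in G, p.-elt k, commute z k, commute z' k & k = 1%g -> commute z z'].
Proof.
move=> Gz Gz' zE z'E af a'f' a'f; pose k := [~ z, z'].
have Gk : k \in G by rewrite groupR.
have kE : rG k = 1 + (f *m (a *m f')) *m a'.
  have: rG z' *m rG z *m rG k = rG z *m rG z'.
    by rewrite -(repr_mxM rG Gz' Gz) -(repr_mxM rG (groupM Gz' Gz) Gk) -(repr_mxM rG Gz Gz')
      [in RHS]commgC.
  have -> : rG z *m rG z' = rG z' *m rG z *m (1 + (f *m (a *m f')) *m a').
    rewrite zE z'E !mulmx_rank1 a'f mulmx0 mul0mx addr0.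
    rewrite mulmxDr -[_ *m 1]/(_ * 1) mulr1; congr (_ + _); first by rewrite addrAC.
    rewrite !mulmxDl -[1 *m _]/(1 * _) mul1r.
    rewrite -!mulmxA (mulmxA a f) af (mulmxA a' f) a'f !(mul0mx, mulmx0) !addr0.
    by rewrite !mulmxA.
  have u : rG z' *m rG z \in unitmx by rewrite unitmx_mul !repr_mx_unit.
  by move/(congr1 (mulmx (invmx (rG z' *m rG z)))); rewrite !mulKmx.
exists k; split=> //.
- apply: nilsq_elt => //; rewrite kE addrC addKr expr2.
  by rewrite -[LHS]/(_ *m _) -!mulmxA (mulmxA a' f) a'f !(mul0mx, mulmx0).
- apply: rep_commute => //; rewrite zE kE !mulmx_rank1 a'f (mulmxA a f) af.
  by rewrite !(mul0mx, mulmx0) !addr0 addrAC.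
- apply: rep_commute => //; rewrite z'E kE !mulmx_rank1 a'f' (mulmxA a' f) a'f.
  by rewrite !(mul0mx, mulmx0) !addr0 addrAC.
- by move=> k1; apply/commgP; rewrite -/k k1.
Qed.

(** Membership in [H] passes along commuting p-elements, from [z] to the commutator [k] and from [k]
    to [z']; if [k] is trivial, [z] and [z'] commute directly. *)
Lemma transvections_emb (H : {group aT}) z z' (f : 'cV['F_p]_3) (a : 'rV['F_p]_3)
    (f' : 'cV['F_p]_3) (a' : 'rV['F_p]_3) :
  strongly_p_embedded p G H ->
  z \in H -> z != 1%g -> z' \in G -> rG z = 1 + f *m a -> rG z' = 1 + f' *m a' ->
  a *m f = 0 -> a' *m f' = 0 -> a' *m f = 0 \/ a *m f' = 0 -> z' \in H.
Proof.
move=> emb Hz ntz Gz' zE z'E af a'f' cross; have Gz := subsetP (se_sub emb) z Hz.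
have pz : p.-elt z.
  apply: nilsq_elt => //; rewrite zE addrC addKr expr2.
  by rewrite -[LHS]/(_ *m _) -!mulmxA (mulmxA a f) af !(mul0mx, mulmx0).
have [k [Gk pk czk cz'k k1]] :
    exists k, [/\ k \in G, p.-elt k, commute z k, commute z' k & k = 1%g -> commute z z'].
  case: cross => [a'f | af']; first exact: transvections_pair zE z'E af a'f' a'f.
  have [k [Gk pk c1 c2 k1]] := transvections_pair Gz' Gz z'E zE a'f' af af'.
  by exists k; split=> // /k1/commute_sym.
have [k_1 | ntk] := eqVneq k 1%g; first exact: (se_cent emb pz ntz Hz (k1 k_1)).
have Hk : k \in H by apply: (se_cent emb pz ntz Hz czk).
by apply: (se_cent emb pk ntk Hk _ Gz'); apply: commute_sym.
Qed.

Lemma nilsq_rank1 (A : 'M['F_p]_3) :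
  A * A = 0 -> A != 0 ->
  exists f : 'cV['F_p]_3, exists a : 'rV['F_p]_3, A = f *m a /\ a *m f = 0.
Proof.
move=> A2 ntA; have r1 : \rank A = 1%N.
  apply/eqP; rewrite eqn_leq lt0n mxrank_eq0 ntA andbT.
  by have := mulmx0_rank_max A2; case: (\rank A) => [|[|n]] //; rewrite !addnS.
have := mulmx_base A; have := col_base_full A; have := row_base_free A.
move: (col_base A) (row_base A); rewrite r1 => f a freea fullf eA.
exists f, a; split=> //; move: A2; rewrite -eA -[_ * _]/(_ *m _) !mulmxA -(mulmxA f).
rewrite -(mul0mx _ a) => /(row_free_inj freea).
by rewrite -(mulmx0 _ f) => /(row_full_inj fullf).
Qed.

End Transvections.

Section TransvectionPair.
Variables (aT : finGroupType) (p : nat) (G : {group aT}).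
Hypotheses (p_pr : prime p) (p_ge5 : (5 <= p)%N).
Variable rG : mx_representation 'F_p G 3.

Lemma rep_upperX z n : z \in G -> rG z = mx3 1 1 0 0 1 0 0 0 1 ->
  rG (z ^+ n)%g = mx3 1 n%:R 0 0 1 0 0 0 1.
Proof.
move=> Gz zE; elim: n => [|n IH]; first by rewrite repr_mx1 mx3_1.
by rewrite expgS repr_mxM ?groupX // IH zE mx3M -natr1; congr mx3; ring.
Qed.

Lemma rep_lowerX z c n : z \in G -> rG z = mx3 1 0 0 c 1 0 0 0 1 ->
  rG (z ^+ n)%g = mx3 1 0 0 (n%:R * c) 1 0 0 0 1.
Proof.
move=> Gz zE; elim: n => [|n IH]; first by rewrite repr_mx1 mul0r mx3_1.
by rewrite expgS repr_mxM ?groupX // IH zE mx3M -natr1; congr mx3; ring.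
Qed.

(* The product of unipotents [u(l^-1-1) v(1) u(l-1) v(-l^-1)] in SL_2. *)
Lemma rep_torus z z' c l : z \in G -> z' \in G -> c != 0 -> l != 0 ->
  rG z = mx3 1 1 0 0 1 0 0 0 1 -> rG z' = mx3 1 0 0 c 1 0 0 0 1 ->
  exists2 t, t \in G & rG t = mx3 l^-1 0 0 0 l 0 0 0 1.
Proof.
move=> Gz Gz' nzc nzl zE z'E.
have up a : exists2 x, x \in G & rG x = mx3 1 a 0 0 1 0 0 0 1.
  exists (z ^+ a)%g; first by rewrite groupX.
  by rewrite (rep_upperX _ Gz zE) natr_Zp.
have lo a : exists2 x, x \in G & rG x = mx3 1 0 0 a 1 0 0 0 1.
  exists (z' ^+ (a / c)%R)%g; first by rewrite groupX.
  by rewrite (rep_lowerX _ Gz' z'E) natr_Zp divfK.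
have [x1 Gx1 x1E] := up (l^-1 - 1); have [x2 Gx2 x2E] := lo 1.
have [x3 Gx3 x3E] := up (l - 1); have [x4 Gx4 x4E] := lo (- l^-1).
exists (x1 * x2 * x3 * x4)%g; first by rewrite !groupM.
rewrite !repr_mxM ?groupM // x1E x2E x3E x4E !mx3M.
by congr mx3; field.
Qed.

Hypothesis faith : mx_faithful rG.

(** Commuting with [z] and being unipotent leaves [y] three free entries; dividing by a power of [z]
    clears one of them and gives [w]. The conjugate of [z ^ g] by [w] still pairs to zero with
    [z ^ g], so it stays in [H :^ g], and therefore so does [w]. A nontrivial [w] in both [H] and
    [H :^ g] would put [g] into [H]. *)
Lemma transvection_std (H U : {group aT}) z g c :
  strongly_p_embedded p G H -> p.-group U -> U \subset H -> z \in U ->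
  (forall y, y \in U -> commute z y) -> g \in G -> g \notin H -> c != 0 ->
  rG z = mx3 1 1 0 0 1 0 0 0 1 -> rG (z ^ g)%g = mx3 1 0 0 c 1 0 0 0 1 ->
  U :=: <[z]>%g.
Proof.
move=> emb pU sUH Uz cUz Gg notHg nzc zE z'E.
have sHG := se_sub emb; have sUG := subset_trans sUH sHG.
apply/eqP; rewrite eqEsubset cycle_subG Uz andbT; apply/subsetP=> y Uy.
have Gy := subsetP sUG y Uy; have Gz := subsetP sUG z Uz.
have czy: rG z *m rG y = rG y *m rG z by rewrite -!repr_mxM // (cUz y Uy).
have := unipotent_p_elt p_pr rG Gy (mem_p_elt pU Uy).
have yE := mx3E (rG y); move: czy; rewrite zE yE.
move: yE; move: (rG y 0 0) (rG y 0 1) (rG y 0 2%:R) (rG y 1 0) (rG y 1 1) (rG y 1 2%:R)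
  (rG y 2%:R 0) (rG y 2%:R 1) (rG y 2%:R 2%:R) => y00 y01 y02 y10 y11 y12 y20 y21 y22 yE.
rewrite !mx3M !(mul0r, mul1r, mulr0, mulr1, add0r, addr0).
move=> /mx3_inj[[/esym e00 e01 /esym e02] [_ [_ e21 _]]].
have y10_0 : y10 = 0 by apply: (addrI y00); rewrite addr0.
have y12_0 : y12 = 0 by apply: (addrI y02); rewrite addr0.
have y20_0 : y20 = 0 by apply: (addIr y21); rewrite add0r.
have y11_00 : y11 = y00 by apply: (addrI y01); rewrite e01 addrC.
move: yE; rewrite {}y10_0 {}y12_0 {}y20_0 {}y11_00 => {y10 y12 y20 y11 e00 e01 e02 e21} yE.
have cube_0 (t : 'F_p) : (t - 1) * (t - 1) * (t - 1) = 0 -> t = 1.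
  by move/eqP; rewrite !mulf_eq0 !orbb subr_eq0 => /eqP.
rewrite -[1 in X in X ^+ _]/(1%:M) mx3_1 mx3N mx3D !exprS expr0 mulr1.
rewrite -![_ * _]/(_ *m _) !mx3M mx3_0 => /mx3_inj[[e00 _ _] [_ [_ _ e22]]].
move: yE; have -> : y00 = 1 by apply: cube_0; rewrite -[RHS]e00; ring.
have -> : y22 = 1 by apply: cube_0; rewrite -[RHS]e22; ring.
move=> yE {y00 y22 e00 e22}.
pose w := (y * z ^- y01)%g.
have Uw : w \in U by rewrite groupM ?groupV ?groupX.
have Gw := subsetP sUG w Uw.
have wE : rG w = mx3 1 0 y02 0 1 0 0 y21 1.
  have /(congr1 (mulmxr (rG (z ^+ y01)%g))) : rG w *m rG (z ^+ y01)%g = rG y.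
    by rewrite -repr_mxM ?groupX // mulgKV.
  have u : rG (z ^+ y01)%g \in unitmx by rewrite repr_mx_unit ?groupX.
  move=> _; apply: (can_inj (mulmxK u)); rewrite -repr_mxM ?groupX // mulgKV yE.
  by rewrite (rep_upperX _ Gz zE) natr_Zp mx3M; congr mx3; ring.
suff w1 : w = 1%g.
  have -> : y = (z ^+ y01)%g by apply/eqP; rewrite eq_mulgV1 -/w w1.
  by rewrite mem_cycle.
apply/eqP; apply: contraT => ntw; case/negP: notHg.
have embg := seJ Gg emb.
have Hgz' : (z ^ g)%g \in (H :^ g)%G by rewrite memJ_conjg (subsetP sUH).
have ntz : z != 1%g.
  apply: contra_eq_neq zE => ->; rewrite repr_mx1 mx3_1; apply/eqP => /mx3_inj[[_ /esym/eqP]].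
  by rewrite oner_eq0.
have ntz' : (z ^ g)%g != 1%g by rewrite conjg_eq1.
have pz' : p.-elt (z ^ g)%g by rewrite p_eltJ (mem_p_elt pU).
suff Hgw : w \in (H :^ g)%G.
  by apply: (se_mem emb (mem_p_elt pU Uw) ntw (subsetP sUH _ Uw) Hgw Gg).
have Gz' : (z ^ g)%g \in G by rewrite groupJ.
suff Hgz'w : ((z ^ g) ^ w)%g \in (H :^ g)%G.
  apply: (se_mem embg _ _ Hgz'w _ Gw); rewrite ?p_eltJ ?conjg_eq1 ?(mem_p_elt pU Uz) //.
  by rewrite memJ_conjg.
pose f : 'cV['F_p]_3 := \col_i (if i == 1 then c else 0).
pose a : 'rV['F_p]_3 := \row_i (if i == 0 then 1 else 0).
have z'fa : rG (z ^ g)%g = 1 + f *m a.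
  rewrite z'E -[X in X + f *m a]/(1%:M) mx3_1; apply/matrixP=> [[[|[|[|//]]] ?] [[|[|[|//]]] ?]];
  by rewrite !mxE big_ord1 !mxE /= ?(mulr0, mul0r, mulr1, addr0, add0r).
have af : a *m f = 0.
  by apply/matrixP=> i j; rewrite !mxE !big_ord_recl big_ord0 !mxE /= !(mul0r, mulr0, addr0).
have awf : (a *m rG w) *m f = 0.
  rewrite wE; apply/matrixP=> i j; rewrite !mxE !big_ord_recl big_ord0 !mxE.
  by rewrite !big_ord_recl !big_ord0 !mxE /= !(mul0r, mulr0, addr0).
apply: (transvections_emb p_pr p_ge5 faith embg Hgz' ntz' _ z'fa _ af).
- by rewrite groupJ.
- have -> : rG ((z ^ g) ^ w)%g = 1 + (rG w^-1%g *m f) *m (a *m rG w); last by [].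
  rewrite [((z ^ g) ^ w)%g]conjgE (repr_mxM rG (groupVr Gw) (groupM Gz' Gw)) (repr_mxM rG Gz' Gw) z'fa.
  rewrite mulmxDl mulmxDr -[1 *m _]/(1 * _) mul1r !mulmxA repr_mxV //.
  by rewrite mulVmx ?repr_mx_unit.
- by rewrite mulmxA repr_mxV // mulmxK ?repr_mx_unit.
- by left.
Qed.

End TransvectionPair.

Section TransvectionCase.
Variables (aT : finGroupType) (p : nat) (G : {group aT}).
Hypotheses (p_pr : prime p) (p_ge5 : (5 <= p)%N).
Variable rG : mx_representation 'F_p G 3.
Hypothesis faith : mx_faithful rG.

Lemma rconj_faithful B (uB : B \in unitmx) : mx_faithful (rconj_repr rG uB).
Proof. by rewrite /mx_faithful rker_conj. Qed.

Lemma rconj_mxP B (uB : B \in unitmx) x M :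
  rconj_repr rG uB x = M <-> B *m rG x = M *m B.
Proof.
rewrite rconj_mxE; split=> [<- | ->]; first by rewrite mulmxKV.
by rewrite mulmxK.
Qed.

Definition has_torus (z : aT) := exists2 B, B \in unitmx &
  B *m rG z = mx3 1 1 0 0 1 0 0 0 1 *m B /\
  forall l, l != 0 -> exists2 t, t \in G & B *m rG t = mx3 l^-1 0 0 0 l 0 0 0 1 *m B.

(** If one of the pairings between [z] and [z ^ g] vanished, [z ^ g] would lie in [H], and so would
    [g]. With both nonzero, the two transvections are opposite on the plane spanned by [a] and [a'];
    they generate SL_2(p) there and fix a complementary vector. *)
Lemma transvection_case (H U : {group aT}) z :
  strongly_p_embedded p G H -> p.-group U -> U \subset H -> z \in U -> z != 1%g ->
  (forall y, y \in U -> commute z y) -> (rG z - 1) ^+ 2 = 0 ->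
  U :=: <[z]>%g /\ has_torus z.
Proof.
move=> emb pU sUH Uz ntz cUz; rewrite expr2 => z2.
have Hz := subsetP sUH z Uz; have Gz := subsetP (se_sub emb) z Hz.
have pz := mem_p_elt pU Uz.
have z1 : rG z - 1 != 0.
  apply: contra_neq ntz => /eqP; rewrite subr_eq0 => /eqP z1.
  by apply: (mx_faithful_inj faith) => //; rewrite repr_mx1.
have [f [a [zfa af]]] := nilsq_rank1 z2 z1.
have [_ [g Gg notHg]] : H \subset G /\ exists2 g, g \in G & g \notin H.
  by apply/properP; case/and4P: emb.
have Gz' : (z ^ g)%g \in G by rewrite groupJ.
pose f' := rG g^-1%g *m f; pose a' := a *m rG g.
have zE : rG z = 1 + f *m a by rewrite -zfa addrC subrK.
have z'E : rG (z ^ g)%g = 1 + f' *m a'.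
  rewrite conjgE (repr_mxM rG (groupVr Gg) (groupM Gz Gg)) (repr_mxM rG Gz Gg) zE.
  rewrite mulmxDl mulmxDr -[1 *m _]/(1 * _) mul1r /f' /a' !mulmxA repr_mxV //.
  by rewrite mulVmx ?repr_mx_unit.
have af' : a' *m f' = 0 by rewrite /f' /a' mulmxA repr_mxV // mulmxK ?repr_mx_unit.
have notHz' : (z ^ g)%g \notin H.
  apply: contra notHg => Hz'; apply: (se_mem emb _ _ Hz' _ Gg); rewrite ?p_eltJ ?conjg_eq1 //.
  by rewrite memJ_conjg.
have cross1 : a' *m f != 0.
  apply: contraNneq notHz' => e0.
  by apply: (transvections_emb p_pr p_ge5 faith emb Hz ntz Gz' zE z'E af af'); left.
have cross2 : a *m f' != 0.
  apply: contraNneq notHz' => e0.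
  by apply: (transvections_emb p_pr p_ge5 faith emb Hz ntz Gz' zE z'E af af'); right.
pose b := (a' *m f) 0 0; pose c := (a *m f') 0 0.
have bE : a' *m f = b%:M by rewrite [LHS]mx11_scalar.
have cE : a *m f' = c%:M by rewrite [LHS]mx11_scalar.
have nzb : b != 0 by apply: contraNneq cross1 => b0; rewrite bE b0 raddf0.
have nzc : c != 0 by apply: contraNneq cross2 => c0; rewrite cE c0 raddf0.
have [w ntw wff'] : exists2 w : 'rV['F_p]_3, w != 0 & w *m row_mx f f' = 0.
  have : kermx (row_mx f f') != 0.
    rewrite -mxrank_eq0 mxrank_ker subn_eq0 -ltnNge.
    exact: leq_ltn_trans (rank_leq_col _) _.
  case/rowV0Pn=> w /sub_kermxP w0 ntw; by exists w.
have [wf wf'] : w *m f = 0 /\ w *m f' = 0.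
  by move: wff'; rewrite mul_mx_row -[0]row_mx0 => /eq_row_mx.
(* [z] sends [a'] to [a' + b *: a], hence the factor [b]; then [z ^ g] adds [b * c] times the first
   row to the second. The row [w] is killed by [f] and [f'], so both fix it. *)
pose B := mx3row a' (b *: a) w.
have uB : B \in unitmx.
  rewrite -row_free_unit; apply: inj_row_free => v; rewrite mul_rV_mx3row => v0.
  have := congr1 (mulmxr f) v0; rewrite /= !mulmxDl -!scalemxAl bE af wf mul0mx !scaler0 !addr0.
  move/(congr1 (fun M : 'M_1 => M 0 0)); rewrite !mxE eqxx mulr1n => /eqP.
  rewrite mulf_eq0 (negPf nzb) orbF => /eqP e0.
  have := congr1 (mulmxr f') v0; rewrite /= !mulmxDl -!scalemxAl cE af' wf' mul0mx !scaler0 addr0 add0r.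
  move/(congr1 (fun M : 'M_1 => M 0 0)); rewrite !mxE eqxx mulr1n => /eqP.
  rewrite !mulf_eq0 (negPf nzb) (negPf nzc) !orbF => /eqP e1.
  move: v0; rewrite e0 e1 !scale0r !add0r => /eqP; rewrite scalemx_eq0 (negPf ntw) orbF => /eqP e2.
  apply/rowP=> [[[|[|[|//]]] ?]]; rewrite mxE; [rewrite -[RHS]e0 | rewrite -[RHS]e1 | rewrite -[RHS]e2];
    by congr (v _ _); apply: val_inj.
have mul1D (u : 'rV['F_p]_3) k h : u *m (1 + k *m h) = u + (u *m k) *m h.
  by rewrite mulmxDr -[1]/(1%:M) mulmx1 mulmxA.
have BzE : B *m rG z = mx3 1 1 0 0 1 0 0 0 1 *m B.
  rewrite mx3row_mul mx3_mulrow zE !mul1D -scalemxAl af bE wf.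
  by rewrite mul_scalar_mx scaler0 !mul0mx !scale1r !scale0r !addr0 !add0r.
have Bz'E : B *m rG (z ^ g)%g = mx3 1 0 0 (b * c) 1 0 0 0 1 *m B.
  rewrite mx3row_mul mx3_mulrow z'E !mul1D -scalemxAl cE af' wf'.
  rewrite mul0mx -scalemxAl mul_scalar_mx scalerA.
  by rewrite !(scale1r, scale0r, addr0, add0r) addrC.
have nzbc : b * c != 0 by rewrite mulf_neq0.
split.
  apply: (transvection_std p_pr p_ge5 (rconj_faithful uB) emb pU sUH Uz cUz Gg notHg nzbc);
  exact/rconj_mxP.
exists B => //; split=> // l nzl.
have [t Gt /rconj_mxP tE] : exists2 t, t \in G & rconj_repr rG uB t = mx3 l^-1 0 0 0 l 0 0 0 1.
  by apply: (rep_torus Gz Gz' nzbc nzl); apply/rconj_mxP.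
by exists t.
Qed.

End TransvectionCase.

(** * Regular unipotent elements, with a single Jordan block *)

Section RegularUnipotent.
Variables (aT : finGroupType) (p : nat) (G : {group aT}).
Hypotheses (p_pr : prime p) (p_ge5 : (5 <= p)%N).

Lemma regular_basis (N : 'M['F_p]_3) (e : 'rV['F_p]_3) :
  N ^+ 3 = 0 -> e *m (N ^+ 2) != 0 -> mx3row e (e *m N) (e *m N *m N) \in unitmx.
Proof.
move=> N3 nzw; have N3' : N *m N *m N = 0 by rewrite -N3 !exprS expr0 mulr1 !mulmxE mulrA.
move: nzw; rewrite expr2 -[_ * _]/(_ *m _) mulmxA => nzw.
have eN3 : e *m N *m N *m N = 0 by rewrite -(mulmxA e) -(mulmxA e) N3' mulmx0.
rewrite -row_free_unit; apply: inj_row_free => v; rewrite mul_rV_mx3row => v0.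
have := congr1 (mulmxr (N *m N)) v0; rewrite /= mul0mx !mulmxDl -!scalemxAl !mulmxA eN3 mul0mx.
rewrite !scaler0 !addr0 => /eqP; rewrite scalemx_eq0 (negPf nzw) orbF => /eqP e0.
move: v0; rewrite e0 scale0r add0r => v0.
have := congr1 (mulmxr N) v0; rewrite /= mul0mx !mulmxDl -!scalemxAl eN3.
rewrite scaler0 addr0 => /eqP; rewrite scalemx_eq0 (negPf nzw) orbF => /eqP e1.
move: v0; rewrite e1 scale0r add0r => /eqP; rewrite scalemx_eq0 (negPf nzw) orbF => /eqP e2.
by apply/rowP=> [[[|[|[|//]]] ?]]; rewrite mxE;
  [rewrite -[RHS]e0 | rewrite -[RHS]e1 | rewrite -[RHS]e2]; congr (v _ _); apply: val_inj.
Qed.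

Lemma regular_basisE (A N : 'M['F_p]_3) (e : 'rV['F_p]_3) :
  A = 1%:M + N -> N ^+ 3 = 0 ->
  mx3row e (e *m N) (e *m N *m N) *m A =
  mx3 1 1 0 0 1 1 0 0 1 *m mx3row e (e *m N) (e *m N *m N).
Proof.
move=> -> N3; have N3' : N *m N *m N = 0 by rewrite -N3 !exprS expr0 mulr1 !mulmxE mulrA.
rewrite mx3row_mul mx3_mulrow !mulmxDr !mulmx1 !(scale1r, scale0r, addr0, add0r).
by rewrite -(mulmxA e N N) -(mulmxA e _ N) N3' mulmx0 addr0.
Qed.

Lemma exists_mulmx_neq0 (A : 'M['F_p]_3) : A != 0 -> exists e : 'rV_3, e *m A != 0.
Proof.
case/rowV0Pn => v /submxP[e ->] nz; by exists e.
Qed.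

Variable rG : mx_representation 'F_p G 3.
Hypothesis faith : mx_faithful rG.

(** The centraliser of a full Jordan block consists of the polynomials in it, so unipotent elements
    of [U] have two parameters and commute with each other. Dividing by a power of [z] clears the
    first parameter; what is left is trivial or has square-zero difference from the identity. *)
Lemma pgroup_std (U : {group aT}) z :
  p.-group U -> U \subset G -> z \in U -> (forall y, y \in U -> commute z y) ->
  rG z = mx3 1 1 0 0 1 1 0 0 1 ->
  (exists z', [/\ z' \in U, z' != 1%g, forall y, y \in U -> commute z' y & (rG z' - 1) ^+ 2 = 0])
  \/ U :=: <[z]>%g.
Proof.
move=> pU sUG Uz cUz zE; have Gz := subsetP sUG z Uz.
have form y : y \in U -> exists b, exists c, rG y = mx3 1 b c 0 1 b 0 0 1.
  move=> Uy; have Gy := subsetP sUG y Uy.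
  have czy: rG z *m rG y = rG y *m rG z by rewrite -!repr_mxM // (cUz y Uy).
  have := unipotent_p_elt p_pr rG Gy (mem_p_elt pU Uy).
  have yE := mx3E (rG y); move: czy; rewrite zE yE.
  move: yE; move: (rG y 0 0) (rG y 0 1) (rG y 0 2%:R) (rG y 1 0) (rG y 1 1) (rG y 1 2%:R)
    (rG y 2%:R 0) (rG y 2%:R 1) (rG y 2%:R 2%:R) => y00 y01 y02 y10 y11 y12 y20 y21 y22 yE.
  rewrite !mx3M !(mul0r, mul1r, mulr0, mulr1, add0r, addr0).
  move=> /mx3_inj[[/esym e00 e01 e02] [[/esym e10 e11 e12] [_ e21 e22]]].
  have y10_0 : y10 = 0 by apply: (addrI y00); rewrite addr0.
  have y20_0 : y20 = 0 by apply: (addrI y10); rewrite addr0.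
  have y11_00 : y11 = y00 by apply: (addrI y01); rewrite e01 addrC.
  have y21_0 : y21 = 0 by apply: (addrI y11); rewrite e11 y10_0 add0r addr0.
  have y22_11 : y22 = y11 by apply: (addrI y12); rewrite e12 addrC.
  have y12_01 : y12 = y01 by apply: (addrI y02); rewrite e02 addrC.
  move: yE; rewrite y22_11 y10_0 y20_0 y21_0 y11_00 y12_01 => yE.
  rewrite -[1 in X in X ^+ _]/(1%:M) mx3_1 mx3N mx3D !exprS expr0 mulr1.
  rewrite -![_ * _]/(_ *m _) !mx3M mx3_0 => /mx3_inj[[e _ _] _].
  exists y01, y02; suff -> : y00 = 1 by [].
  apply/eqP; rewrite -subr_eq0; have : (y00 - 1) * (y00 - 1) * (y00 - 1) == 0.
    by apply/eqP; rewrite -[RHS]e; ring.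
  by rewrite !mulf_eq0 !orbb.
have [/exists_inP[z' Uz' /andP[nt /eqP z'2]] | noz'] :=
    boolP [exists y in U, (y != 1)%g && ((rG y - 1) ^+ 2 == 0)].
  left; exists z'; split=> // y Uy; apply: (rep_commute faith); try exact: (subsetP sUG).
  have [b [c ->]] := form z' Uz'; have [b' [c' ->]] := form y Uy.
  by rewrite !mx3M; congr mx3; ring.
right; apply/eqP; rewrite eqEsubset cycle_subG Uz andbT; apply/subsetP=> y Uy.
have [b [c yE]] := form y Uy; pose w := (y * z ^- b)%g.
have Uw : w \in U by rewrite groupM ?groupV ?groupX.
have [b1 [c1 wE]] := form w Uw.
have [b2 [c2 z2E]] := form (z ^+ b)%g (groupX _ Uz).
have zX n : exists d, rG (z ^+ n)%g = mx3 1 n%:R d 0 1 n%:R 0 0 1.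
  elim: n => [|n [d IH]]; first by exists 0; rewrite repr_mx1 mx3_1.
  exists (n%:R + d); rewrite expgS repr_mxM ?groupX // IH zE mx3M -natr1.
  by congr mx3; ring.
have b2E : b2 = b.
  by have [d] := zX b; rewrite z2E natr_Zp => /mx3_inj[[_ -> _] _].
have: rG w *m rG (z ^+ b)%g = rG y.
  by rewrite -repr_mxM ?mulgKV // ?(subsetP sUG) // groupX.
rewrite wE z2E yE mx3M b2E => /mx3_inj[[_ eb _] _].
have b10 : b1 = 0 by apply: (addrI b); rewrite addr0 -[RHS]eb; ring.
move: noz'; rewrite negb_exists => /forallP/(_ w); rewrite Uw /= negb_and negbK.
case/orP=> [/eqP w1 | /eqP[]]; last first.
  rewrite wE b10 -[X in _ - X]/(1%:M) mx3_1 mx3N mx3D expr2 -[_ * _]/(_ *m _) mx3M mx3_0.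
  by congr mx3; ring.
have -> : y = (z ^+ b)%g by apply/eqP; rewrite eq_mulgV1 -/w w1.
by rewrite mem_cycle.
Qed.

End RegularUnipotent.

Section PgroupDichotomy.
Variables (aT : finGroupType) (p : nat) (G : {group aT}).
Hypotheses (p_pr : prime p) (p_ge5 : (5 <= p)%N).
Variable rG : mx_representation 'F_p G 3.
Hypothesis faith : mx_faithful rG.

Lemma pgroup_dichotomy (U : {group aT}) :
  p.-group U -> U \subset G -> U :!=: 1%g ->
  (exists z, [/\ z \in U, z != 1%g, forall y, y \in U -> commute z y & (rG z - 1) ^+ 2 = 0])
  \/ (exists z, U :=: <[z]>%g /\ (rG z - 1) ^+ 2 != 0).
Proof.
move=> pU sUG ntU.
have /trivgPn[z /centerP[Uz cUz] ntz] : 'Z(U)%g != 1%g.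
  by rewrite center_nil_eq1 // (pgroup_nil pU).
have Gz := subsetP sUG z Uz.
have [z2|nz2] := eqVneq ((rG z - 1) ^+ 2) 0; first by left; exists z.
have N3 := unipotent_p_elt p_pr rG Gz (mem_p_elt pU Uz).
have [e nze] := exists_mulmx_neq0 nz2.
have uB := regular_basis N3 nze; set B := mx3row _ _ _ in uB.
have zE : rconj_repr rG uB z = mx3 1 1 0 0 1 1 0 0 1.
  by apply/rconj_mxP; apply: regular_basisE N3; rewrite addrC subrK.
have [[z' [Uz' ntz' cz' z'2]] | ->] := pgroup_std p_pr (rconj_faithful faith uB) pU sUG Uz cUz zE.
  left; exists z'; split=> //; have := z'2; rewrite rconj_mxE.
  have -> : B *m rG z' *m invmx B - 1 = B *m (rG z' - 1) *m invmx B.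
    by rewrite mulmxBr mulmxBl mulmx1 mulmxV.
  rewrite expr2 -[_ * _]/(_ *m _) !mulmxA mulmxKV // => /(congr1 (mulmxr B)).
  rewrite /= mulmxKV // mul0mx => /(congr1 (mulmx (invmx B))).
  by rewrite mulmx0 -!mulmxA mulKmx // expr2.
by right; exists z.
Qed.
End PgroupDichotomy.

(** * A regular unipotent element rules out invariant planes and lines *)

Section BlockTriangular.
Variables (aT : finGroupType) (p : nat) (G : {group aT}).
Hypotheses (p_pr : prime p) (p_ge5 : (5 <= p)%N).

Lemma unipotent_normal1 (rG : mx_representation 'F_p G 3) (H K : {group aT}) :
  mx_faithful rG -> strongly_p_embedded p G H -> K <| G ->
  (forall x, x \in K -> (rG x - 1) ^+ 3 = 0) -> K :=: 1%g.
Proof.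
move=> faith emb nKG unip; apply: (se_pcore1 p_pr emb nKG).
apply/pgroupP=> q q_pr /(Cauchy q_pr)[x Kx ox].
have Gx := subsetP (normal_sub nKG) x Kx.
have := unipotent_elt p_pr p_ge5 faith Gx (unip x Kx).
by rewrite /p_elt ox pnatE.
Qed.

Lemma F2_neq0 : (2%:R : 'F_p) != 0.
Proof.
have pch := pchar_Fp p_pr; rewrite -(dvdn_pcharf pch) gtnNdvd //.
exact: leq_trans p_ge5.
Qed.

(** If [G] is triangular, the kernel of its diagonal part is normal and unipotent, hence trivial,
    yet contains [z]. Otherwise [G] contains an element acting as -1 on the invariant plane and as 1
    on the quotient. It commutes with [z] modulo a unipotent kernel, which is trivial again, and
    comparing entries gives 2 = 0. *)
Lemma upper_block_regular (rG : mx_representation 'F_p G 3) (H : {group aT}) z :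
  mx_faithful rG -> strongly_p_embedded p G H -> z \in G ->
  rG z = mx3 1 1 0 0 1 1 0 0 1 ->
  (forall g, g \in G -> exists a b c d e f h, rG g = mx3 a b c 0 d e 0 f h) -> False.
Proof.
move=> faith emb Gz zE form.
have ntz : z != 1%g.
  apply: contra_eq_neq zE => ->; rewrite repr_mx1 mx3_1; apply/eqP => /mx3_inj[[_ /esym/eqP]].
  by rewrite oner_eq0.
have cube0 (b c e : 'F_p) : (mx3 1 b c 0 1 e 0 0 1 - 1) ^+ 3 = 0.
  rewrite -[X in _ - X]/(1%:M) mx3_1 mx3N mx3D !exprS expr0 mulr1.
  by rewrite -![_ * _]/(_ *m _) !mx3M mx3_0; congr mx3; ring.
have [/forall_inP tri | ] := boolP [forall g in G, rG g 2%:R 1 == 0].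
  pose d g := mx3 (rG g 0 0) 0 0 0 (rG g 1 1) 0 0 0 (rG g 2%:R 2%:R).
  have triE g : g \in G -> exists a b c d e f, rG g = mx3 a b c 0 d e 0 0 f.
    move=> Gg; have [a [b [c [d' [e [f [h gE]]]]]]] := form g Gg.
    exists a, b, c, d', e, h; have := tri g Gg.
    by rewrite gE !mxE /= => /eqP ->.
  have d_repr : mx_repr G d.
    split=> [|x y Gx Gy]; first by rewrite /d repr_mx1 [RHS]mx3_1 !mxE.
    have [a [b [c [d' [e [f xE]]]]]] := triE x Gx.
    have [a' [b' [c' [d'' [e' [f' yE]]]]]] := triE y Gy.
    by rewrite /d repr_mxM // xE yE !mx3M !mxE /=; congr mx3; ring.
  pose rD := MxRepresentation d_repr.
  have Kz : z \in rker rD.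
    by apply/rkerP; split=> //; rewrite /= /d zE !mxE /= mx3_1.
  suff K1 : rker rD = 1%g by rewrite K1 inE (negPf ntz) in Kz.
  apply: (unipotent_normal1 faith emb (rker_normal rD)) => x /rkerP[Gx].
  have [a [b [c [d' [e [f xE]]]]]] := triE x Gx.
  rewrite /= /d xE !mxE /= mx3_1 => /mx3_inj[[-> _ _] [[_ -> _] [_ _ ->]]].
  exact: cube0.
rewrite negb_forall => /existsP[g0]; rewrite negb_imply => /andP[Gg0 nz0].
have zX n : exists m k, rG (z ^+ n)%g = mx3 1 m k 0 1 n%:R 0 0 1.
  elim: n => [|n [m [k IH]]]; first by exists 0, 0; rewrite repr_mx1 mx3_1.
  exists (m + 1), (n%:R + k); rewrite expgS repr_mxM ?groupX // IH zE mx3M -natr1.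
  by congr mx3; ring.
(* Elements that act trivially on the quotient by the plane, recorded by their matrix on the plane
   only. *)
pose has2 a b c d := exists x m n, x \in G /\ rG x = mx3 1 m n 0 a b 0 c d.
have hasM a b c d a' b' c' d' : has2 a b c d -> has2 a' b' c' d' ->
    has2 (a * a' + b * c') (a * b' + b * d') (c * a' + d * c') (c * b' + d * d').
  case=> x [m [n [Gx xE]]] [y [m' [n' [Gy yE]]]].
  exists (x * y)%g, (m' + m * a' + n * c'), (n' + m * b' + n * d').
  rewrite groupM // repr_mxM // xE yE mx3M; split=> //.
  by congr mx3; ring.
have up k : has2 1 k 0 1.
  have [m [n kE]] := zX k; exists (z ^+ k)%g, m, n; rewrite groupX // kE.
  by rewrite natr_Zp.
have [g [Gg [a [b [c [d [e [f gE]]]]]]]] :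
   exists g, g \in G /\ exists a b c d e f, rG g = mx3 a b c 0 d e 0 f 0 /\ f != 0.
  have [a [b [c [d [e [f [h gE]]]]]]] := form g0 Gg0.
  have nzf : f != 0 by move: nz0; rewrite gE !mxE.
  (* This power of [z] makes the last diagonal entry vanish; conjugating [z] by such a [g] turns its
     upper unipotent block into a lower one. *)
  have [m [n kE]] := zX (- h / f).
  exists (g0 * z ^+ (- h / f)%R)%g; rewrite groupM ?groupX //; split=> //.
  rewrite repr_mxM ?groupX // kE gE natr_Zp mx3M !(mul0r, mul1r, mulr0, mulr1, add0r, addr0).
  have -> : f * (- h / f) + h = 0 by field.
  by do 6!eexists; split; [exact: erefl | exact: nzf].
case: gE => gE nzf.
have [nza nze] : a != 0 /\ e != 0.
  have [a2 [b2 [c2 [d2 [e2 [f2 [h2 gVE]]]]]]] := form g^-1%g (groupVr Gg).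
  have: rG g *m rG g^-1%g = 1%:M by rewrite -repr_mxM ?groupV // mulgV repr_mx1.
  rewrite gE gVE mx3M mx3_1 !(mul0r, mul1r, mulr0, mulr1, add0r, addr0).
  move=> /mx3_inj[[aE _ _] [[_ dE _] [_ /eqP]]]; rewrite mulf_eq0 (negPf nzf) => /eqP d20 _.
  move: dE; rewrite d20 mulr0 add0r => eE.
  split; apply/eqP=> e0; move/eqP: (oner_neq0 'F_p); apply.
    by rewrite -aE e0 mul0r.
  by rewrite -eE e0 mul0r.
have [q nzq lo1] : exists2 q, q != 0 & has2 1 0 q 1.
  have Gy : (z ^ g)%g \in G by rewrite groupJ.
  have [a' [b' [c' [d' [e' [f' [h' yE]]]]]]] := form _ Gy.
  have: rG g *m rG (z ^ g)%g = rG z *m rG g by rewrite -(repr_mxM rG Gg Gy) -(repr_mxM rG Gz Gg) [in RHS]conjgC.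
  rewrite gE zE yE !mx3M !(mul0r, mul1r, mulr0, mulr1, add0r, addr0).
  move=> /mx3_inj[[e00 _ _] [[_ e11 e12] [_ e21 e22]]].
  have a1 : a' = 1 by apply: (mulfI nza); rewrite mulr1.
  have d1 : d' = 1 by apply: (mulfI nzf); rewrite mulr1.
  have e0 : e' = 0 by apply: (mulfI nzf); rewrite mulr0.
  have h1 : h' = 1 by apply: (mulfI nze); rewrite mulr1 -[RHS]e12 e0 mulr0 add0r.
  exists f'; last by exists (z ^ g)%g, b', c'; rewrite Gy yE a1 d1 e0 h1.
  apply: contraNneq nzf => f0; move: e11; rewrite f0 d1 mulr0 addr0 mulr1.
  by move/(congr1 (fun t => t - d)); rewrite subrr addrC addKr => <-.
have lo k : has2 1 0 k 1.
  suff loX n : has2 1 0 (n%:R * q) 1 by have := loX (k / q); rewrite natr_Zp divfK.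
  elim: n => [|n IH]; first by exists 1%g, 0, 0; rewrite group1 repr_mx1 mul0r mx3_1.
  have := hasM _ _ _ _ _ _ _ _ IH lo1; congr has2; rewrite -?natr1; ring.
have [t [m [n [Gt tE]]]] : has2 (-1) 0 0 (-1).
  (* The product has rows (-1, -2) and (1, 1); it has trace 0 and determinant 1, so its square is
     -1. *)
  have hw := hasM _ _ _ _ _ _ _ _ (up (- 2%:R)) (lo 1).
  by have := hasM _ _ _ _ _ _ _ _ hw hw; congr has2; ring.
pose bl g := mx3 (rG g 0 0) 0 0 0 (rG g 1 1) (rG g 1 2%:R) 0 (rG g 2%:R 1) (rG g 2%:R 2%:R).
have bl_repr : mx_repr G bl.
  split=> [|x y Gx Gy]; first by rewrite /bl repr_mx1 [RHS]mx3_1 !mxE.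
  have [a1 [b1 [c1 [d1 [e1 [f1 [h1 xE]]]]]]] := form x Gx.
  have [a2 [b2 [c2 [d2 [e2 [f2 [h2 yE]]]]]]] := form y Gy.
  by rewrite /bl repr_mxM // xE yE !mx3M !mxE /=; congr mx3; ring.
pose rB := MxRepresentation bl_repr.
have rB1 : rker rB = 1%g.
  apply: (unipotent_normal1 faith emb (rker_normal rB)) => x /rkerP[Gx].
  have [a1 [b1 [c1 [d1 [e1 [f1 [h1 xE]]]]]]] := form x Gx.
  rewrite /= /bl xE !mxE /= mx3_1 => /mx3_inj[[-> _ _] [[_ -> ->] [_ -> ->]]].
  exact: cube0.
have ctz : [~ t, z] = 1%g.
  apply/set1P; rewrite -[[set _]]rB1; apply/rkerP; split; first by rewrite groupR.
  have Gk : [~ t, z] \in G by rewrite groupR.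
  have [a1 [b1 [c1 [d1 [e1 [f1 [h1 kE]]]]]]] := form _ Gk.
  have: rG z *m rG t *m rG [~ t, z] = rG t *m rG z.
    by rewrite -(repr_mxM rG Gz Gt) -(repr_mxM rG (groupM Gz Gt) Gk) -(repr_mxM rG Gt Gz) [in RHS]commgC.
  rewrite zE tE kE !mx3M !(mul0r, mul1r, mulr0, mulr1, add0r, addr0, mulN1r, mulrN1).
  move=> /mx3_inj[[a1E _ _] [[_ dE eE] [_ /eqP fE /eqP hE]]].
  rewrite /= /bl kE !mxE /= mx3_1.
  have f0 : f1 = 0 by apply/eqP; rewrite -oppr_eq0.
  have h0 : h1 = 1 by apply/eqP; rewrite -eqr_opp.
  move: dE eE; rewrite f0 h0 oppr0 addr0 => /oppr_inj -> /eqP.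
  by rewrite -subr_eq0 opprK subrK oppr_eq0 => /eqP ->; rewrite a1E.
have: rG t *m rG z = rG z *m rG t by rewrite -!repr_mxM //; congr (rG _); apply/commgP/eqP.
rewrite zE tE !mx3M !(mul0r, mul1r, mulr0, mulr1, add0r, addr0).
move=> /mx3_inj[[_ e01 _] _]; case/negP: F2_neq0.
have -> : 2%:R = (1 + m) - (m - 1) :> 'F_p by ring.
by rewrite e01 subrr.
Qed.

End BlockTriangular.

Section InvariantPlane.
Variables (aT : finGroupType) (p : nat) (G : {group aT}).
Hypotheses (p_pr : prime p) (p_ge5 : (5 <= p)%N).

(** A single Jordan block has only one invariant plane, the image of [rG z - 1]. So [D] is spanned
    by the last two vectors of the basis [v], [v *m N], [v *m N *m N], and in that basis [G] has the
    excluded block form. *)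
Lemma regular_no_plane (rG : mx_representation 'F_p G 3) (H : {group aT}) z (D : 'M_3) :
  mx_faithful rG -> strongly_p_embedded p G H -> z \in G ->
  (rG z - 1) ^+ 3 = 0 -> (rG z - 1) ^+ 2 != 0 ->
  mxmodule rG D -> \rank D = 2%N -> False.
Proof.
move=> faith emb Gz N3 nzN2 modD rD; pose N := rG z - 1.
have [v nzv] := exists_mulmx_neq0 nzN2.
have uB := regular_basis N3 nzv; set B := mx3row _ _ _ in uB.
have zE : rconj_repr rG uB z = mx3 1 1 0 0 1 1 0 0 1.
  by apply/rconj_mxP; apply: regular_basisE N3; rewrite addrC subrK.
have DN : (D *m N <= D)%MS.
  rewrite /N mulmxBr addmx_sub ?(mxmoduleP modD) //.
  by rewrite eqmx_opp -[X in _ *m X]/(1%:M) mulmx1.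
have DN2 : D *m (N ^+ 2) = 0.
  apply/eqP; apply: contraT => /rowV0Pn[w /submxP[x ->]]; rewrite mulmxA => nzx.
  have := regular_basis N3 nzx; rewrite -row_free_unit /row_free => /eqP r3.
  have xD : (x *m D <= D)%MS by apply: submxMl.
  have xDN : (x *m D *m N <= D)%MS by apply: submx_trans DN; rewrite -mulmxA submxMl.
  have xDN2 : (x *m D *m N *m N <= D)%MS by apply: submx_trans DN; apply: submxMr.
  have : (mx3row (x *m D) (x *m D *m N) (x *m D *m N *m N) <= D)%MS.
    apply/row_subP=> [[[|[|[|//]]] ?]]; [rewrite (_ : row _ _ = x *m D) // |
      rewrite (_ : row _ _ = x *m D *m N) // | rewrite (_ : row _ _ = x *m D *m N *m N) //];
    by apply/rowP=> j; rewrite !mxE.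
  by move/mxrankS; rewrite r3 rD.
have N3' : N *m N *m N = 0 by rewrite -N3 !exprS expr0 mulr1 !mulmxE mulrA.
pose C := col_mx (v *m N) (v *m N *m N).
have rC : \rank C = 2%N.
  apply/eqP; rewrite -[_ == _]/(row_free C); apply: inj_row_free => w.
  rewrite -[w]hsubmxK mul_row_col [lsubmx w]mx11_scalar [rsubmx w]mx11_scalar !mul_scalar_mx.
  set a := lsubmx w 0 0; set b := rsubmx w 0 0 => ab0.
  have: (mx3row v (v *m N) (v *m N *m N)) \in unitmx by [].
  rewrite -row_free_unit => /row_free_inj/(_ (\row_i nth 0 [:: 0; a; b] i) 0).
  rewrite mul0mx mul_rV_mx3row !mxE /= scale0r add0r ab0 => /(_ erefl)/rowP e.
  have := e 1; have := e 2%:R; rewrite !mxE /= => -> ->.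
  by rewrite !raddf0 row_mx0.
have sC1 : (v *m N <= C)%MS by rewrite -addsmxE addsmxSl.
have sC2 : (v *m N *m N <= C)%MS by rewrite -addsmxE addsmxSr.
have DC : (D <= C)%MS.
  apply/rV_subP=> w /submxP[x ->].
  have := mulmxKV uB (x *m D); set y := x *m D *m invmx B; rewrite mul_rV_mx3row => yE.
  have y0 : y 0 0 = 0.
    have v3 : v *m N *m N *m N = 0 by rewrite -(mulmxA v) -(mulmxA v) N3' mulmx0.
    have : x *m D *m N *m N = 0 by rewrite -!mulmxA -[N *m N]/(N * N) -expr2 DN2 mulmx0.
    rewrite -yE !mulmxDl -!scalemxAl v3 mul0mx !scaler0 !addr0 => /eqP.
    rewrite scalemx_eq0 => /orP[/eqP -> //|].
    by rewrite -mulmxA -[N *m N]/(N * N) -expr2 (negPf nzv).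
  by rewrite -yE y0 scale0r add0r addmx_sub // scalemx_sub.
have CD : (C <= D)%MS by rewrite -(mxrank_leqif_sup DC) rC rD.
have CG g : g \in G -> (C *m rG g <= C)%MS.
  move=> Gg; apply: submx_trans (submxMr _ CD) _.
  by apply: submx_trans DC; apply: (mxmoduleP modD).
apply: (upper_block_regular p_pr p_ge5 (rconj_faithful faith uB) emb Gz zE) => g Gg.
set M := rconj_repr rG uB g.
have ME : B *m rG g = M *m B by apply/rconj_mxP.
have inC (w : 'rV_3) : (w <= C)%MS -> (w *m invmx B) 0 0 = 0.
  case/submxP=> x ->; rewrite -[x]hsubmxK mul_row_col !mulmxDl.
  have -> : v *m N *m N = row 2%:R B by rewrite mx3row_row2.
  have -> : v *m N = row 1 B by rewrite mx3row_row1.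
  rewrite !rowE -!mulmxA mulmxV // !mulmx1 !mxE !big_ord1 !mxE /=.
  by rewrite !mulr0 addr0.
have := mx3E M; have -> : M 1 0 = 0.
  have := inC (v *m N *m rG g); rewrite (submx_trans (submxMr _ sC1) (CG g Gg)) => /(_ isT).
  have -> : v *m N = row 1 B by rewrite mx3row_row1.
  by rewrite rowE -(mulmxA _ B) ME mulmxA mulmxK // -rowE mxE => ->.
have -> : M 2%:R 0 = 0.
  have := inC (v *m N *m N *m rG g); rewrite (submx_trans (submxMr _ sC2) (CG g Gg)) => /(_ isT).
  have -> : v *m N *m N = row 2%:R B by rewrite mx3row_row2.
  by rewrite rowE -(mulmxA _ B) ME mulmxA mulmxK // -rowE mxE => ->.
by move=> ->; do 7!eexists.
Qed.

End InvariantPlane.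

Section Dual.
Variables (aT : finGroupType) (p : nat) (G : {group aT}).
Variable rG : mx_representation 'F_p G 3.

Definition dual_mx g := (rG g^-1%g)^T.

Lemma dual_mx_repr : mx_repr G dual_mx.
Proof.
split=> [|x y Gx Gy]; rewrite /dual_mx ?invg1 ?repr_mx1 ?trmx1 //.
by rewrite invMg repr_mxM ?groupV // trmx_mul.
Qed.
Definition dual_repr := MxRepresentation dual_mx_repr.

Lemma dual_faithful : mx_faithful rG -> mx_faithful dual_repr.
Proof.
move=> faith; apply/subsetP=> x /rkerP[Gx]; rewrite /= /dual_mx => /(congr1 trmx).
rewrite trmxK trmx1 => x1; rewrite inE -invg_eq1; apply/eqP.
by apply: (mx_faithful_inj faith); rewrite ?groupV // x1 repr_mx1.
Qed.
End Dual.

Section RegularIrreducible.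
Variables (aT : finGroupType) (p : nat) (G : {group aT}).
Hypotheses (p_pr : prime p) (p_ge5 : (5 <= p)%N).

Lemma regular_irreducible (rG : mx_representation 'F_p G 3) (H : {group aT}) z :
  mx_faithful rG -> strongly_p_embedded p G H -> z \in G ->
  (rG z - 1) ^+ 3 = 0 -> (rG z - 1) ^+ 2 != 0 -> mx_irreducible rG.
Proof.
move=> faith emb Gz N3 nzN2; apply/mx_irrP; split=> // U modU nzU.
rewrite -mxrank_eq0 -lt0n in nzU; rewrite /row_full.
have := rank_leq_row U; case rU: (\rank U) nzU => [|[|[|[|n]]]] //= _ _; last first.
  by case: (regular_no_plane p_pr p_ge5 faith emb Gz N3 nzN2 modU rU).
(* The annihilator of an invariant line is an invariant plane of the dual representation, in which
   [z^-1] is regular unipotent. *)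
pose D := kermx U^T.
have rD : \rank D = 2%N by rewrite mxrank_ker mxrank_tr rU.
have modD : mxmodule (dual_repr rG) D.
  apply/mxmoduleP=> g Gg; apply/sub_kermxP; rewrite /= /dual_mx -mulmxA -trmx_mul.
  have /submxP[C ->] := mxmoduleP modU _ (groupVr Gg).
  by rewrite trmx_mul mulmxA mulmx_ker mul0mx.
have dz : dual_repr rG z^-1%g - 1 = (rG z - 1)^T.
  by rewrite /= /dual_mx invgK linearB /= trmx1.
have trX n (A : 'M['F_p]_3) : (A^T) ^+ n = (A ^+ n)^T.
  by elim: n => [|n IH]; rewrite ?expr0 ?trmx1 // exprS exprSr IH -mulmxE trmx_mul.
case: (regular_no_plane p_pr p_ge5 (dual_faithful faith) emb (groupVr Gz) _ _ modD rD).
  by rewrite dz trX N3 trmx0.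
by rewrite dz trX trmx_eq0.
Qed.
End RegularIrreducible.

Theorem linear_alternative (aT : finGroupType) (p : nat) (G H U : {group aT})
    (rG : mx_representation 'F_p G 3) :
  prime p -> (5 <= p)%N -> mx_faithful rG -> strongly_p_embedded p G H ->
  p.-group U -> U \subset G -> U :!=: 1%g ->
  exists z, [/\ U :=: <[z]>%g, (z ^+ p)%g = 1%g, (rG z - 1) ^+ 3 = 0 &
    has_torus rG z \/ (rG z - 1) ^+ 2 != 0 /\ mx_irreducible rG].
Proof.
move=> p_pr p_ge5 faith emb pU sUG ntU.
have unip z : z \in U -> (rG z - 1) ^+ 3 = 0.
  move=> Uz; have Gz := subsetP sUG z Uz.
  exact: (unipotent_p_elt p_pr rG Gz (mem_p_elt pU Uz)).
have [[z [Uz ntz cUz z2]] | [z [defU nz2]]] := pgroup_dichotomy p_pr faith pU sUG ntU.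
  have [K embK sUK] := se_over p_pr emb pU sUG.
  have [defU tor] := transvection_case p_pr p_ge5 faith embK pU sUK Uz ntz cUz z2.
  exists z; split=> //; [|by apply: unip | by left].
  by apply: (p_elt_unipotent p_pr p_ge5 faith (subsetP sUG z Uz)); apply: unip.
have Uz : z \in U by rewrite defU cycle_id.
have Gz := subsetP sUG z Uz; have N3 := unip z Uz.
exists z; split=> //; first exact: (p_elt_unipotent p_pr p_ge5 faith Gz N3).
right; split=> //; exact: (regular_irreducible p_pr p_ge5 faith emb Gz N3 nz2).
Qed.

(** Permutations compose from left to right, so automorphisms act on row vectors from the right. The
    coordinate map [r] on [E] with kernel ['Phi(E)] is kept, so that later arguments stay with
    elements of [E]. *)
Lemma Aut_Frattini_repr (gT : finGroupType) p (E : {group gT}) (G : {group {perm gT}}) :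
  prime p -> p.-group E -> #|E : 'Phi(E)%g| = (p ^ 3)%N -> G \subset Aut E ->
  exists rG : mx_representation 'F_p G 3, exists r : gT -> 'rV['F_p]_3,
  [/\ {in E &, forall x y, r (x * y)%g = r x + r y},
      {in E, forall x, (r x == 0) = (x \in 'Phi(E)%g)},
      (forall v, exists2 x, x \in E & r x = v) &
      forall (a : {perm gT}) x, a \in G -> x \in E -> r (a x) = r x *m rG a].
Proof.
move=> p_pr pE iE sGA; have nPE := normal_norm (Phi_normal E).
have abV := Phi_quotient_abelem pE.
have /isogP[f injf imf] : (E / 'Phi(E))%g \isog [set: 'rV['F_p]_3].
  rewrite (isog_abelem_card _ abV) cardsT card_mx card_Fp // mul1n card_quotient // iE eqxx.
  by rewrite mx_Fp_abelem.
pose r x := f (coset 'Phi(E) x) : 'rV['F_p]_3.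
have NP x : x \in E -> x \in 'N('Phi(E)) by apply/subsetP.
have Vx x : x \in E -> coset 'Phi(E) x \in (E / 'Phi(E))%g by apply: mem_quotient.
have rM : {in E &, forall x y, r (x * y)%g = r x + r y}.
  by move=> x y Ex Ey; rewrite /r morphM ?NP // morphM ?Vx.
have r0 : {in E, forall x, (r x == 0) = (x \in 'Phi(E))}.
  move=> x Ex; rewrite -[0]/(1%g : 'rV['F_p]_3) /r morph_injm_eq1 ?Vx //.
  by apply/eqP/idP => [/(coset_idr (NP x Ex)) | /coset_id].
have rs v : exists2 x, x \in E & r x = v.
  have : v \in (f @* (E / 'Phi(E)))%g by rewrite imf inE.
  case/morphimP=> y _ /morphimP[x Nx Ex ->] ->; by exists x.
(* A section of [r]; surjectivity rules out the default value. *)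
pose s v := odflt 1%g [pick x in E | r x == v].
have [Es sK] : (forall v, s v \in E) /\ (forall v, r (s v) = v).
  split=> v; rewrite /s; case: pickP => [x /andP[Ex /eqP] // | /= none];
  by have [x Ex rx] := rs v; have := none x; rewrite Ex rx eqxx.
have Ea a x : a \in G -> x \in E -> a x \in E.
  by move=> Ga Ex; apply: Aut_closed Ex; apply: (subsetP sGA).
have aM a : a \in G -> {in E &, {morph a : x y / (x * y)%g}}.
  by move=> Ga x y Ex Ey; have /morphicP := Aut_morphic (subsetP sGA a Ga); apply.
have aPhi a x : a \in G -> x \in 'Phi(E) -> a x \in 'Phi(E).
  by move/(subsetP sGA); apply: char_Aut_closed (Phi_char E).
have r_a a x y : a \in G -> x \in E -> y \in E -> r x = r y -> r (a x) = r (a y).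
  move=> Ga Ex Ey rxy; pose k := (x * y^-1)%g.
  have Ek : k \in E by rewrite groupM ?groupV.
  have xE : x = (k * y)%g by rewrite mulgKV.
  have rk : r k == 0.
    by move/eqP: rxy; rewrite {1}xE rM // -subr_eq0 addrK.
  rewrite xE aM // rM ?Ea //.
  have /eqP -> : r (a k) == 0 by rewrite r0 ?Ea // aPhi // -r0.
  by rewrite add0r.
pose h a v := r (a (s v)).
have hD a : a \in G -> {morph h a : v w / v + w}.
  move=> Ga v w; rewrite /h -rM ?Ea // -aM //.
  by apply: r_a; rewrite ?groupM // rM // !sK.
have h0 a : a \in G -> h a 0 = 0.
  by move=> Ga; apply: (addrI (h a 0)); rewrite -hD // !addr0.
have hZ a (c : 'F_p) v : a \in G -> h a (c *: v) = c *: h a v.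
  move=> Ga; rewrite -[c]natr_Zp !scaler_nat.
  by elim: (c : nat) => [|n IH]; rewrite ?mulr0n ?h0 // !mulrS hD // IH.
pose M a : 'M['F_p]_3 := \matrix_i h a (delta_mx 0 i).
have hE a v : a \in G -> h a v = v *m M a.
  move=> Ga; rewrite mulmx_sum_row {1}[v]row_sum_delta (big_morph (h a) (hD a Ga) (h0 a Ga)).
  by apply: eq_bigr => i _; rewrite hZ // rowK.
have rE a x : a \in G -> x \in E -> r (a x) = r x *m M a.
  by move=> Ga Ex; rewrite -hE //; apply: r_a; rewrite ?sK.
have M_repr : mx_repr G M.
  split=> [|a b Ga Gb]; apply/row_matrixP=> i; rewrite rowK /h.
    by rewrite perm1 sK rowE mulmx1.
  by rewrite permM !rE ?Ea // sK rowE mulmxA.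
by exists (MxRepresentation M_repr), r; split.
Qed.

(** * Essential subgroups of rank three *)

Definition indep3 (F : fieldType) (u v w : 'rV[F]_3) :=
  forall a b c, a *: u + b *: v + c *: w = 0 -> [/\ a = 0, b = 0 & c = 0].

Lemma indep3_unitmx (F : fieldType) (u v w : 'rV[F]_3) : mx3row u v w \in unitmx -> indep3 u v w.
Proof.
move=> uB a b c eq0; have eqA : mx3 a b c 0 0 0 0 0 0 = mx3 0 0 0 0 0 0 0 0 0.
  rewrite -(mulmxK uB (mx3 a _ _ _ _ _ _ _ _)) -[RHS](mulmxK uB).
  by rewrite !mx3_mulrow eq0 !scale0r !addr0.
by case: (mx3_inj eqA).
Qed.

Lemma indep3_span (F : fieldType) (u v w x : 'rV[F]_3) : mx3row u v w \in unitmx ->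
  exists a b c, x = a *: u + b *: v + c *: w.
Proof.
move=> uB; exists ((x *m invmx (mx3row u v w)) 0 0), ((x *m invmx (mx3row u v w)) 0 1),
  ((x *m invmx (mx3row u v w)) 0 2%:R).
by rewrite -mul_rV_mx3row mulmxKV.
Qed.

(** * Subgroups between ['Phi(E)] and [E] in coordinates *)

Section Coordinates.
Variables (gT : finGroupType) (p : nat) (E : {group gT}) (r : gT -> 'rV['F_p]_3).
Hypotheses (p_pr : prime p) (pE : p.-group E).
Hypotheses (rM : {in E &, forall x y, r (x * y)%g = r x + r y}).
Hypotheses (r0 : {in E, forall x, (r x == 0) = (x \in 'Phi(E))}).
Hypothesis (iE : #|E : 'Phi(E)| = (p ^ 3)%N).

Lemma coord1 : r 1%g = 0. Proof. by apply/eqP; rewrite r0 ?group1. Qed.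

Lemma coordV x : x \in E -> r x^-1%g = - r x.
Proof. by move=> Ex; apply/eqP; rewrite -addr_eq0 -rM ?groupV // mulVg coord1. Qed.

Lemma coordX x n : x \in E -> r (x ^+ n)%g = r x *+ n.
Proof.
move=> Ex; elim: n => [|n IH]; first by rewrite coord1.
by rewrite expgS rM ?groupX // IH mulrS.
Qed.

Lemma coordZ x (a : 'F_p) : x \in E -> r (x ^+ a)%g = a *: r x.
Proof. by move=> Ex; rewrite coordX // -scaler_nat natr_Zp. Qed.

Lemma coord_mem (X : {group gT}) x y :
  'Phi(E) \subset X -> X \subset E -> x \in E -> y \in X -> r x = r y -> x \in X.
Proof.
move=> sPX sXE Ex Xy rxy; have Ey := subsetP sXE y Xy.
rewrite -(mulgKV y x) groupM // (subsetP sPX) // -r0 ?groupM ?groupV //.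
by rewrite rM ?groupV // coordV // rxy subrr.
Qed.

Lemma Phi_normal_over (X : {group gT}) : 'Phi(E) \subset X -> X \subset E -> X <| E.
Proof.
move=> sPX sXE; rewrite /normal sXE -commg_subl.
by apply: subset_trans (subset_trans (commSg _ sXE) (der_sub_Phi pE)) sPX.
Qed.

Lemma coord_line (X : {group gT}) d x : 'Phi(E) \subset X -> X \subset E -> d \in E ->
  x \in (<[d]> <*> X)%G -> exists a, exists2 y, y \in X & r x = a *: r d + r y.
Proof.
move=> sPX sXE Ed; have nXE := normal_norm (Phi_normal_over sPX sXE).
rewrite /= norm_joinEl; last by rewrite cycle_subG (subsetP nXE).
case/mulsgP=> _ y /cycleP[n ->] Xy ->; exists n%:R, y => //.
have Ey := subsetP sXE y Xy.
by rewrite rM ?groupX // coordX // scaler_nat.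
Qed.

Lemma coord_flag e d w : e \in E -> d \in E -> w \in E -> indep3 (r e) (r d) (r w) ->
  exists D Z : {group gT},
  [/\ [/\ 'Phi(E) \subset D, D \subset Z & Z \subset E],
      [/\ #|E : Z| = p, #|Z : D| = p & #|D : 'Phi(E)| = p],
      [/\ d \in D, w \in Z & e \notin Z],
      forall x, x \in E -> (x \in D) <-> (exists a, r x = a *: r d) &
      forall x, x \in E -> (x \in Z) <-> (exists a b, r x = a *: r w + b *: r d)].
Proof.
move=> Ee Ed Ew ind; have sPE := Phi_sub E.
pose D := (<[d]> <*> 'Phi(E))%G; pose Z := (<[w]> <*> D)%G.
have sPD : 'Phi(E) \subset D by apply: joing_subr.
have sDZ : D \subset Z by apply: joing_subr.
have sDE : D \subset E by rewrite join_subG cycle_subG Ed.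
have sZE : Z \subset E by rewrite join_subG cycle_subG Ew.
have Dd : d \in D by rewrite (subsetP (joing_subl _ _)) ?cycle_id.
have Zw : w \in Z by rewrite (subsetP (joing_subl _ _)) ?cycle_id.
have memD x : x \in E -> (x \in D) <-> (exists a, r x = a *: r d).
  move=> Ex; split=> [/(coord_line (subxx _) sPE Ed)[a [y Py ->]] | [a rx]].
    by exists a; have /eqP -> : r y == 0; rewrite ?addr0 // r0 // (subsetP sPE).
  by apply: (coord_mem sPD sDE Ex (groupX a Dd)); rewrite coordZ.
have memZ x : x \in E -> (x \in Z) <-> (exists a b, r x = a *: r w + b *: r d).
  move=> Ex; split=> [/(coord_line sPD sDE Ew)[a [y Dy ->]] | [a [b rx]]].
    have [b ->] := proj1 (memD y (subsetP sDE y Dy)) Dy.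
    by exists a, b.
  apply: (coord_mem (subset_trans sPD sDZ) sZE Ex (groupM (groupX a Zw) (groupX b (subsetP sDZ d Dd)))).
  by rewrite rM ?groupX // !coordZ.
have notPd : d \notin 'Phi(E).
  rewrite -r0 //; apply/eqP=> rd; have [] := ind 0 1 0; last by move=> _ /eqP; rewrite oner_eq0.
  by rewrite !scale0r rd scaler0 !addr0.
have notDw : w \notin D.
  apply/negP=> /(memD w Ew)[a rw]; have [] := ind 0 a (-1).
    by rewrite scale0r add0r rw scaleN1r subrr.
  by move=> _ _ /eqP; rewrite oppr_eq0 oner_eq0.
have notZe : e \notin Z.
  apply/negP=> /(memZ e Ee)[a [b re]]; have [] := ind (-1) b a.
    by rewrite re scaleN1r -addrA [X in _ + X]addrC addNr.
  by move=> /eqP; rewrite oppr_eq0 oner_eq0.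
have iDP : #|D : 'Phi(E)| = p.
  apply: index_cycle_join => //; last exact: expg_Phi.
  by apply: (subsetP (normal_norm (Phi_normal E))).
have iZD : #|Z : D| = p.
  apply: index_cycle_join => //.
    exact: (subsetP (normal_norm (Phi_normal_over sPD sDE))).
  by apply: (subsetP sPD); apply: expg_Phi.
exists D, Z; split=> //; split=> //.
have := Lagrange_index sZE (subset_trans sPD sDZ).
rewrite -(Lagrange_index sDZ sPD) iZD iDP iE (expnSr p 2).
by rewrite -mulnn [in RHS]mulnC => /eqP; rewrite eqn_pmul2r ?muln_gt0 ?prime_gt0 // => /eqP.
Qed.

End Coordinates.

Lemma conj_autJ (gT : finGroupType) (E : {group gT}) (a : {perm gT}) y :
  a \in Aut E -> y \in E -> (conj_aut E y ^ a)%g = conj_aut E (a y).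
Proof.
move=> Aa Ey; have aM := Aut_morph Aa; have Eay : a y \in E by apply: Aut_closed.
apply: (eq_Aut (A := E)); [exact: (groupJ (Aut_aut _ _) Aa) | exact: Aut_aut | move=> x].
rewrite -{1}(Aut_imset Aa) => /imsetP[w Ew ->]; rewrite permJ !conj_autE ?Aut_closed //.
by rewrite !conjgE -(weight_idV aM) // !aM ?groupM ?groupV.
Qed.

Section Essential.
Variables (gT : finGroupType) (p : nat) (S E : {group gT}).
Variable F : {set gT} -> {ffun gT -> gT} -> bool.
Hypotheses (p_pr : prime p) (p_ge5 : (5 <= p)%N).
Hypotheses (pS : p.-group S) (satF : saturated F p S) (essE : essential p S F E).
Hypotheses (rkE : Defs.grank E = 3) (nsSN : ~~ (S \subset 'N(E))).

Let N := 'N_S(E)%G.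

(** [Inn(E)] acts trivially on the Frattini quotient. Conversely the kernel of the action is a
    p-group by [Aut_Phi_pgroup], so its image in the outer group is a normal p-subgroup and vanishes
    by strong embedding. Hence the outer group acts faithfully. *)
Lemma essential_linear : #|N : E| = p /\
  exists (G : {group {perm gT}}) (rG : mx_representation 'F_p G 3) (r : gT -> 'rV['F_p]_3) (u : gT),
  [/\ G :=: AutF F E,
      [/\ {in E &, forall x y, r (x * y)%g = r x + r y}, {in E, forall x, (r x == 0) = (x \in 'Phi(E))},
          (forall v, exists2 x, x \in E & r x = v) &
          forall (a : {perm gT}) x, a \in G -> x \in E -> r (a x) = r x *m rG a],
      forall a, a \in G -> rG a = 1%:M -> a \in conj_aut E @* E,
      u \in N /\ u \notin E &
      (rG (conj_aut E u) - 1) ^+ 3 = 0 /\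
      (has_torus rG (conj_aut E u) \/ (rG (conj_aut E u) - 1) ^+ 2 != 0 /\ mx_irreducible rG)].
Proof.
have fusF : is_fusion_system S F by case: satF.
case: essE => _ sES fnE [H emb].
have [cSE _] : 'C_S(E) \subset E /\ True.
  split=> //; have [] := fnE E; last by [].
  exists (finfun id); split; first exact: (fus_id fusF sES).
  by rewrite finfun_imset imset_id.
pose G := Group (AutF_group_set fusF sES).
have sGA : G \subset Aut E := AutF_sub F E.
have pE := pgroupS sES pS.
have iE : #|E : 'Phi(E)| = (p ^ 3)%N by rewrite (card_Phi_quotient p_pr pE) -mgrankE rkE.
have [rG [r [rM r0 rs rE]]] := Aut_Frattini_repr p_pr pE iE sGA.
have gI : group_set (InnP E) by rewrite InnPE groupP.
pose I := Group gI; have IE : I = conj_aut E @* E :> {set _} := InnPE E.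
have sEN : E \subset N by rewrite subsetI sES normG.
have sUG : conj_aut E @* N \subset G by have := AutS_sub_AutF fusF sES; rewrite AutSE.
have sIG : I \subset G by rewrite IE (subset_trans _ sUG) ?morphimS.
have nIG : G \subset 'N(I).
  apply/subsetP=> a Ga; have Aa := subsetP sGA a Ga; rewrite inE.
  apply/subsetP=> _ /imsetP[b Ib ->]; move: Ib; rewrite IE => /morphimP[y ny Ey ->].
  by rewrite conj_autJ // mem_morphim ?(subsetP (normG E)) ?Aut_closed.
have nIG' : I <| G by apply/andP.
have rV := coordV rM r0.
have pK : p.-group (rker rG).
  apply: (Aut_Phi_pgroup p_pr pE (subset_trans (rstab_sub _ _) sGA)) => a x /rkerP[Ga ra] Ex.
  have Eax : a x \in E by apply: Aut_closed => //; apply: (subsetP sGA).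
  by rewrite -r0 ?groupM ?groupV // rM ?groupV // rV // rE // ra mulmx1 addNr.
have gH : group_set H by case/and4P: emb.
have embG : strongly_p_embedded p (G / I)%G (Group gH) := emb.
have sKI : rker rG \subset I.
  have nIK := subset_trans (rstab_sub _ _) nIG : rker rG \subset 'N(I).
  rewrite -quotient_sub1 //.
  have -> // : (rker rG / I)%g = 1%g.
  apply: (se_pcore1 p_pr embG); last exact: quotient_pgroup.
  exact: quotient_normal (rker_normal rG).
have sIK : I \subset rker rG.
  apply/subsetP=> a Ia; have Ga := subsetP sIG a Ia; apply/rkerP; split=> //.
  move: Ia; rewrite IE => /morphimP[y ny Ey eqa].
  apply/row_matrixP=> i; rewrite rowE [RHS]rowE mulmx1; have [x Ex <-] := rs (delta_mx 0 i).
  rewrite -rE // eqa conj_autE // conjgE.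
  by rewrite !rM ?groupM ?groupV // rV // addrCA addNr addr0.
pose rGI := quo_repr sIK nIG.
have faith : mx_faithful rGI.
  apply/subsetP=> _ /rkerP[/morphimP[a na Ga ->]]; rewrite quo_repr_coset // => ra.
  by apply/set1P/coset_id; apply: (subsetP sKI); apply/rkerP.
pose U := (conj_aut E @* N / I)%G.
have sIN : I \subset conj_aut E @* N by rewrite IE morphimS.
have pU : p.-group U by rewrite quotient_pgroup // morphim_pgroup // (pgroupS (subsetIl _ _)).
have sUGI : U \subset (G / I)%G by rewrite quotientS.
(* [E] contains its centraliser in [S], so passing to automorphisms modulo inner ones loses nothing
   of [N / E]. *)
have cU : #|U| = #|N : E|.
  rewrite card_quotient ?(subset_trans sUG) // IE.
  have := index_morphim_ker (conj_aut_morphism E) sEN (subsetIr _ _).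
  have -> : #|'ker_N (conj_aut E) : E| = 1%N; last by rewrite muln1.
  apply/eqP; rewrite indexg_eq1; apply: subset_trans cSE.
  by apply: setISS; [apply: subsetIl | rewrite -ker_conj_aut; exact: subxx].
have ltEN : ~~ (N \subset E).
  have ltES : E \proper S by rewrite properE sES; apply: contra nsSN => sSE; rewrite (subset_trans sSE) ?normG.
  by case/andP: (nilpotent_proper_norm (pgroup_nil pS) ltES).
have ntU : U :!=: 1%g by rewrite -cardG_gt1 cU indexg_gt1.
have [z [defU zp z3 alt]] := linear_alternative p_pr p_ge5 faith embG pU sUGI ntU.
have ntz : z != 1%g by rewrite -cycle_eq1 -defU.
split; first by rewrite -cU defU -orderE; apply: nt_prime_order.
have : z \in U by rewrite defU cycle_id.
case/morphimP=> b nb Ub zE; case/morphimP: (Ub) => u nu Nu bE.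
exists G, rG, r, u; split=> //.
- by move=> a Ga ra; rewrite -IE; apply: (subsetP sKI); apply/rkerP.
- split=> //; apply: contra ntz => Eu; rewrite zE bE; apply/eqP/coset_id.
  by rewrite IE mem_morphim.
have Gb : b \in G := subsetP sUG b Ub.
have rz : rGI z = rG (conj_aut E u) by rewrite zE quo_repr_coset // bE.
rewrite -rz; split=> //; case: alt => [[B uB [Bz tor]] | [nz2 irr]]; [left | right].
  exists B => //; rewrite -rz; split=> // l /tor[_ /morphimP[a na Ga ->]].
  by rewrite quo_repr_coset // => Ba; exists a.
by split=> //; have [irrE _] := quo_mx_irr sIK nIG; apply: irrE.
Qed.

End Essential.

Lemma eqn_mod_Fp p m n : prime p -> (m == n %[mod p]) = (m%:R == n%:R :> 'F_p).
Proof.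
move=> p_pr; rewrite -val_eqE /= !val_Fp_nat //.
Qed.

(** A primitive root has order p - 1, which is at least 4 and does not divide 5, as 6 is not prime.
    The exponent 5 comes from the weights l^3 on M / N and l^2 on L / Z. *)
Lemma Fp_torus_generator p : prime p -> (5 <= p)%N ->
  exists l : 'F_p, [/\ l != 0, l != 1, l ^+ 2 != 1, l ^+ 3 != 1 & l ^+ 5 != 1].
Proof.
move=> p_pr p_ge5; pose rs := [seq x <- enum 'F_p | x != 0].
have n0 : (0 < p.-1)%N by rewrite -subn1 subn_gt0 prime_gt1.
have szrs : (p.-1 <= size rs)%N.
  rewrite size_filter; have := count_predC (fun x : 'F_p => x == 0) (enum 'F_p).
  rewrite -cardE card_Fp //.
  have -> : count (fun x : 'F_p => x == 0) (enum 'F_p) = 1%N.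
    by rewrite -[LHS]/(count_mem 0 _) count_uniq_mem ?enum_uniq // mem_enum.
  by move=> cnt; rewrite -subn1 leq_subLR; apply/eq_leq/esym.
have unity : all p.-1.-unity_root rs.
  apply/allP=> x; rewrite mem_filter => /andP[nzx _]; apply/unity_rootP.
  apply: (mulfI nzx); rewrite -exprS prednK ?prime_gt0 // mulr1.
  by rewrite -[x]natr_Zp -natrX; apply/eqP; rewrite -eqn_mod_Fp //; apply/eqP/fermat_little.
have /hasP[l rsl prim] := has_prim_root n0 unity (filter_uniq _ (enum_uniq _)) szrs.
have nzl : l != 0 by move: rsl; rewrite mem_filter => /andP[].
have not1 m : ~~ (p.-1 %| m)%N -> l ^+ m != 1 by rewrite (prim_order_dvd prim).
exists l; split=> //; first rewrite -[l]expr1.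
- by apply: not1; rewrite gtnNdvd // -ltnS prednK ?prime_gt0 // (leq_trans _ p_ge5).
- by apply: not1; rewrite gtnNdvd // -ltnS prednK ?prime_gt0 // (leq_trans _ p_ge5).
- by apply: not1; rewrite gtnNdvd // -ltnS prednK ?prime_gt0 // (leq_trans _ p_ge5).
apply: not1; apply/negP=> dv5; have := dvdn_leq (isT : (0 < 5)%N) dv5.
move: dv5 p_pr p_ge5; move: (p) => [|[|[|[|[|[|[|]]]]]]] //.
Qed.

Lemma mx3row_inj (R : comNzRingType) (u v w u' v' w' : 'rV[R]_3) :
  mx3row u v w = mx3row u' v' w' -> [/\ u = u', v = v' & w = w'].
Proof.
move=> eqB; have := (congr1 (row 0) eqB, congr1 (row 1) eqB, congr1 (row 2%:R) eqB).
by rewrite !mx3row_row0 !mx3row_row1 !mx3row_row2 => -[[-> ->] ->].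
Qed.

(** * From the linear alternative back to the two group configurations *)

Section EssentialCases.
Variables (gT : finGroupType) (p : nat) (S E : {group gT}).
Variable F : {set gT} -> {ffun gT -> gT} -> bool.
Hypotheses (p_pr : prime p) (p_ge5 : (5 <= p)%N).
Hypotheses (pS : p.-group S) (secS : sections_le3 p S) (satF : saturated F p S).
Hypotheses (sES : E \subset S) (cSE : 'C_S(E) \subset E) (fnE : fully_normalized F S E).
Hypothesis nsSN : ~~ (S \subset 'N(E)).

Let N := 'N_S(E)%G.
Variables (G : {group {perm gT}}) (rG : mx_representation 'F_p G 3) (r : gT -> 'rV['F_p]_3) (u : gT).
Hypotheses (iNE : #|N : E| = p) (iE : #|E : 'Phi(E)| = (p ^ 3)%N) (defG : G :=: AutF F E).
Hypotheses (rM : {in E &, forall x y, r (x * y)%g = r x + r y}).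
Hypotheses (r0 : {in E, forall x, (r x == 0) = (x \in 'Phi(E))}).
Hypothesis rs : forall v, exists2 x, x \in E & r x = v.
Hypothesis rE : forall (a : {perm gT}) x, a \in G -> x \in E -> r (a x) = r x *m rG a.
Hypothesis kerG : forall a, a \in G -> rG a = 1%:M -> a \in conj_aut E @* E.
Hypotheses (Nu : u \in N) (notEu : u \notin E).

Let fusF : is_fusion_system S F. Proof. by case: satF. Qed.
Let pE : p.-group E := pgroupS sES pS.
Let sGA : G \subset Aut E. Proof. by rewrite defG AutF_sub. Qed.
Let nEN : E <| N. Proof. exact: normalSG. Qed.
Let sEN := normal_sub nEN.
Let sNS : N \subset S. Proof. exact: subsetIl. Qed.
Let pN := pgroupS sNS pS.
Let prNE : prime #|N : E|. Proof. by rewrite iNE. Qed.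
Let EEP : [~: E, E] \subset 'Phi(E).
Proof. exact: der_sub_Phi pE. Qed.
Let nPN : 'Phi(E) <| N.
Proof. exact: char_normal_trans (Phi_char E) nEN. Qed.
Let sPE := Phi_sub E.

Let T := rG (conj_aut E u).

Lemma conj_autG n : n \in N -> conj_aut E n \in G.
Proof. by move=> Nn; rewrite defG (subsetP (AutS_sub_AutF fusF sES)) //; apply/AutS_P; exists n. Qed.

Lemma coordJ x n : x \in E -> n \in N -> r (x ^ n)%g = r x *m rG (conj_aut E n).
Proof.
move=> Ex Nn; rewrite -rE ?conj_autG // norm_conj_autE //.
exact: (subsetP (normal_norm nEN)).
Qed.

Lemma coordR x : x \in E -> r [~ x, u]%g = r x *m (T - 1).
Proof.
move=> Ex; have Exu : (x ^ u)%g \in E by rewrite memJ_norm ?(subsetP (normal_norm nEN)).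
by rewrite /commg rM ?groupV // (coordV rM r0) // coordJ // mulmxBr mulmx1 addrC.
Qed.

Lemma comm_into (X Y : {group gT}) : X \subset E -> 'Phi(E) \subset Y -> N \subset 'N(Y) ->
  (forall x, x \in X -> [~ x, u]%g \in Y) -> [~: X, N] \subset Y.
Proof.
move=> sXE sPY nYN XY; rewrite gen_subG; apply/subsetP=> _ /imset2P[x n Xx Nn ->].
apply: (comm_step_r nYN sEN prNE Nu notEu (XY x Xx)) => // m Em.
by apply: (subsetP (subset_trans EEP sPY)); rewrite mem_commg // (subsetP sXE x Xx).
Qed.

Lemma comm_normal (X Y : {group gT}) : X \subset N -> Y \subset X -> [~: X, N] \subset Y -> X <| N.
Proof. by move=> sXN sYX XNY; rewrite /normal sXN -commg_subl (subset_trans XNY). Qed.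

Lemma kerN n : n \in N -> conj_aut E n \in conj_aut E @* E -> n \in E.
Proof.
move=> Nn /morphimP[y ny Ey eqny]; have nEn := subsetP (normal_norm nEN) n Nn.
have Ny := subsetP sEN y Ey.
have cny : (n * y^-1)%g \in 'C(E).
  apply/centP=> x Ex; apply: commute_sym; apply/commgP/conjg_fixP; rewrite conjgM.
  have : conj_aut E n x = conj_aut E y x by rewrite eqny.
  by rewrite !norm_conj_autE // => ->; rewrite conjgK.
rewrite -(mulgKV y n) groupM // (subsetP cSE) // inE cny andbT.
by rewrite (subsetP sNS) ?groupM ?groupV.
Qed.

Let p_odd : odd p. Proof. by case/even_prime: p_pr p_ge5 => // ->. Qed.

Lemma torus_case : has_torus rG (conj_aut E u) -> False.
Proof.
case=> B uB [BT tor]; have [l [nzl l1 l2 l3 l5]] := Fp_torus_generator p_pr p_ge5.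
have [t Gt Bt] := tor l nzl.
have [e Ee re] := rs (row 0 B); have [d Ed rd] := rs (row 1 B); have [w Ew rw] := rs (row 2%:R B).
have defB : B = mx3row (r e) (r d) (r w) by rewrite re rd rw -mx3rowE.
rewrite {B re rd rw}defB in uB BT tor Bt.
move: BT Bt; rewrite !mx3row_mul !mx3_mulrow.
move=> /mx3row_inj[eT dT wT] /mx3row_inj[et dt wt].
move: eT dT wT et dt wt; rewrite !scale1r !scale0r !addr0 !add0r => eT dT wT et dt wt.
have ind := indep3_unitmx uB.
have [D [Z [[sPD sDZ sZE] [iEZ iZD iDP] [Dd Zw notZe] memD memZ]]] :=
  coord_flag p_pr pE rM r0 iE Ee Ed Ew ind.
have sPZ := subset_trans sPD sDZ; have sDE := subset_trans sDZ sZE.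
have nzd : r d != 0.
  apply/eqP=> rd; have [] := ind 0 1 0; last by move=> _ /eqP; rewrite oner_eq0.
  by rewrite !scale0r rd scaler0 !addr0.
have ZNP : [~: Z, N] \subset 'Phi(E).
  apply: comm_into => //; first exact: normal_norm.
  move=> x Zx; have Ex := subsetP sZE x Zx; have [b [c rx]] := proj1 (memZ x Ex) Zx.
  have Exu : [~ x, u]%g \in E by rewrite groupM ?groupV // memJ_norm ?(subsetP (normal_norm nEN)).
  by rewrite -r0 // coordR // mulmxBr mulmx1 rx mulmxDl -!scalemxAl wT dT subrr.
have nZN : Z <| N := comm_normal (subset_trans sZE sEN) sPZ ZNP.
have nDN : D <| N.
  apply: (comm_normal (subset_trans sDE sEN) sPD); apply: subset_trans ZNP; exact: commSg.
have END : [~: E, N] \subset D.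
  apply: comm_into => //; first exact: normal_norm.
  move=> x Ex; have [b [c [f rx]]] := indep3_span (r x) uB.
  have Exu : [~ x, u]%g \in E by rewrite groupM ?groupV // memJ_norm ?(subsetP (normal_norm nEN)).
  apply/(memD _ Exu); exists b; rewrite coordR // mulmxBr mulmx1 rx !mulmxDl -!scalemxAl eT dT wT.
  by apply/rowP=> i; rewrite !mxE; ring.
have nENP : ~~ ([~: E, N] \subset 'Phi(E)).
  apply: contra nzd => ENP; have Peu : [~ e, u]%g \in 'Phi(E) by rewrite (subsetP ENP) ?mem_commg.
  have Eeu := subsetP sPE _ Peu; move: Peu; rewrite -r0 // coordR // mulmxBr mulmx1 eT.
  by rewrite addrC addKr.
have AutEt := subsetP sGA t Gt.
have tE x : x \in E -> t x \in E by apply: Aut_closed.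
have wr v (c : 'F_p) : v \in E -> r (v ^- c * t v)%g = r v *m rG t - c *: r v.
  by move=> Ev; rewrite rM ?groupV ?groupX ?tE // (coordV rM r0) ?groupX // (coordZ rM r0) // rE // addrC.
have wrE v (c : nat) : v \in E -> (v ^- c * t v)%g \in E by move=> Ev; rewrite groupM ?groupV ?groupX ?tE.
have wD : weight t D 'Phi(E) l.
  move=> v Dv; have Ev := subsetP sDE v Dv; have [b rv] := proj1 (memD v Ev) Dv.
  by rewrite -r0 ?wrE // wr // rv -scalemxAl dt !scalerA mulrC subrr.
have wZ : weight t Z D 1.
  move=> v Zv; have Ev := subsetP sZE v Zv; have [b [c rv]] := proj1 (memZ v Ev) Zv.
  apply/(memD _ (wrE v 1%N Ev)); exists (c * (l - 1)).
  rewrite rM ?groupV ?tE // (coordV rM r0) // rE // rv mulmxDl -!scalemxAl dt wt.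
  by apply/rowP=> i; rewrite !mxE; ring.
have wE : weight t E Z (l^-1 : 'F_p).
  move=> v Ev; have [b [c [f rv]]] := indep3_span (r v) uB.
  apply/(memZ _ (wrE v _ Ev)); exists (f * (1 - l^-1)), (c * (l - l^-1)).
  rewrite wr // rv !mulmxDl -!scalemxAl et dt wt.
  by apply/rowP=> i; rewrite !mxE; ring.
pose cu := conj_aut E u; have Gcu : cu \in G by apply: conj_autG.
have nEu : u \in 'N(E) := subsetP (normal_norm nEN) u Nu.
(* [u] adds [d] to [e] in coordinates, and [t] scales [e] by l^-1 and [d] by l, so conjugation by
   [t] multiplies the added vector by l / l^-1 = l^2. *)
pose m := ((l : nat) ^ 2)%N; have mE : m%:R = l ^+ 2 by rewrite natrX natr_Zp.
have eTn n : r e *m T ^+ n = r e + n%:R *: r d.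
  elim: n => [|n IH]; first by rewrite expr0 mulmx1 scale0r addr0.
  by rewrite exprSr -[_ * T]/(_ *m T) mulmxA IH mulmxDl -scalemxAl eT dT -addrA -natr1 scalerDl scale1r [r d + _]addrC.
have fixTn (v : 'rV_3) n : v *m T = v -> v *m T ^+ n = v.
  by move=> vT; elim: n => [|n IH]; rewrite ?mulmx1 // exprSr -[_ * T]/(_ *m T) mulmxA IH.
have comT : rG (cu * t)%g = rG (t * cu ^+ m)%g.
  rewrite !repr_mxM ?groupX // repr_mxX //; apply: (can_inj (mulKmx uB)).
  rewrite !mulmxA !mx3row_mul.
  rewrite eT dT wT et dt wt -!scalemxAl eTn !(fixTn (r d)) ?(fixTn (r w)) //.
  congr mx3row; rewrite mulmxDl et dt scalerDr scalerA mE.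
  by rewrite expr2 mulrA mulVf // mul1r.
have kerT : (cu ^- m * cu ^ t)%g \in conj_aut E @* E.
  apply: kerG; first by rewrite groupM ?groupV ?groupX ?groupJ.
  rewrite conjgE repr_mxM ?groupV ?groupX ?groupM //; last by rewrite groupV.
  rewrite (repr_mxM rG (groupVr Gt)) ?groupM // comT -repr_mxM ?groupV ?groupM ?groupX //.
  by rewrite mulKg -repr_mxM ?groupV ?groupX // mulVg repr_mx1.
pose U := (conj_aut E @* N)%G.
have sEU : conj_aut E @* E \subset U by apply: morphimS.
have Ucu : cu \in U by apply: mem_morphim.
have FtE : t \in AutF F E by rewrite -defG.
(* The elements of [N] whose action on [E] is carried back into [Aut_S(E)] by [t]. This subgroup
   contains [E] and [u], so it is [N], and [t] extends to [N]. *)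
pose K := [set x in N | (conj_aut E x ^ t)%g \in U].
have gK : group_set K.
  apply/group_setP; split; first by rewrite inE group1 morph1 conj1g group1.
  move=> x y /setIdP[Nx Ux] /setIdP[Ny Uy]; apply/setIdP; split; first exact: groupM.
  by rewrite morphM ?(subsetP (normal_norm nEN)) //= conjMg groupM.
have sKN : K \subset N by apply/subsetP=> x /setIdP[].
have sEK : E \subset K.
  apply/subsetP=> x Ex; apply/setIdP; split; first exact: (subsetP sEN).
  rewrite conj_autJ //; apply: (subsetP sEU); apply: mem_morphim; last exact: tE.
  by apply: (subsetP (normG E)); apply: tE.
have Ku : u \in K.
  apply/setIdP; split=> //; rewrite -(mulKVg (cu ^+ m)%g (cu ^ t)%g).
  by rewrite groupM ?groupX // (subsetP sEU).
have defK := prime_index_eq (K := Group gK) prNE sEN sEK sKN Ku notEu.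
have [||f Ff ft] := @saturated_extend _ p S E N F t satF sES fnE FtE.
- exact: subxx.
- move=> x Nx; have : x \in Group gK by rewrite defK.
  case/setIdP=> _ /morphimP[h nh Nh eh]; exists h => // y Ey.
  have nx := subsetP (normal_norm nEN) x Nx.
  by rewrite -(norm_conj_autE nh) ?tE // -eh permJ norm_conj_autE.
have [_ _ fM finj fS] := fus_mor fusF Ff.
have fJ n y : n \in N -> y \in E -> (t y ^ f n = t (y ^ n))%g.
  move=> Nn Ey; have Ny := subsetP sEN y Ey; have Eyn : (y ^ n)%g \in E.
    by rewrite memJ_norm ?(subsetP (normal_norm nEN)).
  rewrite -!ft // !conjgE -(weight_idV fM) // -fM // -fM ?groupV ?groupM //.
have fN : f @: N = N.
  apply/eqP; rewrite eqEcard (card_in_imset finj) leqnn andbT; apply/subsetP=> _ /imsetP[n Nn ->].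
  rewrite inE (subsetP fS) ?imset_f //= inE; apply/subsetP=> _ /imsetP[y Ey ->].
  move: Ey; rewrite -{1}(Aut_imset AutEt) => /imsetP[x Ex ->]; rewrite fJ // tE //.
  by rewrite memJ_norm ?(subsetP (normal_norm nEN)).
have [a Aa af] := fus_aut fusF Ff fN.
have at_ : {in E, a =1 t} by move=> x Ex; rewrite af ?ft // (subsetP sEN).
have aM := Aut_morph (subsetP (AutF_sub F N) a Aa).
have Nau : a u \in N by apply: Aut_closed Nu; apply: (subsetP (AutF_sub F N)).
have conj_au : conj_aut E (a u) = (cu ^ t)%g.
  have Nfu : f u \in N by rewrite -af.
  apply: (eq_Aut (A := E)); [exact: Aut_aut | exact: (groupJ (Aut_aut _ _) AutEt) | move=> x].
  rewrite -{1}(Aut_imset AutEt) => /imsetP[y Ey ->]; rewrite permJ norm_conj_autE ?tE //.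
    by rewrite norm_conj_autE // af // fJ.
  exact: (subsetP (normal_norm nEN)).
have wN : weight a N E m.
  apply: (weight_gen aM (C := E) (x := u)) => //.
  - exact: normal_norm.
  - exact: (step_central p_pr pN).
  - by move=> x Ex; rewrite at_ // groupM ?groupV ?groupX ?tE.
  have Num : (u ^- m)%g \in N by rewrite groupV groupX.
  have nNE n : n \in N -> n \in 'N(E) by apply/subsetP/normal_norm.
  apply: kerN; first exact: groupM.
  by rewrite morphM ?nNE //= morphV ?nNE ?groupX //= morphX //= conj_au.
apply: (@fusion_configuration_false gT p l (l^-1 : 'F_p) S N E Z D 'Phi(E)%G F a) => //.
- by apply: contra nsSN => sSN; apply: subset_trans sSN (normal_norm nEN).
- by move=> y; apply: expg_Phi.
- by apply: eq_weight wD => x Dx; rewrite at_ ?(subsetP sDE).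
- by apply: eq_weight wZ => x Zx; rewrite at_ ?(subsetP sZE).
- by apply: eq_weight wE => x Ex; rewrite at_.
- by apply/eqP; rewrite eqn_mod_Fp // natrM !natr_Zp mulVf.
- rewrite eqn_mod_Fp // natrX !natr_Zp; apply: contra l1 => /eqP h.
  by apply/eqP/(mulfI nzl); rewrite mulr1 -expr2.
- by rewrite eqn_mod_Fp // natrX !natr_Zp eq_sym.
- rewrite eqn_mod_Fp // natrX !natr_Zp; apply: contra l2 => /eqP h.
  by apply/eqP/(mulfI nzl); rewrite mulr1 -exprS.
- by rewrite eqn_mod_Fp // natrX !natr_Zp eq_sym.
- rewrite eqn_mod_Fp // !natrX !natr_Zp; apply: contra l1 => /eqP h.
  by apply/eqP/(mulfI (expf_neq0 2 nzl)); rewrite mulr1 -exprSr.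
- by rewrite eqn_mod_Fp // natrX !natr_Zp eq_sym.
rewrite eqn_mod_Fp // natrX !natr_Zp; apply: contra l3 => /eqP h.
by rewrite exprS -h mulfV.
Qed.

Lemma irreducible_subgroups (X : {group gT}) : mx_irreducible rG ->
  'Phi(E) \subset X -> X \subset E ->
  (forall (a : {perm gT}) x, a \in AutF F E -> x \in X -> a x \in X) ->
  X :=: 'Phi(E) \/ X :=: E.
Proof.
case/mx_irrP=> _ irr sPX sXE stX.
have [sXP | /subsetPn[x0 Xx0 notPx0]] := boolP (X \subset 'Phi(E)).
  by left; apply/eqP; rewrite eqEsubset sXP.
right; apply/eqP; rewrite eqEsubset sXE; apply/subsetP=> y Ey.
have EX x : x \in X -> x \in E by apply/subsetP.
(* Scalars are residues modulo p, so multiples of [r x] come from powers of [x]: [W] has no other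
   vectors than the coordinates of [X]. *)
pose W := (\sum_(x in X) <<r x>>)%MS.
have sW x : x \in X -> (r x <= W)%MS.
  by move=> Xx; rewrite -genmxE; apply: (sumsmx_sup x).
have modW : mxmodule rG W.
  apply/mxmoduleP=> a Ga; rewrite sumsmxMr; apply/sumsmx_subP=> x Xx.
  rewrite (eqmxMr _ (genmxE _)) -rE ?EX //; apply: sW.
  by apply: stX => //; rewrite -defG.
have ntW : W != 0.
  apply: contraNneq notPx0 => W0; rewrite -r0 ?EX //.
  by have := sW x0 Xx0; rewrite W0 submx0.
have /sub_sumsmxP[v ry] : (r y <= W)%MS by apply/submx_full/irr.
have [x Xx rx] : exists2 x, x \in X & r x = r y.
  rewrite ry; elim/big_ind: _ => [|_ _ [x Xx <-] [x' Xx' <-]|x Xx].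
  - by exists 1%g; rewrite ?group1 ?(coord1 r0).
  - by exists (x * x')%g; [exact: groupM | rewrite rM ?EX].
  have : (v x *m <<r x>> <= r x)%MS by apply: submx_trans (submxMl _ _) _; rewrite genmxE.
  by case/sub_rVP=> a ->; exists (x ^+ a)%g; rewrite ?groupX // (coordZ rM r0) ?EX.
by apply: (coord_mem rM r0 sPX sXE Ey Xx).
Qed.

Lemma irreducible_case :
  (T - 1) ^+ 3 = 0 -> (T - 1) ^+ 2 != 0 -> mx_irreducible rG -> False.
Proof.
move=> N3 nz2 irr; have [v nzv] := exists_mulmx_neq0 nz2.
have uB := regular_basis N3 nzv; have [e Ee re] := rs v.
pose c := [~ e, u]%g; pose d := [~ c, u]%g.
have EuE x : x \in E -> [~ x, u]%g \in E.
  by move=> Ex; rewrite groupM ?groupV // memJ_norm ?(subsetP (normal_norm nEN)).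
have Ec : c \in E by apply: EuE.
have Ed : d \in E by apply: EuE.
have rc : r c = v *m (T - 1) by rewrite coordR // re.
have rd : r d = v *m (T - 1) *m (T - 1) by rewrite coordR // rc.
have eT : r e *m (T - 1) = r c by rewrite re rc.
have cT : r c *m (T - 1) = r d by rewrite rc rd.
have dT : r d *m (T - 1) = 0.
  by rewrite rd -!mulmxA !mulmxE -!expr2 -exprS N3 mulmx0.
have uB' : mx3row (r e) (r c) (r d) \in unitmx by rewrite rd rc re.
have ind : indep3 (r e) (r d) (r c).
  by move=> x y z eq0; have [] := indep3_unitmx uB' (a := x) (b := z) (c := y); rewrite // addrAC.
have [D [Z [[sPD sDZ sZE] [iEZ iZD iDP] [Dd Zc _] memD memZ]]] :=
  coord_flag p_pr pE rM r0 iE Ee Ed Ec ind.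
have sPZ := subset_trans sPD sDZ; have sDE := subset_trans sDZ sZE.
have DNP : [~: D, N] \subset 'Phi(E).
  apply: comm_into => //; first exact: normal_norm.
  move=> x Dx; have Ex := subsetP sDE x Dx; have [b rx] := proj1 (memD x Ex) Dx.
  by rewrite -r0 ?EuE // coordR // rx -scalemxAl dT scaler0.
have nDN : D <| N := comm_normal (subset_trans sDE sEN) sPD DNP.
have ZND : [~: Z, N] \subset D.
  apply: comm_into => //; first exact: normal_norm.
  move=> x Zx; have Ex := subsetP sZE x Zx; have [b [b' rx]] := proj1 (memZ x Ex) Zx.
  apply/(memD _ (EuE x Ex)); exists b.
  by rewrite coordR // rx mulmxDl -!scalemxAl cT dT scaler0 addr0.
have nZN : Z <| N := comm_normal (subset_trans sZE sEN) sDZ ZND.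
have ENZ : [~: E, N] \subset Z.
  apply: comm_into => //; first exact: normal_norm.
  move=> x Ex; have [b [b' [b'' rx]]] := indep3_span (r x) uB'.
  apply/(memZ _ (EuE x Ex)); exists b, b'.
  by rewrite coordR // rx !mulmxDl -!scalemxAl eT cT dT scaler0 addr0.
have Nsub x : x \in E -> x \in N by apply/subsetP.
have defI : Z :=: [~: E, N] <*> 'Phi(E).
  apply/eqP; rewrite eqEsubset [X in _ && X]join_subG ENZ sPZ !andbT; apply/subsetP=> x Zx.
  have Ex := subsetP sZE x Zx; have [b [b' rx]] := proj1 (memZ x Ex) Zx.
  have sI : [~: E, N] \subset [~: E, N] <*> 'Phi(E) := joing_subl _ _.
  have Ic : c \in [~: E, N] <*> 'Phi(E) by rewrite (subsetP sI) ?mem_commg.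
  have Id : d \in [~: E, N] <*> 'Phi(E) by rewrite (subsetP sI) ?mem_commg.
  apply: (coord_mem rM r0 (X := [~: E, N] <*> 'Phi(E)) (joing_subr _ _) _ Ex (groupM (groupX b Ic) (groupX b' Id))).
    by rewrite join_subG sPE (subset_trans ENZ).
  by rewrite rM ?groupX // !(coordZ rM r0).
have defJ : D :=: [~: Z, N] <*> 'Phi(E).
  apply/eqP; rewrite eqEsubset [X in _ && X]join_subG ZND sPD !andbT; apply/subsetP=> x Dx.
  have Ex := subsetP sDE x Dx; have [b rx] := proj1 (memD x Ex) Dx.
  have Jd : d \in [~: Z, N] <*> 'Phi(E) by rewrite (subsetP (joing_subl _ _)) ?mem_commg.
  apply: (coord_mem rM r0 (X := [~: Z, N] <*> 'Phi(E)) (joing_subr _ _) _ Ex (groupX b Jd)).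
    by rewrite join_subG sPE (subset_trans ZND).
  by rewrite (coordZ rM r0).
have ltNS : N \proper S.
  rewrite properE sNS; apply: contra nsSN => sSN; exact: subset_trans sSN (normal_norm nEN).
(* Normalisers grow in a nilpotent group; an element outside [N = 'N_S(E)] cannot fix [E]. *)
have [_ /subsetPn[g /setIP[Sg nNg] notNg]] := andP (nilpotent_proper_norm (pgroup_nil pS) ltNS).
have nEg : E :^ g != E.
  apply: contra notNg => /eqP Eg; apply/setIP; split=> //; rewrite inE; by rewrite Eg.
apply: (@irreducible_case_false gT p S E N g (AutF F E)) => //; rewrite -?defI -?defJ //.
- exact: AutF_sub.
by move=> X; apply: irreducible_subgroups.
Qed.

End EssentialCases.

Local Close Scope ring_scope.

Theorem theorem6p6 (gT : finGroupType) (p : nat) (S : {group gT})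
    (F : {set gT} -> {ffun gT -> gT} -> bool) :
  prime p -> 5 <= p -> p.-group S -> sectional_rank S = 3 ->
  saturated F p S ->
  forall E : {group gT}, essential p S F E -> grank E = 3 -> E <| S.
Proof.
move=> p_pr p_ge5 pS rS satF E essE rkE.
have [_ sES fnE _] := essE; rewrite /normal sES; apply: contraT => nsSN.
have pE := pgroupS sES pS; have fusF : is_fusion_system S F by case: satF.
have secS : sections_le3 p S by apply: sections_le3_of_rank => //; rewrite rS.
have [cSE _] : 'C_S(E) \subset E /\ #|'N_S(E)| <= #|'N_S(E)|.
  apply: fnE; exists (finfun id); split; first exact: (fus_id fusF sES).
  by rewrite finfun_imset imset_id.
have fnE' : fully_normalized F S E by move=> Q /fnE[].
have iE : #|E : 'Phi(E)| = (p ^ 3)%N by rewrite (card_Phi_quotient p_pr pE) -mgrankE rkE.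
have [iNE [G [rG [r [u [defG [rM r0 rs rE] kerG [Nu notEu] [N3 alt]]]]]]] :=
  essential_linear p_pr p_ge5 pS satF essE rkE nsSN.
exfalso; case: alt => [tor | [nz2 irr]].
  exact: (torus_case p_pr p_ge5 pS secS satF sES cSE fnE' nsSN iNE iE defG rM r0 rs rE kerG Nu notEu tor).
exact: (irreducible_case p_pr p_ge5 pS secS satF sES nsSN iNE iE defG rM r0 rs rE Nu notEu N3 nz2 irr).
Qed.
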